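(* Let $\Gamma$ be a compact finite (not necessarily connected) metric graph, let $A_N$ be the self-adjoint Neumann (Kirchhoff) Laplacian in $L^2(\Gamma)$, and let $V\neq 0$ be a nonnegative function such that $V\in L^p(\Gamma)$ with $p\ge 2$. Then, for every $\alpha\in\mathbb{R}$, the operator $$(A_N+\alpha V)f=A_Nf+\alpha Vf,\quad f\in\operatorname{dom}(A_N+\alpha V)=\operatorname{dom}(A_N),$$ is self-adjoint in $L^2(\Gamma)$; the operator $V(A_N-zI)^{-1}$ is compact in $L^2(\Gamma)$ for every $z\in\rho(A_N)$; and $$\sigma(A_N+\alpha V)\cap(-\infty,0)\neq\emptyset\quad\text{for any }\alpha<0.$$
   Context: A compact finite graph $\Gamma$ consists of $e<\infty$ edges $\mathcal{E}_n$, $n=1,\dots,e$, which are finite (compact, nondegenerate) intervals, and $v<\infty$ vertices $\mathcal{V}_m$, $m=1,\dots,v$; the vertices are the (nonempty) classes of a partition of the set of all $2e$ edge endpoints, and endpoints in the same class are identified. One sets $L^2(\Gamma)=\bigoplus_{n=1}^e L^2(\mathcal{E}_n)$, and $L^p(\Gamma)$ consists analogously of functions whose restriction to each edge $\mathcal{E}_n$ is in $L^p(\mathcal{E}_n)$. For $g=(g_n)_{n=1}^e$ with $g_n\in H^2(\mathcal{E}_n)$ and an endpoint $x_j$ of an edge $\mathcal{E}_n$, $g(x_j)$ is the value of $g_n$ at $x_j$ and $\partial g(x_j)$ is the derivative of $g_n$ at $x_j$ taken in the direction pointing from the endpoint into the edge (i.e., $g_n'(x_j)$ at a left endpoint and $-g_n'(x_j)$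 at a right endpoint). The Neumann (or Kirchhoff) Laplacian is the self-adjoint operator in $L^2(\Gamma)$ given by $A_Nf=(-f_n'')_{n=1}^e$ with $\operatorname{dom}(A_N)$ the set of all $g=(g_n)_{n=1}^e$ with $g_n\in H^2(\mathcal{E}_n)$ such that, for every $m=1,\dots,v$, one has $g(x_i)=g(x_j)$ for all $x_i,x_j\in\mathcal{V}_m$ and $\sum_{x_j\in\mathcal{V}_m}\partial g(x_j)=0$. $V\neq0$ means that $V$ is not zero almost everywhere on $\Gamma$; $V$ also denotes the corresponding maximal multiplication operator in $L^2(\Gamma)$. $\sigma(\cdot)$ and $\rho(\cdot)$ denote spectrum and resolvent set, and $I$ is the identity on $L^2(\Gamma)$. *)

(* Defs.v *)
From HB Require Import structures.
From mathcomp Require Import all_boot all_order all_algebra.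
From mathcomp Require Import all_classical all_reals all_analysis.
From mathcomp Require Import sesquilinear ring.
From mathcomp.real_closed Require Import complex.

Set Implicit Arguments.
Unset Strict Implicit.
Unset Printing Implicit Defensive.

Import Order.TTheory GRing.Theory Num.Theory Num.Def.
Import numFieldTopology.Exports numFieldNormedType.Exports.

Local Open Scope classical_set_scope.
Local Open Scope complex_scope.
Local Open Scope ring_scope.

(* An unbounded operator in [H] is represented by its graph, a subset of
   [H * H]; [linear_operator] says that the subset is the graph of a linear map
   defined on a linear subspace of [H]. *)
Section Operators.
Context {R : realType} {H : normedModType R[i]}.
Implicit Types (S T : set (H * H)) (z : R[i]).

Definition op_dom T : set H := [set f | exists h, T (f, h)].

Definition linear_operator T : Prop :=
  [/\ T 0,
      forall (c : R[i]) (x y : H * H), T x -> T y -> T (c *: x + y)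
    & forall f h k, T (f, h) -> T (f, k) -> h = k].

Definition op_id : set (H * H) := [set x | x.2 = x.1].

Definition op_scale (c : R[i]) T : set (H * H) :=
  [set x | exists2 h, T (x.1, h) & x.2 = c *: h].

(* The domain of the sum is the intersection of the domains. *)
Definition op_add S T : set (H * H) :=
  [set x | exists h k, [/\ S (x.1, h), T (x.1, k) & x.2 = h + k]].

Definition op_comp S T : set (H * H) :=
  [set x | exists2 h, T (x.1, h) & S (h, x.2)].

Definition op_inv T : set (H * H) := [set x | T (x.2, x.1)].

Definition op_shift T z : set (H * H) := op_add T (op_scale (- z) op_id).

(* [y = (y.1, T^* y.1)] with [<T f, y.1> = <f, T^* y.1>] for all [f] in the
   domain of [T]; a graph when the domain of [T] is dense. *)
Definition op_adjoint (ip : {dot H for conjC}) T : set (H * H) :=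
  [set y | forall x, T x -> ip x.2 y.1 = ip x.1 y.2].

Definition self_adjoint (ip : {dot H for conjC}) T : Prop :=
  [/\ linear_operator T, dense (op_dom T) & op_adjoint ip T = T].

Definition bounded_operator T : Prop :=
  [/\ linear_operator T, op_dom T = setT
    & exists M : R, forall f h, T (f, h) -> `|h| <= M%:C * `|f|].

Definition compact_operator T : Prop :=
  [/\ linear_operator T, op_dom T = setT
    & precompact [set h | exists2 f, `|f| <= 1 & T (f, h)]].

(* [T - z] is a bijection from its domain onto [H], with bounded inverse. *)
Definition resolvent_set T : set R[i] :=
  [set z | bounded_operator (op_inv (op_shift T z))].

Definition spectrum T : set R[i] := ~` resolvent_set T.

End Operators.

Section DotNorm.
Context {C : numClosedFieldType} {U : lmodType C}.
Variable ip : {dot U for @conjC C}.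

Lemma dot_herm u v : ip u v = (ip v u)^*.
Proof. by rewrite [LHS]hermC expr0 mul1r. Qed.

Lemma dot_cauchy_schwarz u v : `|ip u v| ^+ 2 <= ip u u * ip v v.
Proof.
have [->|v0] := eqVneq v 0.
  by rewrite !linear0r normr0 expr0n.
have vv : 0 < ip v v by rewrite dnorm_gt0.
have := dnorm_ge0 ip (ip v v *: u - ip u v *: v).
have dE : ip (ip v v *: u) (ip u v *: v) = ip v v * `|ip u v| ^+ 2.
  by rewrite linearZl_LR linearZr_LR /= [_^* * _]mulrC -normCK.
rewrite dnormB !dnormZ dE (gtr0_norm vv).
rewrite [X in _ - (_ + X)](_ : _ = ip v v * `|ip u v| ^+ 2); last first.
  by apply/CrealP; rewrite rpredM ?rpredX ?normr_real// gtr0_real.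
rewrite (_ : _ - _ = ip v v * (ip u u * ip v v - `|ip u v| ^+ 2)).
  by rewrite pmulr_rge0// subr_ge0.
by ring.
Qed.

Definition dot_norm u : C := sqrtC (ip u u).

Lemma dot_norm_triangle u v : dot_norm (u + v) <= dot_norm u + dot_norm v.
Proof.
rewrite -ler_sqr ?nnegrE ?addr_ge0 ?sqrtC_ge0 ?dnorm_ge0//.
rewrite sqrrD !sqrtCK dnormD.
rewrite [X in _ <= X]addrAC lerD2l.
rewrite -mulr_natr -[X in X <= _](divfK (negbT (pnatr_eq0 C 2))) -/('Re _).
rewrite ler_pM2r ?ltr0n//.
have Rle : 'Re (ip u v) <= `|ip u v| by case: (leif_Re_Creal (ip u v)).
rewrite [X in X <= _](_ : _ = 'Re (ip u v)); last by rewrite ReE.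
apply: (le_trans Rle).
rewrite -ler_sqr ?nnegrE ?mulr_ge0 ?sqrtC_ge0 ?dnorm_ge0//.
by rewrite exprMn !sqrtCK dot_cauchy_schwarz.
Qed.

Lemma dot_normZ a u : dot_norm (a *: u) = `|a| * dot_norm u.
Proof.
by rewrite /dot_norm dnormZ rootCMl ?exprn_ge0// sqrCK.
Qed.

Lemma dot_norm_eq0 u : dot_norm u = 0 -> u = 0.
Proof. by move=> /eqP; rewrite sqrtC_eq0 dnorm_eq0 => /eqP. Qed.

End DotNorm.

Section EdgeFunctions.
Context {R : realType}.
Local Notation mu := (@lebesgue_measure R).
Implicit Types (E : set R) (u v w : R -> R) (f g h : R -> R[i]).

(* A function on [E] is represented by a function on [R] whose values outside
   [E] are irrelevant. Measurability is with respect to the Borel sets; every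
   Lebesgue class has a Borel representative. *)
Definition Lp_on E (p : \bar R) u : Prop := u \_ E \in Lfun mu p.

Definition L2_on E f : Prop :=
  Lp_on E 2%:E (@complex.Re R \o f) /\ Lp_on E 2%:E (@complex.Im R \o f).

Definition cintegral E f : R[i] :=
  (\int[mu]_(x in E) complex.Re (f x)) +i*
  (\int[mu]_(x in E) complex.Im (f x)).

Definition L2_dot E f g : R[i] := cintegral E (fun x => f x * (g x)^*).

Definition ae_on E (P : R -> Prop) : Prop :=
  {ae mu, forall x : measurableTypeR R, E x -> P x}.

Let le12 : (1 <= (2%:E : \bar R))%E. Proof. by rewrite lee_fin ler1n. Qed.

Lemma Lp2_on_lin E a u v : Lp_on E 2%:E u -> Lp_on E 2%:E v ->
  Lp_on E 2%:E (fun x => a * u x + v x).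
Proof.
move=> u2 v2; rewrite /Lp_on.
rewrite (_ : _ \_ E = a *: (u \_ E) + v \_ E).
  exact: (Lfun_submod_closed mu le12).2.
apply/funext => x; rewrite !fctE /patch; case: ifPn => //= _.
by rewrite scaler0 addr0.
Qed.

Lemma Lp2_on0 E : Lp_on E 2%:E (cst 0).
Proof.
rewrite /Lp_on (_ : _ \_ _ = 0); last first.
  by apply/funext => x; rewrite /patch; case: ifP.
exact: (Lfun_submod_closed mu le12).1.
Qed.

Lemma Lp2_on_mul E u v : measurable E -> Lp_on E 2%:E u -> Lp_on E 2%:E v ->
  mu.-integrable E (EFin \o (fun x => u x * v x)).
Proof.
move=> mE u2 v2; apply: (@integrable_mkcond _ _ _ mu E _ mE).2.
rewrite (_ : _ \_ E = EFin \o ((u \_ E) \* (v \_ E))).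
  by apply/Lfun1_integrable; exact: Lfun2_mul_Lfun1.
apply/funext => x /=; rewrite /patch; case: ifPn => //= _.
by rewrite mul0r.
Qed.

Lemma Lp2_on_measurable E u : measurable E -> Lp_on E 2%:E u ->
  measurable_fun E u.
Proof.
move=> mE u2; apply/(measurable_restrictT _ mE).
by have := sub_Lfun_mfun u2; rewrite inE.
Qed.

Let rdot E u v : R := \int[mu]_(x in E) (u x * v x).

Let rdot_lin E a u v w : measurable E -> Lp_on E 2%:E u -> Lp_on E 2%:E v ->
  Lp_on E 2%:E w ->
  rdot E (fun x => a * u x + v x) w = a * rdot E u w + rdot E v w.
Proof.
move=> mE u2 v2 w2; rewrite /rdot.
rewrite -RintegralZl//; last exact: Lp2_on_mul.
rewrite -RintegralD//; last 2 first.
- have := Lp2_on_mul mE (Lp2_on_lin a u2 (Lp2_on0 E)) w2.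
  by congr (_.-integrable _ _); apply/funext => x /=; rewrite addr0 mulrA.
- exact: Lp2_on_mul.
by apply: eq_Rintegral => x _; rewrite mulrDl mulrA.
Qed.

Let rdot_ae E u v w : measurable E -> Lp_on E 2%:E u -> Lp_on E 2%:E v ->
  Lp_on E 2%:E w -> ae_on E (fun x => u x = v x) ->
  rdot E u w = rdot E v w.
Proof.
move=> mE u2 v2 w2 uv; congr fine; apply: ae_eq_integral => //.
- by apply: measurable_int; exact: Lp2_on_mul.
- by apply: measurable_int; exact: Lp2_on_mul.
- by move: uv; rewrite /ae_on; apply: filterS => x uv Ex; rewrite uv.
Qed.

Let rdotC E u v : rdot E u v = rdot E v u.
Proof. by apply: eq_Rintegral => x _; rewrite mulrC. Qed.

Let L2_dotE E f g : measurable E -> L2_on E f -> L2_on E g ->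
  L2_dot E f g =
    (rdot E (@complex.Re R \o f) (@complex.Re R \o g) +
     rdot E (@complex.Im R \o f) (@complex.Im R \o g)) +i*
    (rdot E (@complex.Im R \o f) (@complex.Re R \o g) -
     rdot E (@complex.Re R \o f) (@complex.Im R \o g)).
Proof.
move=> mE [f1 f2] [g1 g2]; rewrite /L2_dot /cintegral.
congr (_ +i* _).
  rewrite -RintegralD//; [|exact: Lp2_on_mul|exact: Lp2_on_mul].
  by apply: eq_Rintegral => x _ /=; case: (f x) (g x) => [a b] [c d] /=; ring.
rewrite -RintegralB//; [|exact: Lp2_on_mul|exact: Lp2_on_mul].
by apply: eq_Rintegral => x _ /=; case: (f x) (g x) => [a b] [c d] /=; ring.
Qed.

Lemma L2_on_lin E (a : R[i]) f g : L2_on E f -> L2_on E g ->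
  L2_on E (fun x => a * f x + g x).
Proof.
case: a => [a b] [f1 f2] [g1 g2]; split.
- have := Lp2_on_lin a f1 (Lp2_on_lin (- b) f2 g1).
  congr Lp_on; apply/funext => x /=.
  by case: (f x) (g x) => [? ?] [? ?] /=; ring.
- have := Lp2_on_lin a f2 (Lp2_on_lin b f1 g2).
  congr Lp_on; apply/funext => x /=.
  by case: (f x) (g x) => [? ?] [? ?] /=; ring.
Qed.

Lemma L2_on0 E : L2_on E (cst 0).
Proof. by split; exact: Lp2_on0. Qed.

Lemma L2_dot_lin E a f g h : measurable E ->
  L2_on E f -> L2_on E g -> L2_on E h ->
  L2_dot E (fun x => a * f x + g x) h = a * L2_dot E f h + L2_dot E g h.
Proof.
move=> mE f2 g2 h2; rewrite !L2_dotE//; last exact: L2_on_lin.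
case: a f2 g2 h2 => a b [f1 f2] [g1 g2] [h1 h2].
have -> : @complex.Re R \o (fun x => (a +i* b) * f x + g x) =
    (fun x => a * (@complex.Re R \o f) x +
              ((- b) * (@complex.Im R \o f) x + (@complex.Re R \o g) x)).
  by apply/funext => x /=; case: (f x) (g x) => [? ?] [? ?] /=; ring.
have -> : @complex.Im R \o (fun x => (a +i* b) * f x + g x) =
    (fun x => a * (@complex.Im R \o f) x +
              (b * (@complex.Re R \o f) x + (@complex.Im R \o g) x)).
  by apply/funext => x /=; case: (f x) (g x) => [? ?] [? ?] /=; ring.
rewrite !rdot_lin//; try exact: Lp2_on_lin.
by congr (_ +i* _); ring.
Qed.

Lemma L2_dot_conj E f g : measurable E -> L2_on E f -> L2_on E g ->
  L2_dot E f g = (L2_dot E g f)^*.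
Proof.
move=> mE f2 g2; rewrite (L2_dotE mE f2 g2) (L2_dotE mE g2 f2).
apply/eqP; rewrite eq_complex /= opprB; apply/andP; split; apply/eqP.
  by congr (_ + _); exact: rdotC.
by congr (_ - _); exact: rdotC.
Qed.

Lemma L2_dot_ae E f g h : measurable E ->
  L2_on E f -> L2_on E g -> L2_on E h ->
  ae_on E (fun x => f x = g x) -> L2_dot E f h = L2_dot E g h.
Proof.
move=> mE f2 g2 h2 fg; rewrite !L2_dotE//.
case: f2 g2 h2 => f1 f2 [g1 g2] [h1 h2].
have fgR : ae_on E (fun x => (@complex.Re R \o f) x = (@complex.Re R \o g) x).
  by move: fg; rewrite /ae_on; apply: filterS => x /= fg Ex; rewrite fg.
have fgI : ae_on E (fun x => (@complex.Im R \o f) x = (@complex.Im R \o g) x).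
  by move: fg; rewrite /ae_on; apply: filterS => x /= fg Ex; rewrite fg.
by congr ((_ + _) +i* (_ - _)); exact: rdot_ae.
Qed.

Let rdot_ge0 E u : 0 <= rdot E u u.
Proof. by apply: Rintegral_ge0 => x _; rewrite -expr2 sqr_ge0. Qed.

Let rdot_eq0 E u : measurable E -> Lp_on E 2%:E u -> rdot E u u = 0 ->
  ae_on E (fun x => u x = 0).
Proof.
move=> mE u2 uu.
have iu := Lp2_on_mul mE u2 u2.
have : ae_eq mu E (EFin \o (fun x => u x * u x)) (cst 0%E).
  apply: (@ae_eq_integral_abs _ _ _ mu E mE _ _).1.
    exact: measurable_int iu.
  move: uu; rewrite /rdot /Rintegral => /eqP.
  rewrite fine_eq0; last exact: integrable_fin_num.
  move=> /eqP <-; apply: eq_integral => x _ /=.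
  by rewrite ger0_norm// -expr2 sqr_ge0.
apply: filterS => x /[apply] /= -[] /eqP.
by rewrite mulf_eq0 orbb => /eqP.
Qed.

Lemma L2_dot_ge0 E f : measurable E -> L2_on E f -> 0 <= L2_dot E f f.
Proof.
move=> mE f2; rewrite L2_dotE// lecE /= [in X in _ - X]rdotC subrr eqxx /=.
by rewrite addr_ge0.
Qed.

Lemma L2_dot_eq0 E f : measurable E -> L2_on E f -> L2_dot E f f = 0 ->
  ae_on E (fun x => f x = 0).
Proof.
move=> mE f2; rewrite L2_dotE// => -[/eqP + _].
case: f2 => f1 f2.
rewrite paddr_eq0// => /andP[/eqP /(rdot_eq0 mE f1) a /eqP /(rdot_eq0 mE f2) b].
move: a b; rewrite /ae_on; apply: filterS2 => x /= a b Ex.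
by move: (a Ex) (b Ex); case: (f x) => ? ? /= -> ->.
Qed.

End EdgeFunctions.

(* The endpoint [(n, false)] is the left end of the edge [n], and [(n, true)] is
   its right end. *)
Record metric_graph (R : realType) := MetricGraph {
  nedges : nat;
  left_end : 'I_nedges -> R;
  right_end : 'I_nedges -> R;
  left_lt_right : forall n, left_end n < right_end n;
  vertices : {set {set 'I_nedges * bool}};
  vertices_partition : finset.partition vertices [set: 'I_nedges * bool]%SET }.

Section L2Space.
Local Open Scope quotient_scope.
Context {R : realType} (G : metric_graph R).
Local Notation edge := 'I_(nedges G).

Definition edge_set (n : edge) : set R := `[left_end n, right_end n].

Lemma measurable_edge_set n : measurable (edge_set n).
Proof. exact: measurable_itv. Qed.

Definition graph_fun : Type := edge -> R -> R[i].
HB.instance Definition _ := GRing.Lmodule.on graph_fun.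

Definition square_integrable : {pred graph_fun} :=
  [pred f | `[< forall n, L2_on (edge_set n) (f n) >]].

Lemma square_integrable_submod_closed : submod_closed square_integrable.
Proof.
split=> [|a f g]; rewrite !unfold_in /=.
  by apply/asboolP => n; exact: L2_on0.
move=> /asboolP f2 /asboolP g2; apply/asboolP => n.
exact: L2_on_lin.
Qed.

HB.instance Definition _ := GRing.isSubmodClosed.Build R[i] graph_fun
  square_integrable square_integrable_submod_closed.

Record sqint_fun : Type := SqintFun {
  sqint_val : graph_fun;
  sqint_valP : sqint_val \in square_integrable }.

HB.instance Definition _ := [isSub for sqint_val].
HB.instance Definition _ := [Choice of sqint_fun by <:].
HB.instance Definition _ := [SubChoice_isSubLmodule of sqint_fun by <:].

Definition null_fun : {pred sqint_fun} :=
  [pred f : sqint_fun | `[< forall n, ae_on (edge_set n) (fun x => sqint_val f n x = 0) >]].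

Lemma null_fun_zmod_closed : zmod_closed null_fun.
Proof.
split=> [|f g]; rewrite !unfold_in /=.
  by apply/asboolP => n; rewrite /ae_on; apply: aeW => x _.
move=> /asboolP f0 /asboolP g0; apply/asboolP => n.
move: (f0 n) (g0 n); rewrite /ae_on; apply: filterS2 => x fx gx Ex.
by rewrite !fctE fx// gx// subr0.
Qed.

HB.instance Definition _ := GRing.isZmodClosed.Build sqint_fun null_fun
  null_fun_zmod_closed.

(* L^2 of the graph: square-integrable families of functions on the edges,
   modulo equality almost everywhere on every edge. *)
Definition L2_space : Type := Quotient.quot null_fun.
HB.instance Definition _ := GRing.Zmodule.on L2_space.


Local Notation L2 := L2_space.

Definition L2_repr (f : L2) : graph_fun := sqint_val (repr f).

Lemma L2_reprP f n : L2_on (edge_set n) (L2_repr f n).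
Proof. by have := sqint_valP (repr f); rewrite unfold_in => /asboolP. Qed.

Definition L2_class (f : sqint_fun) : L2 := \pi_L2 f.

Lemma L2_classK f : L2_class (repr f) = f.
Proof. exact: reprK. Qed.

Lemma eq_L2_class (f g : sqint_fun) : L2_class f = L2_class g <->
  forall n, ae_on (edge_set n) (fun x => sqint_val f n x = sqint_val g n x).
Proof.
have -> : (L2_class f = L2_class g) = (f - g \in null_fun).
  by rewrite Quotient.idealrBE; apply/propext; split => [/eqP|/eqP].
rewrite unfold_in /=; split=> [/asboolP fg n|fg]; last apply/asboolP => n.
  move: (fg n); rewrite /ae_on; apply: filterS => x /[apply] fgx.
  by apply/eqP; rewrite -subr_eq0; apply/eqP.
move: (fg n); rewrite /ae_on; apply: filterS => x /[apply] fgx.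
by rewrite -[RHS](subrr (sqint_val g n x)) -{1}fgx.
Qed.

Lemma L2_repr_class f n :
  ae_on (edge_set n) (fun x => L2_repr (L2_class f) n x = sqint_val f n x).
Proof. by move: n; apply/eq_L2_class; exact: L2_classK. Qed.

Lemma L2_classD f g : L2_class f + L2_class g = L2_class (f + g).
Proof. by rewrite /L2_class raddfD. Qed.

Definition L2_scale (a : R[i]) (f : L2) : L2 := L2_class (a *: repr f).

Lemma L2_scale_class a f : L2_scale a (L2_class f) = L2_class (a *: f).
Proof.
apply/eq_L2_class => n.
move: (L2_repr_class f n); rewrite /ae_on; apply: filterS => x /[apply] fx.
by rewrite -[RHS]/(a * sqint_val f n x) -fx.
Qed.

Lemma L2_scaleA a b f : L2_scale a (L2_scale b f) = L2_scale (a * b) f.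
Proof. by rewrite -(L2_classK f) !L2_scale_class scalerA. Qed.

Lemma L2_scale1 : left_id 1 L2_scale.
Proof. by move=> f; rewrite -(L2_classK f) L2_scale_class scale1r. Qed.

Lemma L2_scaleDr : right_distributive L2_scale +%R.
Proof.
move=> a f g; rewrite -(L2_classK f) -(L2_classK g) L2_classD !L2_scale_class.
by rewrite scalerDr L2_classD.
Qed.

Lemma L2_scaleDl f : {morph L2_scale^~ f : a b / a + b}.
Proof.
by move=> a b; rewrite -(L2_classK f) !L2_scale_class scalerDl L2_classD.
Qed.

HB.instance Definition _ := GRing.Zmodule_isLmodule.Build R[i] L2
  L2_scaleA L2_scale1 L2_scaleDr L2_scaleDl.


Lemma L2_repr_lin a (f g : L2) n : ae_on (edge_set n) (fun x =>
  L2_repr (a *: f + g) n x = a * L2_repr f n x + L2_repr g n x).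
Proof.
have -> : a *: f + g = L2_class (a *: repr f + repr g).
  by rewrite -L2_classD (L2_classK g).
exact: L2_repr_class.
Qed.

Definition L2_ip (f g : L2) : R[i] :=
  \sum_(n : edge) L2_dot (edge_set n) (L2_repr f n) (L2_repr g n).

Lemma L2_ip_linl h a f g :
  L2_ip (a *: f + g) h = a * L2_ip f h + L2_ip g h.
Proof.
rewrite /L2_ip mulr_sumr -big_split /=; apply: eq_bigr => n _.
have mE := measurable_edge_set n.
rewrite -L2_dot_lin//; try exact: L2_reprP.
apply: L2_dot_ae (L2_repr_lin a f g n) => //; try exact: L2_reprP.
by apply: L2_on_lin; exact: L2_reprP.
Qed.

Lemma L2_ip_herm f g : L2_ip f g = (L2_ip g f)^*.
Proof.
rewrite /L2_ip rmorph_sum /=; apply: eq_bigr => n _.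
have mE := measurable_edge_set n.
by apply: L2_dot_conj => //; exact: L2_reprP.
Qed.

Lemma L2_ip_gt0 f : f != 0 -> 0 < L2_ip f f.
Proof.
have ge0 n : 0 <= L2_dot (edge_set n) (L2_repr f n) (L2_repr f n).
  by apply: L2_dot_ge0; [exact: measurable_edge_set|exact: L2_reprP].
move=> f0; rewrite lt_neqAle [X in _ && X]sumr_ge0// andbT.
apply: contra f0 => /eqP/esym/psumr_eq0P ip0; apply/eqP.
have -> : 0 = L2_class 0 by rewrite /L2_class raddf0.
rewrite -[LHS]L2_classK; apply/eq_L2_class => n.
apply: L2_dot_eq0; [exact: measurable_edge_set|exact: L2_reprP|].
exact: ip0.
Qed.

Lemma L2_ip_bilinear :
  bilinear_for ( *%R : R[i] -> R[i] -> R[i])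
    (@conjC R[i] \; *%R : R[i] -> R[i] -> R[i]) L2_ip.
Proof.
split=> [h a f g|h a f g] /=; first exact: L2_ip_linl.
rewrite L2_ip_herm L2_ip_linl rmorphD rmorphM /=.
by rewrite -(L2_ip_herm h f) -(L2_ip_herm h g).
Qed.

HB.instance Definition _ := bilinear_isBilinear.Build R[i] L2 L2 R[i]
  *%R (@conjC R[i] \; *%R) L2_ip L2_ip_bilinear.

Lemma L2_ip_hermitian f g : L2_ip f g = (-1) ^+ false * conjC (L2_ip g f).
Proof. by rewrite expr0 mul1r L2_ip_herm. Qed.

HB.instance Definition _ := isHermitianSesquilinear.Build R[i] L2
  false (@conjC R[i]) L2_ip L2_ip_hermitian.

HB.instance Definition _ := isDotProduct.Build R[i] L2 L2_ip L2_ip_gt0.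

HB.instance Definition _ := Lmodule_isNormed.Build R[i] L2
  (dot_norm_triangle L2_ip) (dot_normZ L2_ip) (dot_norm_eq0 (ip := L2_ip)).

Lemma L2_normE (f : L2) : `|f| = sqrtC (L2_ip f f).
Proof. by []. Qed.

End L2Space.

Section GraphOperators.
Context {R : realType} (G : metric_graph R).
Local Notation edge := 'I_(nedges G).
Local Notation endpoint := (edge * bool)%type.
Implicit Types (g : graph_fun G) (V : edge -> R -> R).

Definition is_primitive (a b : R) (F f : R -> R[i]) : Prop :=
  forall x, x \in `[a, b] -> F x = F a + cintegral `[a, x] f.

(* The Sobolev space H^2(a, b): [g] is the continuously differentiable
   representative, its derivative [g1] is absolutely continuous (an indefinite
   Lebesgue integral), and [g2] is the square-integrable second derivative. *)
Definition H2_with_derivatives (a b : R) (g g1 g2 : R -> R[i]) : Prop :=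
  [/\ L2_on `[a, b] g2, is_primitive a b g1 g2 & is_primitive a b g g1].

Definition position (j : endpoint) : R :=
  if j.2 then right_end j.1 else left_end j.1.

Definition value_at g (j : endpoint) : R[i] := g j.1 (position j).

(* [g1] is the edgewise derivative; the inward direction reverses the sign at
   right ends. *)
Definition inward_derivative g1 (j : endpoint) : R[i] :=
  if j.2 then - g1 j.1 (position j) else g1 j.1 (position j).

Definition kirchhoff_conditions g g1 : Prop :=
  forall v : {set endpoint}, v \in vertices G ->
    (forall i j, i \in v -> j \in v -> value_at g i = value_at g j) /\
    \sum_(j in v) inward_derivative g1 j = 0.

Definition neumann_laplacian : set (L2_space G * L2_space G) :=
  [set x | exists g g1 g2 : graph_fun G,
    [/\ forall n, H2_with_derivatives (left_end n) (right_end n)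
                    (g n) (g1 n) (g2 n),
        kirchhoff_conditions g g1,
        forall n, ae_on (edge_set n) (fun t => L2_repr x.1 n t = g n t)
      & forall n, ae_on (edge_set n) (fun t => L2_repr x.2 n t = - g2 n t)]].

(* The domain consists of all f in L^2 for which V f is in L^2. *)
Definition multiplication_operator V : set (L2_space G * L2_space G) :=
  [set x | forall n, ae_on (edge_set n)
    (fun t => L2_repr x.2 n t = (V n t)%:C * L2_repr x.1 n t)].

Definition Lp_graph (p : \bar R) V : Prop :=
  forall n, Lp_on (edge_set n) p (V n).

Definition ae_graph (P : edge -> R -> Prop) : Prop :=
  forall n, ae_on (edge_set n) (P n).

End GraphOperators.

Arguments neumann_laplacian {R} G.
Arguments multiplication_operator {R G} V.

(* Main.v *)
(* On a compact interval H^2 functions are bounded by an arbitrarily small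
   multiple of the L^2 norm of the derivative plus a multiple of the L^2 norm
   (Sobolev). Hence a square-integrable V maps dom(A_N) into L^2, and
   T = A_N + alpha V is symmetric and semibounded. It is self-adjoint because
   the adjoint is computed directly: testing T^* against functions clamped at
   the ends of an edge gives u'' = alpha V u - w in the weak sense, so u is in
   H^2 (du Bois-Reymond), and testing against Hermite polynomials with
   prescribed boundary data gives the Kirchhoff conditions.
   (A_N - z)^-1 maps the unit ball of L^2 to uniformly bounded, uniformly
   Hoelder continuous functions, a compact set for uniform convergence, and
   multiplication by V is continuous from uniform convergence to L^2.
   Finally the constant function 1 is in dom(A_N), and its energy is alpha times
   the integral of V, which is negative for alpha < 0; so the bottom of the
   numerical range of T is negative, and it lies in the spectrum. *)
Require Import Defs.
From HB Require Import structures.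
From mathcomp Require Import all_boot all_order all_algebra.
From mathcomp Require Import all_classical all_reals all_analysis.
From mathcomp Require Import measurable_realfun ess_sup_inf.
From mathcomp Require Import sesquilinear ring lra.
From mathcomp.real_closed Require Import complex.

Set Implicit Arguments.
Unset Strict Implicit.
Unset Printing Implicit Defensive.

Import Order.TTheory GRing.Theory Num.Theory Num.Def.
Import numFieldTopology.Exports numFieldNormedType.Exports.

Local Open Scope classical_set_scope.
Local Open Scope complex_scope.
Local Open Scope ring_scope.

(** * Absolutely continuous functions on an interval *)

Section RealIntegrals.
Context {R : realType}.
Local Notation mu := (@lebesgue_measure R).
Implicit Types (E : set R) (a b c x y : R) (f g u v F G : R -> R).

(** Both operators belong to one family [schrodinger W], with W = 0 for A_N and W = alpha V for the
    perturbed operator, so no perturbation theorem is invoked: the same arguments serve every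
    square-integrable W. The obstacle is that W need not be bounded.

    Density of the domain is needed twice: as part of self-adjointness, and to see that the operator
    is single-valued, since its graph is defined through the existence of representatives. It is
    obtained from polynomials clamped at the ends of one edge, which approximate indicators of rays,
    then of Borel sets, then all of L^2.

    That the bottom of the numerical range lies in the spectrum is shown by a direct variational
    argument with the resolvent, in place of the spectral theorem. *)

Lemma ae_onS E (P Q : R -> Prop) : (forall x, E x -> P x -> Q x) ->
  ae_on E P -> ae_on E Q.
Proof. by move=> PQ; rewrite /ae_on; apply: filterS => x /[swap] Ex /(_ Ex) /(PQ _ Ex). Qed.

Lemma ae_onS2 E (P Q S : R -> Prop) : (forall x, E x -> P x -> Q x -> S x) ->
  ae_on E P -> ae_on E Q -> ae_on E S.
Proof.
move=> PQ; rewrite /ae_on; apply: filterS2 => x Px Qx Ex.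
exact: PQ (Px Ex) (Qx Ex).
Qed.

Lemma ae_on_all E (P : R -> Prop) : (forall x, E x -> P x) -> ae_on E P.
Proof. by move=> EP; rewrite /ae_on; apply: aeW => x; exact: EP. Qed.

Lemma ae_on_sub E E' (P : R -> Prop) : E' `<=` E -> ae_on E P -> ae_on E' P.
Proof. by move=> sE; rewrite /ae_on; apply: filterS => x + /sE; apply. Qed.

Definition intable E u : Prop := mu.-integrable E (EFin \o u).

Lemma intable_measurable E u : intable E u -> measurable_fun E u.
Proof. by move=> /integrableP[/measurable_EFinP]. Qed.

Lemma intableS E D u : measurable E -> measurable D -> D `<=` E ->
  intable E u -> intable D u.
Proof. by move=> mE mD DE; exact: (@integrableS _ _ _ mu). Qed.

Lemma eq_intable E u v : {in E, u =1 v} -> measurable E ->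
  intable E u -> intable E v.
Proof. by move=> uv mE; apply: (@eq_integrable _ _ _ mu) => // x /uv /= ->. Qed.

Lemma intableD E u v : measurable E -> intable E u -> intable E v ->
  intable E (fun x => u x + v x).
Proof. by move=> mE iu iv; exact: (integrableD (mu := mu) mE iu iv). Qed.

Lemma intableZ E c u : measurable E -> intable E u ->
  intable E (fun x => c * u x).
Proof. by move=> mE iu; exact: (integrableZl (mu := mu) mE c iu). Qed.

Lemma intableN E u : measurable E -> intable E u -> intable E (fun x => - u x).
Proof.
by move=> mE iu; apply: eq_intable (intableZ (-1) mE iu) => // x _; rewrite mulN1r.
Qed.

Lemma intableB E u v : measurable E -> intable E u -> intable E v ->
  intable E (fun x => u x - v x).
Proof. by move=> mE iu iv; exact: intableD mE iu (intableN mE iv). Qed.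

Lemma intable_norm E u : intable E u -> intable E (fun x => `|u x|).
Proof. exact: (@integrable_norm _ _ _ mu). Qed.

Lemma intable_le E u v : measurable E -> measurable_fun E u -> intable E v ->
  (forall x, E x -> `|u x| <= v x) -> intable E u.
Proof.
move=> mE mu_ iv uv; apply: (@le_integrable _ _ _ mu _ mE _ _ _ _ iv).
  exact/measurable_EFinP.
move=> x Ex /=; rewrite lee_fin (le_trans (uv x Ex))//; exact: ler_norm.
Qed.

Lemma intable_cst_fin E c : measurable E -> (mu E < +oo)%E -> intable E (cst c).
Proof.
move=> mE Efin; apply: (@measurable_bounded_integrable _ _ _ mu _ _ mE) => //.
by exists `|c|; split => // M cM x _ /=; exact: ltW.
Qed.

Lemma lebesgue_measure_itv_lty a b : (mu `[a, b]%classic < +oo)%E.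
Proof.
rewrite [X in (X < _)%E](@lebesgue_measure_itv R `[a, b]) /=.
by case: ifP => _; rewrite -?EFinB ltry.
Qed.

Lemma intable_cst a b c : intable `[a, b] (cst c).
Proof.
by apply: intable_cst_fin (lebesgue_measure_itv_lty a b); exact: measurable_itv.
Qed.

Lemma intable_mul_bdd E u v M : measurable E -> intable E u ->
  measurable_fun E v -> (forall x, E x -> `|v x| <= M) ->
  intable E (fun x => u x * v x).
Proof.
move=> mE iu mv vM; apply: (intable_le (v := fun x => M * `|u x|)) => //.
- by apply: measurable_funM => //; exact: intable_measurable.
- exact: intableZ mE (intable_norm iu).
- by move=> x Ex; rewrite normrM mulrC ler_wpM2r// vM.
Qed.

Lemma Rintegral_chasles a b x f : a <= x -> x <= b -> intable `[a, b] f ->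
  \int[mu]_(t in `[a, b]) f t =
  \int[mu]_(t in `[a, x]) f t + \int[mu]_(t in `[x, b]) f t.
Proof.
move=> ax xb iF; apply/eqP; rewrite addrC -subr_eq; apply/eqP.
rewrite Rintegral_itvB//.
by rewrite Rintegral_itv_obnd_cbnd//; apply: intableS iF => //;
  apply: subset_itv; rewrite bnd_simp.
Qed.

Lemma Rintegral_cst_itv a b c : a <= b ->
  \int[mu]_(_ in `[a, b]) c = c * (b - a).
Proof.
move=> ab; rewrite (@Rintegral_cst _ _ _ mu _ (measurable_itv `[a, b])).
rewrite [X in fine X](@lebesgue_measure_itv R `[a, b]) /=.
case: ifPn => //=; rewrite lte_fin -leNgt => ba.
by have -> : a = b by [apply/le_anti; rewrite ab ba]; rewrite subrr.
Qed.

(** Absolute continuity with derivative f, expressed without differentiation and only on [a, b],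
    since values off an edge carry no meaning. This is the real counterpart of [is_primitive]. *)
Definition primitive a b F f : Prop :=
  forall x, x \in `[a, b] -> F x = F a + \int[mu]_(t in `[a, x]) f t.

Lemma primitive_continuous a b F f : a <= b -> intable `[a, b] f ->
  primitive a b F f -> {within `[a, b], continuous F}.
Proof.
move=> ab iF FE.
have := parameterized_integral_continuous ab iF.
move=> c.
have: {within `[a, b], continuous (fun x => F a + parameterized_integral mu a x f)}.
  move=> x; apply: cvgD; [exact: cvg_cst|exact: c].
apply: subspace_eq_continuous => x; rewrite inE /= => xab; rewrite /from_subspace /=.
by rewrite [RHS]FE.
Qed.

Lemma primitive_measurable a b F f : a <= b -> intable `[a, b] f ->
  primitive a b F f -> measurable_fun `[a, b] F.
Proof.
move=> ab iF FE; apply: subspace_continuous_measurable_fun => //.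
exact: primitive_continuous FE.
Qed.

Lemma primitive_sub a b F f x y : a <= x -> x <= y -> y <= b ->
  intable `[a, b] f -> primitive a b F f ->
  F y = F x + \int[mu]_(t in `[x, y]) f t.
Proof.
move=> ax xy yb iF FE.
rewrite (FE y) ?in_itv/= ?yb ?(le_trans ax)// (FE x) ?in_itv/= ?ax ?(le_trans xy)//.
rewrite -addrA (Rintegral_chasles ax xy)//.
by apply: intableS iF => //; apply: subset_itvl; rewrite bnd_simp.
Qed.

Lemma primitive_restrict a b F f x y : a <= x -> x <= y -> y <= b ->
  intable `[a, b] f -> primitive a b F f -> primitive x y F f.
Proof.
move=> ax xy yb iF FE z; rewrite in_itv/= => /andP[xz zy].
by apply: (primitive_sub ax xz (le_trans zy yb) iF FE).
Qed.

Lemma intable_itvS a b x y f : a <= x -> y <= b ->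
  intable `[a, b] f -> intable `[x, y] f.
Proof. by move=> ax yb; apply: intableS => //; apply: subset_itv; rewrite bnd_simp. Qed.

Lemma primitive_bdd a b F f : a <= b -> intable `[a, b] f ->
  primitive a b F f -> forall x, `[a, b]%classic x ->
  `|F x| <= `|F a| + \int[mu]_(t in `[a, b]) `|f t|.
Proof.
move=> ab iF FE x /= xab; move: (xab); rewrite in_itv/= => /andP[ax xb].
rewrite FE// (le_trans (ler_normD _ _))// lerD2l.
have iax : intable `[a, x] f by exact: intable_itvS iF.
rewrite (le_trans (le_normr_Rintegral (mu := mu) _ iax))//.
rewrite [leRHS](Rintegral_chasles ax xb) ?lerDl ?Rintegral_ge0//.
exact: intable_norm.
Qed.

Lemma intable_primitive_mul a b F f g : a <= b -> intable `[a, b] f ->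
  intable `[a, b] g -> primitive a b F f -> intable `[a, b] (fun x => g x * F x).
Proof.
move=> ab iF ig FE; apply: intable_mul_bdd (primitive_bdd ab iF FE) => //.
exact: primitive_measurable FE.
Qed.

Lemma RintD E u v : measurable E -> intable E u -> intable E v ->
  \int[mu]_(x in E) (u x + v x) = \int[mu]_(x in E) u x + \int[mu]_(x in E) v x.
Proof. by move=> mE iu iv; exact: (@RintegralD _ _ _ mu). Qed.

Lemma RintB E u v : measurable E -> intable E u -> intable E v ->
  \int[mu]_(x in E) (u x - v x) = \int[mu]_(x in E) u x - \int[mu]_(x in E) v x.
Proof. by move=> mE iu iv; exact: (@RintegralB _ _ _ mu). Qed.

Lemma RintZ E c u : measurable E -> intable E u ->
  \int[mu]_(x in E) (c * u x) = c * \int[mu]_(x in E) u x.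
Proof. by move=> mE iu; exact: (@RintegralZl _ _ _ mu). Qed.

Lemma intable_restrict E u : measurable E -> intable E u -> intable setT (u \_ E).
Proof.
move=> mE iu; rewrite /intable -restrict_EFin.
exact: ((@integrable_mkcond _ _ _ mu E (EFin \o u) mE).1 iu).
Qed.

(* Integration by parts for absolutely continuous functions is Fubini's theorem
   for g x * f y on the triangle y <= x. *)
Let triangle : set (R * R) := [set z | z.2 <= z.1].

Let measurable_triangle : measurable triangle.
Proof.
rewrite -[triangle]setTI.
exact: (measurable_fun_le measurableT measurable_snd measurable_fst).
Qed.

Let phi f g (z : R * R) : \bar R := (g z.1 * f z.2 * \1_triangle z)%:E.

(** The function is dominated by |g x| |f y|, whose iterated integral is a product of two finite
    integrals; Tonelli's theorem then gives integrability on the plane. *)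
Let phi_integrable f g : intable setT f -> intable setT g ->
  (mu \x mu)%E.-integrable setT (phi f g).
Proof.
move=> iF ig.
have mf := intable_measurable iF.
have mg := intable_measurable ig.
have mphi : measurable_fun setT (phi f g).
  apply/measurable_EFinP; apply: measurable_funM; last exact: measurable_indic.
  apply: measurable_funM.
    exact: (measurableT_comp mg measurable_fst).
  exact: (measurableT_comp mf measurable_snd).
apply: (@integrable12ltyP _ _ (measurableTypeR R) (measurableTypeR R) _ mu mu
  (phi f g) mphi).2.
have /integrableP[_ f1] := iF.
have /integrableP[_ g1] := ig.
apply: (@le_lt_trans _ _ (\int[mu]_x (`|(g x)%:E| * \int[mu]_y `|(f y)%:E|)))%E.
  apply: ge0_le_integral => //.
  - by move=> x _; exact: integral_ge0.
  - apply: (@measurable_fun_fubini_tonelli_F _ _ (measurableTypeR R)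
      (measurableTypeR R) _ mu (abse \o phi f g)).
      exact: measurableT_comp.
    by move=> z; exact: abse_ge0.
  - apply: emeasurable_funM => //.
    by apply: measurableT_comp => //; exact/measurable_EFinP.
  - move=> x _; rewrite -ge0_integralZl//; last first.
      by apply: measurableT_comp => //; exact/measurable_EFinP.
    apply: ge0_le_integral => //.
    + apply: measurableT_comp => //.
      exact: (measurableT_comp mphi (pair1_measurable x)).
    + apply: emeasurable_funM => //.
      by apply: measurableT_comp => //; exact/measurable_EFinP.
    + move=> y _; rewrite -abseM /phi /= lee_fin !normrM ler_piMr ?mulr_ge0//.
      by rewrite indicE; case: (_ \in _); rewrite ?normr1 ?normr0.
rewrite ge0_integralZr//.
- apply: lte_mul_pinfty => //; first exact: integral_ge0.
  by rewrite ge0_fin_numE//; exact: integral_ge0.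
- by apply: measurableT_comp => //; exact/measurable_EFinP.
- exact: integral_ge0.
Qed.

Lemma integral_EFin E u : measurable E -> intable E u ->
  (\int[mu]_(x in E) (u x)%:E = (\int[mu]_(x in E) u x)%:E)%E.
Proof.
move=> mE iu; rewrite /Rintegral fineK//.
exact: (@integrable_fin_num _ _ _ mu _ mE).
Qed.

Lemma integration_by_parts_primitive a b F f G g : a <= b ->
  intable `[a, b] f -> intable `[a, b] g ->
  primitive a b F f -> primitive a b G g ->
  \int[mu]_(x in `[a, b]) (f x * G x) + \int[mu]_(x in `[a, b]) (F x * g x) =
  F b * G b - F a * G a.
Proof.
move=> ab iF ig FE GE.
pose E : set R := `[a, b]%classic.
have mE : measurable E by exact: measurable_itv.
have iF' := intable_restrict mE iF.
have ig' := intable_restrict mE ig.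
have Fa : intable E (fun x => g x * (F x - F a)).
  apply: eq_intable (intableB _ (intable_primitive_mul ab iF ig FE)
    (intableZ (F a) mE ig)) => //.
  by move=> x _; ring.
have Gb : intable E (fun x => f x * (G b - G x)).
  apply: eq_intable (intableB _ (intableZ (G b) mE iF)
    (intable_primitive_mul ab ig iF GE)) => //.
  by move=> x _; ring.
have memE (z c d : R) : (z \in `[c, d]%classic) = (c <= z <= d).
  by apply/idP/idP; rewrite inE /= in_itv.
have inner1 x : (\int[mu]_y phi (f \_ E) (g \_ E) (x, y) =
    (((fun x => g x * (F x - F a)) \_ E) x)%:E)%E.
  rewrite /phi /=; have [xE|xE] := boolP (x \in E); last first.
    rewrite !patchE (negbTE xE).
    by under eq_integral do rewrite !mul0r; rewrite integral0.
  have /andP[ax xb] : a <= x <= b by move: xE; rewrite inE /E/= in_itv.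
  transitivity (\int[mu]_(y in `[a, x]) (g x * f y)%:E)%E.
    rewrite [RHS]integral_mkcond; apply: eq_integral => y _.
    rewrite /patch xE !memE indicE (_ : (_, _) \in triangle = (y <= x)); last first.
      by apply/idP/idP; rewrite inE.
    case: (leP y x) => yx; last by rewrite andbF mulr0.
    by rewrite (le_trans yx xb) mulr1 !andbT; case: ifP; rewrite ?mulr0.
  have iax : intable `[a, x] f by exact: intable_itvS iF.
  rewrite integral_EFin//; last exact: intableZ.
  rewrite RintZ// patchE xE (FE x) ?in_itv/= ?ax//; congr (_ * _)%:E.
  by rewrite addrAC subrr add0r.
have inner2 y : (\int[mu]_x phi (f \_ E) (g \_ E) (x, y) =
    (((fun y => f y * (G b - G y)) \_ E) y)%:E)%E.
  rewrite /phi /=; have [yE|yE] := boolP (y \in E); last first.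
    rewrite !patchE (negbTE yE).
    by under eq_integral do rewrite mulr0 mul0r; rewrite integral0.
  have /andP[ay yb] : a <= y <= b by move: yE; rewrite inE /E/= in_itv.
  transitivity (\int[mu]_(x in `[y, b]) (f y * g x)%:E)%E.
    rewrite [RHS]integral_mkcond; apply: eq_integral => x _.
    rewrite /patch yE !memE indicE (_ : (_, _) \in triangle = (y <= x)); last first.
      by apply/idP/idP; rewrite inE.
    case: (leP y x) => yx; last by rewrite mulr0.
    by rewrite (le_trans ay yx) mulr1 /=; case: ifP; rewrite ?mul0r// mulrC.
  have iyb : intable `[y, b] g by exact: intable_itvS ig.
  rewrite integral_EFin//; last exact: intableZ.
  rewrite RintZ// patchE yE (primitive_sub ay yb (lexx b) ig GE).
  by congr (_ * _)%:E; rewrite addrAC subrr add0r.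
(* Equating the two iterated integrals gives ∫ g (F - F a) = ∫ f (G b - G), which is the formula
   once multiplied out. *)
have := Fubini (phi_integrable iF' ig').
under eq_integral do rewrite inner1.
under [in RHS]eq_integral do rewrite inner2.
move=> /(congr1 fine).
rewrite -!/(Rintegral _ _ _) -!Rintegral_mkcond.
have -> : \int[mu]_(x in E) (g x * (F x - F a)) =
    \int[mu]_(x in E) (F x * g x) - F a * (G b - G a).
  rewrite (_ : G b - G a = \int[mu]_(t in E) g t); last first.
    by rewrite (GE b) ?in_itv/= ?ab ?lexx// addrAC subrr add0r.
  rewrite -RintZ// -RintB//; last exact: intableZ.
    by apply: eq_Rintegral => x _; ring.
  by apply: eq_intable (intable_primitive_mul ab iF ig FE) => // x _; rewrite mulrC.
have -> : \int[mu]_(x in E) (f x * (G b - G x)) =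
    G b * (F b - F a) - \int[mu]_(x in E) (f x * G x).
  rewrite (_ : F b - F a = \int[mu]_(t in E) f t); last first.
    by rewrite (FE b) ?in_itv/= ?ab ?lexx// addrAC subrr add0r.
  rewrite -RintZ// -RintB//; [|exact: intableZ|exact: intable_primitive_mul GE].
  by apply: eq_Rintegral => x _; ring.
rewrite -/E => h; lra.
Qed.

Lemma Rintegral_ae E u v : measurable E -> measurable_fun E u ->
  measurable_fun E v -> ae_on E (fun x => u x = v x) ->
  \int[mu]_(x in E) u x = \int[mu]_(x in E) v x.
Proof.
move=> mE mu_ mv uv; congr fine.
apply: (@ae_eq_integral _ _ _ mu _ _ _ mE).
- exact/measurable_EFinP.
- exact/measurable_EFinP.
- by rewrite /ae_on in uv *; move: uv; apply: filterS => x uv Ex; rewrite uv.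
Qed.

(** The integral of (u - t)^2 is nonnegative, with t the mean of u over [a, b]. *)
Lemma Rintegral_cauchy_schwarz a b u : a <= b -> intable `[a, b] u ->
  intable `[a, b] (fun x => u x ^+ 2) ->
  (\int[mu]_(x in `[a, b]) u x) ^+ 2 <=
  (b - a) * \int[mu]_(x in `[a, b]) (u x ^+ 2).
Proof.
rewrite le_eqVlt => /predU1P[->|ab] iu iu2.
  by rewrite set_itv1 !Rintegral_set1 mulr0 expr0n.
set I := Rintegral _ _ _; set J := Rintegral _ _ _.
have ba : 0 < b - a by rewrite subr_gt0.
pose t := I / (b - a).
have mE : measurable (`[a, b]%classic : set R) by exact: measurable_itv.
have : 0 <= \int[mu]_(x in `[a, b]) ((u x - t) ^+ 2).
  by apply: Rintegral_ge0 => x _; exact: sqr_ge0.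
have -> : \int[mu]_(x in `[a, b]) ((u x - t) ^+ 2) =
    J + ((- 2 * t) * I + t ^+ 2 * (b - a)).
  rewrite -(Rintegral_cst_itv _ (ltW ab)) -RintZ// -RintD//; last 2 first.
  - exact: intableZ.
  - exact: intable_cst.
  rewrite -RintD//; last first.
    by apply: intableD => //; [exact: intableZ|exact: intable_cst].
  by apply: eq_Rintegral => x _; ring.
have -> : J + (- 2 * t * I + t ^+ 2 * (b - a)) = J - I ^+ 2 / (b - a).
  by rewrite /t; field; rewrite gt_eqF.
by rewrite subr_ge0 ler_pdivrMr// [leRHS]mulrC.
Qed.

Lemma Lp2P E u : measurable E -> Lp_on E 2%:E u <->
  measurable_fun E u /\ intable E (fun x => u x ^+ 2).
Proof.
move=> mE; split => [u2|[mu_ u2]].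
  split; first exact: Lp2_on_measurable.
  exact: (Lp2_on_mul mE u2 u2).
rewrite /Lp_on.
have mu' : measurable_fun setT (u \_ E) by apply/(measurable_restrictT _ mE).
rewrite inE; apply/andP; split; rewrite inE//=.
rewrite /finite_norm unlock /Lnorm poweR_lty//.
have /integrableP[_] := intable_restrict mE u2.
congr (_ < _)%E; apply: eq_integral => x _.
have pow2 (c : R) : (`|c%:E| `^ 2 = `|(c ^+ 2)%:E|)%E.
  by rewrite /= powR_mulrn// normrX.
rewrite [RHS]pow2 /= /patch; case: ifPn => // _.
by rewrite expr0n.
Qed.

(** For finite p the function u^2 is bounded by 1 + |u|^p, and for p = +oo by a constant almost
    everywhere; both bounds are integrable on a set of finite measure. *)
Lemma Lp_on_ge2 E (p : \bar R) u : measurable E -> (mu E < +oo)%E ->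
  (2%:E <= p)%E -> Lp_on E p u -> Lp_on E 2%:E u.
Proof.
move=> mE Eoo p2; rewrite /Lp_on => up.
have mu_ : measurable_fun E u.
  by apply/(measurable_restrictT _ mE); have := sub_Lfun_mfun up; rewrite inE.
apply/(Lp2P _ mE); split=> //.
have mu2 : measurable_fun E (fun x => u x ^+ 2) by exact: measurable_funX.
case: p p2 up => [p| |] p2 up.
- have p2' : 2 <= p by rewrite -lee_fin.
  have p1 : 1 <= p by rewrite (le_trans _ p2')// ler1n.
  have := Lfun_integrable p1 up.
  move=> /(@integrableS _ _ _ mu _ _ _ measurableT mE (@subsetT _ E)) ip.
  apply: (intable_le (v := fun x => 1 + `|(u \_ E) x| `^ p)) => //.
    by apply: intableD => //; exact: intable_cst_fin.
  move=> x Ex; rewrite patchE mem_set// ger0_norm ?sqr_ge0//.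
  rewrite -real_normK ?num_real//.
  have [u1|u1] := leP `|u x| 1.
    by rewrite (le_trans (exprn_ile1 2 _ u1))// lerDl powR_ge0.
  rewrite -powR_mulrn// (le_trans (ler_powR (ltW u1) p2'))//.
  by rewrite lerDr.
- move: up; rewrite inE => /andP[_]; rewrite inE /= /finite_norm unlock /Lnorm.
  case: ifPn => [_|].
    move=> /ess_supr_bounded[M fM].
    apply/integrableP; split; first exact/measurable_EFinP.
    apply: (@le_lt_trans _ _ (\int[mu]_(x in E) (M ^+ 2)%:E))%E; last first.
      by rewrite integral_cst// lte_mul_pinfty// lee_fin sqr_ge0.
    apply: ae_ge0_le_integral => //.
    + by apply: measurableT_comp => //; exact/measurable_EFinP.
    + by move=> x _; rewrite lee_fin sqr_ge0.
    + apply: filterS fM => x /= fM Ex.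
      move: fM; rewrite patchE mem_set// lee_fin => fM.
      rewrite ger0_norm ?sqr_ge0// -real_normK ?num_real//.
      by rewrite ler_sqr ?nnegrE// (le_trans _ fM).
  (* The norm at p = +oo is an essential supremum provided that the whole line has positive measure,
     which the interval [0, 1] witnesses. *)
  move=> /negP[]; apply: (@lt_le_trans _ _ (mu `[0, 1]%classic)).
    by rewrite [ltRHS](@lebesgue_measure_itv R `[0, 1]) /= lte_fin ltr01 -EFinB subr0 lte_fin.
  by apply: (@le_measure _ _ _ mu); rewrite ?inE//; exact: measurable_itv.
- by [].
Qed.

Lemma Lp2_intable a b u : Lp_on `[a, b] 2%:E u -> intable `[a, b] u.
Proof.
have mE : measurable (`[a, b]%classic : set R) by exact: measurable_itv.
move=> /(Lp2P _ mE)[mu_ u2].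
apply: (intable_le (v := fun x => 1 + u x ^+ 2)) => //.
  by apply: intableD => //; exact: intable_cst.
move=> x _; have [u1|u1] := leP `|u x| 1.
  by rewrite (le_trans u1)// lerDl sqr_ge0.
by rewrite -(@real_normK _ (u x)) ?num_real// ler_wpDl// expr2 ler_peMr// ltW.
Qed.

Lemma intable_primitive a b F f : a <= b -> intable `[a, b] f ->
  primitive a b F f -> intable `[a, b] F.
Proof.
move=> ab iF FE.
apply: eq_intable (intable_primitive_mul ab iF (intable_cst a b 1) FE) => //.
by move=> x _; rewrite mul1r.
Qed.

Lemma Lp2_primitive a b F f : a <= b -> intable `[a, b] f ->
  primitive a b F f -> Lp_on `[a, b] 2%:E F.
Proof.
move=> ab iF FE; apply/(Lp2P _ (@measurable_itv R `[a, b])); split.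
  exact: primitive_measurable FE.
exact: (intable_primitive_mul ab iF (intable_primitive ab iF FE) FE).
Qed.

(** The increment of u^2 is the integral of 2 u v, and 2 |u v| <= e v^2 + e^-1 u^2. The free weight
    e is the source of the arbitrarily small factor in the Sobolev bound. *)
Lemma primitive_sqr_sub a b x y e u v : 0 < e -> a <= y -> y <= x -> x <= b ->
  Lp_on `[a, b] 2%:E v -> primitive a b u v ->
  `|u x ^+ 2 - u y ^+ 2| <= e * \int[mu]_(t in `[a, b]) (v t ^+ 2) +
    e^-1 * \int[mu]_(t in `[a, b]) (u t ^+ 2).
Proof.
move=> e0 ay yx xb v2 uv.
have ab : a <= b by rewrite (le_trans ay)// (le_trans yx).
have iv := Lp2_intable v2.
have mE : measurable (`[a, b]%classic : set R) by exact: measurable_itv.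
have mE' : measurable (`[y, x]%classic : set R) by exact: measurable_itv.
have iv' := intable_itvS ay xb iv.
have uv' := primitive_restrict ay yx xb iv uv.
have [_ iv2] := (Lp2P _ mE).1 v2.
have iu2 : intable `[a, b] (fun t => u t ^+ 2).
  by have [] := (Lp2P _ mE).1 (Lp2_primitive ab iv uv).
have -> : u x ^+ 2 - u y ^+ 2 = 2 * \int[mu]_(t in `[y, x]) (u t * v t).
  have := integration_by_parts_primitive yx iv' iv' uv' uv'.
  under eq_Rintegral do rewrite mulrC.
  by rewrite -!expr2 => <-; ring.
have iuv : intable `[y, x] (fun t => u t * v t).
  by apply: eq_intable (intable_primitive_mul yx iv' iv' uv') => // t _; rewrite mulrC.
rewrite -RintZ//.
rewrite (le_trans (@le_normr_Rintegral _ _ _ mu _ _ mE' (intableZ _ mE' iuv)))//.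
rewrite -!RintZ// -RintD//; [|exact: intableZ..].
have iab : intable `[a, b] (fun t => e * v t ^+ 2 + e^-1 * u t ^+ 2).
  by apply: intableD => //; exact: intableZ.
apply: (@le_trans _ _
    (\int[mu]_(t in `[y, x]) (e * v t ^+ 2 + e^-1 * u t ^+ 2))).
  apply: (@le_Rintegral _ _ _ mu) => //.
  - exact: (intable_norm (intableZ _ mE' iuv)).
  - exact: intable_itvS iab.
  - move=> t _; rewrite !normrM ger0_norm// -subr_ge0.
    rewrite -(real_normK (num_real (v t))) -(real_normK (num_real (u t))).
    set p := `|u t|; set q := `|v t|.
    rewrite (_ : _ - _ = e^-1 * (e * q - p) ^+ 2); last by field; rewrite gt_eqF.
    by rewrite mulr_ge0 ?sqr_ge0// invr_ge0 ltW.
have ge0 t : 0 <= e * v t ^+ 2 + e^-1 * u t ^+ 2.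
  by rewrite addr_ge0// mulr_ge0 ?sqr_ge0// ?invr_ge0 ltW.
rewrite [leRHS](Rintegral_chasles ay (le_trans yx xb) iab).
rewrite (@Rintegral_chasles y b x)//; last exact: intable_itvS iab.
by rewrite addrCA lerDl addr_ge0// Rintegral_ge0.
Qed.

(** Average [primitive_sqr_sub] over y in [a, b]: the mean of u^2 supplies the term with (b -
    a)^-1. *)
Lemma sobolev_sqr a b x e u v : 0 < e -> a < b -> x \in `[a, b] ->
  Lp_on `[a, b] 2%:E v -> primitive a b u v ->
  u x ^+ 2 <= e * \int[mu]_(t in `[a, b]) (v t ^+ 2) +
    (e^-1 + (b - a)^-1) * \int[mu]_(t in `[a, b]) (u t ^+ 2).
Proof.
move=> e0 ab xab v2 uv.
set I := Rintegral _ _ _; set J := Rintegral _ _ _.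
have ba : 0 < b - a by rewrite subr_gt0.
have mE : measurable (`[a, b]%classic : set R) by exact: measurable_itv.
have iv := Lp2_intable v2.
have [_ iu2] := (Lp2P _ mE).1 (Lp2_primitive (ltW ab) iv uv).
suff : (u x ^+ 2 - (e * I + e^-1 * J)) * (b - a) <= J.
  rewrite -ler_pdivlMr// lerBlDr => /le_trans; apply.
  by rewrite [leLHS](_ : _ = e * I + (e^-1 + (b - a)^-1) * J)//; ring.
rewrite -(Rintegral_cst_itv _ (ltW ab)); apply: (@le_Rintegral _ _ _ mu) => //.
  exact: intable_cst.
move=> y /=; rewrite in_itv/= => /andP[ay yb].
move: xab; rewrite in_itv/= => /andP[ax xb].
rewrite lerBlDr -lerBlDl (le_trans (ler_norm _))//.
have [yx|/ltW xy] := leP y x; first exact: primitive_sqr_sub uv.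
by rewrite distrC; exact: primitive_sqr_sub uv.
Qed.

End RealIntegrals.

(** * Complex-valued integrals and Green's formula *)

Section ComplexIntegrals.
Context {R : realType}.
Local Notation mu := (@lebesgue_measure R).
Local Notation C := R[i].
Local Notation Re := (@complex.Re R).
Local Notation Im := (@complex.Im R).
Implicit Types (E : set R) (a b x y : R) (c : R[i]) (f g h F G : R -> R[i]).

Lemma Re_mul (z w : C) : Re (z * w) = Re z * Re w - Im z * Im w.
Proof. by case: z w => ? ? []. Qed.
Lemma Im_mul (z w : C) : Im (z * w) = Re z * Im w + Im z * Re w.
Proof. by case: z w => ? ? []. Qed.
Lemma Re_add (z w : C) : Re (z + w) = Re z + Re w.
Proof. by case: z w => ? ? []. Qed.
Lemma Im_add (z w : C) : Im (z + w) = Im z + Im w.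
Proof. by case: z w => ? ? []. Qed.
Lemma Re_opp (z : C) : Re (- z) = - Re z. Proof. by case: z. Qed.
Lemma Im_opp (z : C) : Im (- z) = - Im z. Proof. by case: z. Qed.
Lemma Re_conj (z : C) : Re z^* = Re z. Proof. by case: z. Qed.
Lemma Im_conj (z : C) : Im z^* = - Im z. Proof. by case: z. Qed.
Lemma complex_ext (z w : C) : Re z = Re w -> Im z = Im w -> z = w.
Proof. by case: z w => ? ? [? ?] /= -> ->. Qed.

Definition ReIm := (Re_mul, Im_mul, Re_add, Im_add, Re_opp, Im_opp, Re_conj, Im_conj).

Definition cintable E f := intable E (Re \o f) /\ intable E (Im \o f).

Lemma cintableS E D f : measurable E -> measurable D -> D `<=` E ->
  cintable E f -> cintable D f.
Proof. by move=> mE mD DE [f1 f2]; split; apply: intableS DE _. Qed.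

Lemma eq_cintable E f g : {in E, f =1 g} -> measurable E ->
  cintable E f -> cintable E g.
Proof.
by move=> fg mE [f1 f2]; split; [apply: eq_intable f1|apply: eq_intable f2] => // x xE /=;
  rewrite fg.
Qed.

Lemma eq_cintegral E f g : {in E, f =1 g} -> cintegral E f = cintegral E g.
Proof.
by move=> fg; rewrite /cintegral; congr (_ +i* _); apply: eq_Rintegral => x xE;
  rewrite fg.
Qed.

Lemma cintableD E f g : measurable E -> cintable E f -> cintable E g ->
  cintable E (fun x => f x + g x).
Proof.
move=> mE [f1 f2] [g1 g2]; split.
  by apply: eq_intable (intableD mE f1 g1) => // x _ /=; rewrite ReIm.
by apply: eq_intable (intableD mE f2 g2) => // x _ /=; rewrite ReIm.
Qed.

Lemma cintableZ E c f : measurable E -> cintable E f ->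
  cintable E (fun x => c * f x).
Proof.
move=> mE [f1 f2]; split.
  apply: eq_intable (intableB mE (intableZ (Re c) mE f1) (intableZ (Im c) mE f2)) => //.
  by move=> x _ /=; rewrite ReIm.
apply: eq_intable (intableD mE (intableZ (Re c) mE f2) (intableZ (Im c) mE f1)) => //.
by move=> x _ /=; rewrite ReIm.
Qed.

Lemma cintableN E f : measurable E -> cintable E f -> cintable E (fun x => - f x).
Proof.
move=> mE iF; apply: eq_cintable (cintableZ (-1) mE iF) => // x _.
by rewrite mulN1r.
Qed.

Lemma cintableB E f g : measurable E -> cintable E f -> cintable E g ->
  cintable E (fun x => f x - g x).
Proof. by move=> mE iF ig; exact: cintableD mE iF (cintableN mE ig). Qed.

Lemma cintableJ E f : measurable E -> cintable E f -> cintable E (fun x => (f x)^*).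
Proof.
move=> mE [f1 f2]; split.
  by apply: eq_intable f1 => // x _ /=; rewrite ReIm.
by apply: eq_intable (intableN mE f2) => // x _ /=; rewrite ReIm.
Qed.

Lemma cintegralD E f g : measurable E -> cintable E f -> cintable E g ->
  cintegral E (fun x => f x + g x) = cintegral E f + cintegral E g.
Proof.
move=> mE [f1 f2] [g1 g2]; apply: complex_ext; rewrite ReIm /=.
  by rewrite -RintD//; apply: eq_Rintegral => x _; rewrite ReIm.
by rewrite -RintD//; apply: eq_Rintegral => x _; rewrite ReIm.
Qed.

Lemma cintegralZ E c f : measurable E -> cintable E f ->
  cintegral E (fun x => c * f x) = c * cintegral E f.
Proof.
move=> mE [f1 f2]; apply: complex_ext; rewrite ReIm /=.
  rewrite -!RintZ// -RintB//; [|exact: intableZ..].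
  by apply: eq_Rintegral => x _; rewrite ReIm.
rewrite -!RintZ// -RintD//; [|exact: intableZ..].
by apply: eq_Rintegral => x _; rewrite ReIm.
Qed.

Lemma cintegralN E f : measurable E -> cintable E f ->
  cintegral E (fun x => - f x) = - cintegral E f.
Proof.
move=> mE iF; rewrite -mulN1r -cintegralZ//.
by apply: eq_cintegral => x _; rewrite mulN1r.
Qed.

Lemma cintegralB E f g : measurable E -> cintable E f -> cintable E g ->
  cintegral E (fun x => f x - g x) = cintegral E f - cintegral E g.
Proof.
move=> mE iF ig; rewrite -cintegralN// -cintegralD//; exact: cintableN.
Qed.

Lemma cintegralJ E f : measurable E -> cintable E f ->
  cintegral E (fun x => (f x)^*) = (cintegral E f)^*.
Proof.
move=> mE [f1 f2]; apply: complex_ext; rewrite ReIm /=.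
  by apply: eq_Rintegral => x _; rewrite ReIm.
rewrite -mulN1r -RintZ//.
by apply: eq_Rintegral => x _; rewrite ReIm mulN1r.
Qed.

Lemma cintegral0 E : cintegral E (cst 0) = 0.
Proof.
rewrite /cintegral; under eq_Rintegral do rewrite /=.
by rewrite /Rintegral integral0.
Qed.

Lemma cintegral_ae E f g : measurable E -> cintable E f -> cintable E g ->
  ae_on E (fun x => f x = g x) -> cintegral E f = cintegral E g.
Proof.
move=> mE [f1 f2] [g1 g2] fg; congr (_ +i* _); apply: Rintegral_ae => //.
- exact: (intable_measurable f1).
- exact: (intable_measurable g1).
- by apply: ae_onS fg => x _ /= ->.
- exact: (intable_measurable f2).
- exact: (intable_measurable g2).
- by apply: ae_onS fg => x _ /= ->.
Qed.

Lemma cintegral_set1 a f : cintegral `[a, a] f = 0.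
Proof. by rewrite set_itv1 /cintegral !Rintegral_set1. Qed.

Lemma is_primitiveP a b F f :
  is_primitive a b F f <-> primitive a b (Re \o F) (Re \o f) /\
                           primitive a b (Im \o F) (Im \o f).
Proof.
split=> [FE|[F1 F2] x xab].
  by split=> x xab /=; rewrite FE// ReIm.
by apply: complex_ext; rewrite ReIm; [exact: F1|exact: F2].
Qed.

Lemma cintable_primitive_mul a b F f g : a <= b -> cintable `[a, b] f ->
  cintable `[a, b] g -> is_primitive a b F f ->
  cintable `[a, b] (fun x => g x * F x).
Proof.
move=> ab [f1 f2] [g1 g2] /is_primitiveP[F1 F2].
have mE : measurable (`[a, b]%classic : set R) by exact: measurable_itv.
have H u v U w := @intable_primitive_mul R a b U u w ab.
split.
  apply: eq_intable (intableB mE (intable_primitive_mul ab f1 g1 F1)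
    (intable_primitive_mul ab f2 g2 F2)) => //.
  by move=> x _ /=; rewrite ReIm.
apply: eq_intable (intableD mE (intable_primitive_mul ab f2 g1 F2)
    (intable_primitive_mul ab f1 g2 F1)) => //.
by move=> x _ /=; rewrite ReIm.
Qed.

Lemma is_primitive_cst a b c : is_primitive a b (cst c) (cst 0).
Proof. by move=> x _; rewrite cintegral0 addr0. Qed.

Lemma cintable_primitive a b F f : a <= b -> cintable `[a, b] f ->
  is_primitive a b F f -> cintable `[a, b] F.
Proof.
by move=> ab [f1 f2] /is_primitiveP[F1 F2]; split;
  [exact: intable_primitive F1|exact: intable_primitive F2].
Qed.

Lemma L2_on_primitive a b F f : a <= b -> cintable `[a, b] f ->
  is_primitive a b F f -> L2_on `[a, b] F.
Proof.
by move=> ab [f1 f2] /is_primitiveP[F1 F2]; split;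
  [exact: Lp2_primitive F1|exact: Lp2_primitive F2].
Qed.

Lemma L2_cintable a b f : L2_on `[a, b] f -> cintable `[a, b] f.
Proof. by case=> f1 f2; split; exact: Lp2_intable. Qed.

Lemma L2_mul_cintable E f g : measurable E -> L2_on E f -> L2_on E g ->
  cintable E (fun x => f x * g x).
Proof.
move=> mE [f1 f2] [g1 g2]; split.
  apply: eq_intable (intableB mE (Lp2_on_mul mE f1 g1) (Lp2_on_mul mE f2 g2)) => //.
  by move=> x _ /=; rewrite ReIm.
apply: eq_intable (intableD mE (Lp2_on_mul mE f1 g2) (Lp2_on_mul mE f2 g1)) => //.
by move=> x _ /=; rewrite ReIm.
Qed.

Lemma L2_onJ E f : L2_on E f -> L2_on E (fun x => (f x)^*).
Proof.
move=> [f1 f2]; split.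
  by move: f1; congr Lp_on; apply/funext => x /=; rewrite ReIm.
have := Lp2_on_lin (-1) f2 (Lp2_on0 E); congr Lp_on; apply/funext => x /=.
by rewrite ReIm mulN1r addr0.
Qed.

Lemma L2_on_cst a b c : L2_on `[a, b] (cst c).
Proof.
have mE : measurable (`[a, b]%classic : set R) by exact: measurable_itv.
split; apply/(Lp2P _ mE); split; try exact: measurable_cst.
  exact: (intable_cst a b (Re c ^+ 2)).
exact: (intable_cst a b (Im c ^+ 2)).
Qed.

Lemma is_primitiveD a b F f G g : cintable `[a, b] f -> cintable `[a, b] g ->
  is_primitive a b F f -> is_primitive a b G g ->
  is_primitive a b (fun x => F x + G x) (fun x => f x + g x).
Proof.
move=> iF ig FE GE x; rewrite in_itv/= => /andP[ax xb].
have S : `[a, x]%classic `<=` `[a, b]%classic by apply: subset_itvl; rewrite bnd_simp.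
rewrite cintegralD//; [|exact: cintableS iF|exact: cintableS ig].
by rewrite (FE x) ?(GE x) ?in_itv/= ?ax// addrACA.
Qed.

Lemma is_primitiveZ a b c F f : cintable `[a, b] f ->
  is_primitive a b F f -> is_primitive a b (fun x => c * F x) (fun x => c * f x).
Proof.
move=> iF FE x; rewrite in_itv/= => /andP[ax xb].
have S : `[a, x]%classic `<=` `[a, b]%classic by apply: subset_itvl; rewrite bnd_simp.
rewrite cintegralZ//; last exact: cintableS iF.
by rewrite (FE x) ?in_itv/= ?ax// mulrDr.
Qed.

Lemma is_primitiveJ a b F f : cintable `[a, b] f ->
  is_primitive a b F f ->
  is_primitive a b (fun x => (F x)^*) (fun x => (f x)^*).
Proof.
move=> iF FE x; rewrite in_itv/= => /andP[ax xb].
have S : `[a, x]%classic `<=` `[a, b]%classic by apply: subset_itvl; rewrite bnd_simp.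
rewrite cintegralJ//; last exact: cintableS iF.
by rewrite FE ?in_itv/= ?ax// rmorphD.
Qed.

Lemma is_primitive_ae a b F f g : cintable `[a, b] f -> cintable `[a, b] g ->
  ae_on `[a, b] (fun x => f x = g x) -> is_primitive a b F f ->
  is_primitive a b F g.
Proof.
move=> iF ig fg FE x; rewrite in_itv/= => /andP[ax xb].
have S : `[a, x]%classic `<=` `[a, b]%classic by apply: subset_itvl; rewrite bnd_simp.
rewrite FE ?in_itv/= ?ax//; congr (_ + _); apply: cintegral_ae => //.
- exact: cintableS iF.
- exact: cintableS ig.
- exact: ae_on_sub fg.
Qed.

Lemma is_primitive_cintegral a b f :
  is_primitive a b (fun x => cintegral `[a, x] f) f.
Proof. by move=> x _; rewrite cintegral_set1 add0r. Qed.

Lemma cintegration_by_parts a b F f G g : a <= b ->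
  cintable `[a, b] f -> cintable `[a, b] g ->
  is_primitive a b F f -> is_primitive a b G g ->
  cintegral `[a, b] (fun x => f x * (G x)^*) +
  cintegral `[a, b] (fun x => F x * (g x)^*) = F b * (G b)^* - F a * (G a)^*.
Proof.
move=> ab iF ig FE GE.
have mE : measurable (`[a, b]%classic : set R) by exact: measurable_itv.
have jg := cintableJ mE ig; have JE := is_primitiveJ ig GE.
rewrite -cintegralD//; last 2 first.
- exact: cintable_primitive_mul JE.
- apply: eq_cintable (cintable_primitive_mul ab iF jg FE) => // x _.
  by rewrite mulrC.
move: iF jg FE JE => [f1 f2] [g1 g2] /is_primitiveP[F1 F2] /is_primitiveP[G1 G2].
have ibp u U v V := @integration_by_parts_primitive R a b U u V v ab.
have M1 u U v V (iu : intable `[a, b] u) (iv : intable `[a, b] v)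
    (uE : primitive a b U u) (vE : primitive a b V v) :=
  intableD mE (intable_primitive_mul ab iv iu vE)
    (eq_intable (fun x _ => mulrC (v x) (U x)) mE (intable_primitive_mul ab iu iv uE)).
have E1 u U v V (iu : intable `[a, b] u) (iv : intable `[a, b] v)
    (uE : primitive a b U u) (vE : primitive a b V v) :
    \int[mu]_(x in `[a, b]) (u x * V x + U x * v x) = U b * V b - U a * V a.
  rewrite -(ibp _ _ _ _ iu iv uE vE) -RintD//.
    exact: (intable_primitive_mul ab iv iu vE).
  exact: (eq_intable (fun x _ => mulrC (v x) (U x)) mE (intable_primitive_mul ab iu iv uE)).
(* The complex identity is assembled from four real ones, pairing the real and imaginary parts of F
   with those of G. *)
have e11 := E1 _ _ _ _ f1 g1 F1 G1; have e22 := E1 _ _ _ _ f2 g2 F2 G2.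
have e12 := E1 _ _ _ _ f1 g2 F1 G2; have e21 := E1 _ _ _ _ f2 g1 F2 G1.
have m11 := M1 _ _ _ _ f1 g1 F1 G1; have m22 := M1 _ _ _ _ f2 g2 F2 G2.
have m12 := M1 _ _ _ _ f1 g2 F1 G2; have m21 := M1 _ _ _ _ f2 g1 F2 G1.
have rearr (p q r s : R) : p - q - (r - s) = (p - r) - (q - s) by ring.
have rearr' (p q r s : R) : p + q - (r + s) = (p - r) + (q - s) by ring.
apply: complex_ext; rewrite !(Re_add, Im_add, Re_opp, Im_opp) (Re_mul, Im_mul).
  rewrite Re_mul rearr -[X in X - _]e11 -[X in _ - X]e22 -RintB//.
  by apply: eq_Rintegral => x _; rewrite /= Re_add !Re_mul opprD addrACA.
rewrite Im_mul rearr' -[X in X + _]e12 -[X in _ + X]e21 -RintD//.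
by apply: eq_Rintegral => x _; rewrite /= Im_add !Im_mul addrACA.
Qed.

(** Two integrations by parts share the integral of f1 times the conjugate of k1, which cancels. *)
Lemma green_formula a b f f1 f2 k k1 k2 : a <= b ->
  cintable `[a, b] f2 -> cintable `[a, b] k2 ->
  is_primitive a b f1 f2 -> is_primitive a b f f1 ->
  is_primitive a b k1 k2 -> is_primitive a b k k1 ->
  cintegral `[a, b] (fun x => f2 x * (k x)^*) -
  cintegral `[a, b] (fun x => f x * (k2 x)^*) =
  (f1 b * (k b)^* - f b * (k1 b)^*) - (f1 a * (k a)^* - f a * (k1 a)^*).
Proof.
move=> ab if2 ik2 f1E fE k1E kE.
have if1 := cintable_primitive ab if2 f1E.
have ik1 := cintable_primitive ab ik2 k1E.
have h1 := cintegration_by_parts ab if2 ik1 f1E kE.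
have h2 := cintegration_by_parts ab if1 ik2 fE k1E.
set A := cintegral _ _ in h1 *; set B := cintegral _ _ in h1 h2 *.
have -> : A = (f1 b * (k b)^* - f1 a * (k a)^*) - B by rewrite -h1 addrK.
set D := cintegral _ _ in h2 *.
have -> : B = (f b * (k1 b)^* - f a * (k1 a)^*) - D by rewrite -h2 addrK.
rewrite [- (_ - D)]opprB [D - _]addrC addrA addrK.
by rewrite !opprD !opprK addrACA.
Qed.

End ComplexIntegrals.

(** * Weak solutions of u'' = q *)

Section Polynomials.
Context {R : realType}.
Implicit Types (a b x : R) (p : {poly R}).

Lemma primitive_horner a b p : primitive a b (horner p) (horner p^`()).
Proof.
move=> x; rewrite in_itv/= => /andP[+ _]; rewrite le_eqVlt => /predU1P[->|ax].
  by rewrite set_itv1 Rintegral_set1 addr0.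
rewrite /Rintegral (@continuous_FTC2 _ (horner p^`()) (horner p) a x ax).
- by rewrite -EFinB /= addrC subrK.
- exact/continuous_subspaceT/continuous_horner.
- split.
  + by move=> z _; exact: derivable_horner.
  + exact/cvg_at_right_filter/continuous_horner.
  + exact/cvg_at_left_filter/continuous_horner.
- by move=> z _; rewrite -derivE.
Qed.

Lemma intable_horner a b p : intable `[a, b] (horner p).
Proof.
apply: (@continuous_compact_integrable _ (horner p)); first exact: segment_compact.
exact/continuous_subspaceT/continuous_horner.
Qed.

Definition cpoly p (x : R) : R[i] := (p.[x])%:C.

Lemma is_primitive_cpoly a b p : is_primitive a b (cpoly p) (cpoly p^`()).
Proof.
apply/is_primitiveP; split; first exact: primitive_horner.
by move=> x _; rewrite /= /Rintegral integral0 addr0.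
Qed.

Lemma cintable_cpoly a b p : cintable `[a, b] (cpoly p).
Proof. by split; [exact: intable_horner|exact: intable_cst]. Qed.

Lemma L2_on_cpoly a b p : a <= b -> L2_on `[a, b] (cpoly p).
Proof.
move=> ab.
exact: (L2_on_primitive ab (cintable_cpoly a b _) (@is_primitive_cpoly a b p)).
Qed.

Lemma H2_cpoly a b p : a <= b ->
  H2_with_derivatives a b (cpoly p) (cpoly p^`()) (cpoly p^`()^`()).
Proof. by move=> ab; split; [exact: L2_on_cpoly|exact: is_primitive_cpoly..]. Qed.

(** The cubic Hermite interpolant in powers of x - a: the two lowest coefficients are the data at a,
    and c2, c3 solve the linear system given by the data at b. The last clause records that the
    degree is at most 3, so that p'' is affine. *)
Lemma hermite_interpolation a b v0 v1 d0 d1 : a < b -> exists p,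
  [/\ p.[a] = v0, p.[b] = v1, p^`().[a] = d0, p^`().[b] = d1
    & p^`()^`()^`()^`() = 0].
Proof.
move=> ab; have L0 : b - a != 0 by rewrite subr_eq0 gt_eqF.
set L := b - a in L0.
pose c2 := 3 * (v1 - v0) / L ^+ 2 - (2 * d0 + d1) / L.
pose c3 := 2 * (v0 - v1) / L ^+ 3 + (d0 + d1) / L ^+ 2.
pose Y := 'X - a%:P : {poly R}.
exists (v0%:P + d0 *: Y + c2 *: Y ^+ 2 + c3 *: Y ^+ 3).
have Y' : Y^`() = 1 by rewrite /Y derivB derivX derivC subr0.
have YE x : Y.[x] = x - a by rewrite /Y hornerXsubC.
set P := (X in X^`()^`()^`()^`() = 0).
have P1 : P^`() = d0%:P + (2 * c2) *: Y + (3 * c3) *: Y ^+ 2.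
  rewrite /P !derivD !derivZ !deriv_exp derivC Y' /= -!mul_polyC !polyCM.
  by rewrite !polyC_natr; ring.
have P2 : P^`()^`() = (2 * c2)%:P + (6 * c3) *: Y.
  rewrite P1 !derivD !derivZ !deriv_exp derivC Y' /= -!mul_polyC !polyCM.
  by rewrite !polyC_natr; ring.
have P3 : P^`()^`()^`() = (6 * c3)%:P.
  by rewrite P2 derivD derivZ derivC Y' add0r alg_polyC.
split; last by rewrite P3 derivC.
- by rewrite /P !(YE, horner_exp, hornerZ, hornerC, hornerD) subrr; ring.
- rewrite /P !(YE, horner_exp, hornerZ, hornerC, hornerD) -/L /c2 /c3; field.
  exact: L0.
- by rewrite P1 !(YE, horner_exp, hornerZ, hornerC, hornerD) subrr; ring.
- rewrite P1 !(YE, horner_exp, hornerZ, hornerC, hornerD) -/L /c2 /c3; field.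
  exact: L0.
Qed.

End Polynomials.

Section DuBoisReymond.
Context {R : realType}.
Implicit Types (a b x : R) (c : R[i]) (f g u q : R -> R[i]).

Lemma cpoly0 x : cpoly (0 : {poly R}) x = 0.
Proof. by rewrite /cpoly horner0. Qed.

Lemma L2_onD (E : set R) f g : L2_on E f -> L2_on E g -> L2_on E (fun x => f x + g x).
Proof.
by move=> f2 g2; have := L2_on_lin 1 f2 g2; congr L2_on; apply/funext => x; rewrite mul1r.
Qed.

Lemma L2_onZ (E : set R) c f : L2_on E f -> L2_on E (fun x => c * f x).
Proof.
by move=> f2; have := L2_on_lin c f2 (L2_on0 E); congr L2_on; apply/funext => x;
  rewrite addr0.
Qed.

Lemma L2_onN (E : set R) f : L2_on E f -> L2_on E (fun x => - f x).
Proof.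
by move=> /(L2_onZ (-1)); congr L2_on; apply/funext => x; rewrite mulN1r.
Qed.

Lemma L2_onB (E : set R) f g : L2_on E f -> L2_on E g -> L2_on E (fun x => f x - g x).
Proof. by move=> f2 /L2_onN; exact: L2_onD. Qed.

Lemma H2_lin a b c f f1 f2 g g1 g2 : a <= b ->
  H2_with_derivatives a b f f1 f2 -> H2_with_derivatives a b g g1 g2 ->
  H2_with_derivatives a b (fun x => c * f x + g x) (fun x => c * f1 x + g1 x)
    (fun x => c * f2 x + g2 x).
Proof.
move=> ab [f2L f1E fE] [g2L g1E gE].
have mE : measurable (`[a, b]%classic : set R) by exact: measurable_itv.
have if2 := L2_cintable f2L; have ig2 := L2_cintable g2L.
have if1 := cintable_primitive ab if2 f1E.
have ig1 := cintable_primitive ab ig2 g1E.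
split; first exact: L2_on_lin.
  by apply: is_primitiveD (is_primitiveZ c if2 f1E) g1E => //; exact: cintableZ.
by apply: is_primitiveD (is_primitiveZ c if1 fE) gE => //; exact: cintableZ.
Qed.

(* The test functions are the double primitives f of u - k, with k'' = q,
   corrected by the cubic polynomial that makes f and f' vanish at both ends;
   this correction changes f'' by an affine function, to which f'' is
   orthogonal. *)
Lemma du_bois_reymond a b u q : a < b -> L2_on `[a, b] u -> cintable `[a, b] q ->
  (forall f f1 f2, H2_with_derivatives a b f f1 f2 ->
    f a = 0 -> f b = 0 -> f1 a = 0 -> f1 b = 0 ->
    cintegral `[a, b] (fun x => f2 x * (u x)^*) =
    cintegral `[a, b] (fun x => f x * (q x)^*)) ->
  exists g g1, [/\ is_primitive a b g1 q, is_primitive a b g g1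
    & ae_on `[a, b] (fun x => u x = g x)].
Proof.
move=> ab u2 iq test; have ab' := ltW ab.
have mE : measurable (`[a, b]%classic : set R) by exact: measurable_itv.
pose k1 x := cintegral `[a, x] q; pose k x := cintegral `[a, x] k1.
have k1E : is_primitive a b k1 q.
  exact: is_primitive_cintegral.
have ik1 := cintable_primitive ab' iq k1E.
have kE : is_primitive a b k k1.
  exact: is_primitive_cintegral.
have k2 : L2_on `[a, b] k := L2_on_primitive ab' ik1 kE.
pose d x := u x - k x.
have d2 : L2_on `[a, b] d by exact: L2_onB.
have id := L2_cintable d2.
pose D1 x := cintegral `[a, x] d; pose D x := cintegral `[a, x] D1.
have D1E : is_primitive a b D1 d.
  exact: is_primitive_cintegral.
have iD1 := cintable_primitive ab' id D1E.
have DE : is_primitive a b D D1.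
  exact: is_primitive_cintegral.
(* D and D1 vanish at a by construction; p and r have zero data at a and remove, respectively, the
   value and the slope at b. *)
have [p [pa pb p'a p'b p4]] := hermite_interpolation 0 1 0 0 ab.
have [r [ra rb r'a r'b r4]] := hermite_interpolation 0 0 0 1 ab.
pose A (s t : {poly R}) x := - D b * cpoly s x + (- D1 b * cpoly t x).
have HA : H2_with_derivatives a b (A p r) (A p^`() r^`()) (A p^`()^`() r^`()^`()).
  have := H2_lin (- D1 b) ab' (H2_cpoly r ab') (H2_cpoly 0 ab').
  rewrite !deriv0 => /(H2_lin (- D b) ab' (H2_cpoly p ab')).
  by congr H2_with_derivatives; apply/funext => x; rewrite /A cpoly0 addr0.
pose f x := 1 * D x + A p r x; pose f1 x := 1 * D1 x + A p^`() r^`() x.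
pose f2 x := 1 * d x + A p^`()^`() r^`()^`() x.
have Hf : H2_with_derivatives a b f f1 f2 by exact: H2_lin.
have fa : f a = 0.
  by rewrite /f /A /D cintegral_set1 /cpoly pa ra !mulr0 !addr0.
have fb : f b = 0.
  by rewrite /f /A /cpoly pb rb mulr0 mulr1 mul1r addr0 subrr.
have f1a : f1 a = 0.
  by rewrite /f1 /A /D1 cintegral_set1 /cpoly p'a r'a !mulr0 !addr0.
have f1b : f1 b = 0.
  by rewrite /f1 /A /cpoly p'b r'b mulr0 mulr1 mul1r add0r subrr.
have := test _ _ _ Hf fa fb f1a f1b.
have [f2L f1E fE] := Hf; have if2 := L2_cintable f2L.
have := green_formula ab' if2 iq f1E fE k1E kE.
rewrite fa fb f1a f1b !mul0r !subrr => /eqP; rewrite subr_eq0 => /eqP <- e1.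
pose B2 := A p^`()^`() r^`()^`(); pose B3 := A p^`()^`()^`() r^`()^`()^`().
have HB : H2_with_derivatives a b B2 B3 (cst 0).
  have := H2_lin (- D1 b) ab' (H2_cpoly r^`()^`() ab') (H2_cpoly 0 ab').
  rewrite !deriv0 => /(H2_lin (- D b) ab' (H2_cpoly p^`()^`() ab')).
  by congr H2_with_derivatives; apply/funext => x;
    rewrite /B2 /B3 /A ?p4 ?r4 !cpoly0 ?mulr0 ?addr0.
have [B4L B3E B2E] := HB.
have := green_formula ab' if2 (L2_cintable B4L) f1E fE B3E B2E.
rewrite fa fb f1a f1b !mul0r !subrr.
rewrite (@eq_cintegral _ _ (fun x => f x * _) (cst 0)); last first.
  by move=> x _; rewrite rmorph0 mulr0.
rewrite cintegral0 subr0 => e2.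
have B2L : L2_on `[a, b] B2 by apply: L2_on_primitive (L2_cintable _) B2E => //;
  exact: L2_on_primitive (L2_cintable B4L) B3E.
have M g : L2_on `[a, b] g -> cintable `[a, b] (fun x => f2 x * (g x)^*).
  by move=> g2; apply: L2_mul_cintable => //; exact: L2_onJ.
(* f2 = (u - k) + B2. Testing and Green's formula against k give the same integral, so f2 is
   orthogonal to u - k; it is also orthogonal to B2, hence to itself. *)
have f20 : ae_on `[a, b] (fun x => f2 x = 0).
  apply: L2_dot_eq0 => //; rewrite /L2_dot.
  rewrite (@eq_cintegral _ _ _ (fun x => (f2 x * (u x)^* - f2 x * (k x)^*) +
    f2 x * (B2 x)^*)); last first.
    by move=> x _; rewrite {2}/f2 mul1r rmorphD rmorphB !mulrDr mulrN.
  rewrite cintegralD//; [|exact: cintableB (M _ u2) (M _ k2)|exact: M].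
  by rewrite cintegralB//; [|exact: M..]; rewrite e1 subrr add0r; exact: e2.
exists (fun x => -1 * B2 x + k x), (fun x => -1 * B3 x + k1 x).
have iB3 := cintable_primitive ab' (L2_cintable B4L) B3E.
split.
- have := is_primitiveD (cintableZ (-1) mE (L2_cintable B4L)) iq
    (is_primitiveZ (-1) (L2_cintable B4L) B3E) k1E.
  by congr is_primitive; apply/funext => x; rewrite mulr0 add0r.
- by apply: is_primitiveD (is_primitiveZ (-1) iB3 B2E) kE => //; exact: cintableZ.
- apply: ae_onS f20 => x _; rewrite /f2 /d mul1r -/(B2 x) => /eqP.
  by rewrite -addrA addr_eq0 opprD opprK mulN1r addrC => /eqP.
Qed.

End DuBoisReymond.

(** * Representatives of elements of the L^2 space *)

Section L2Representatives.
Context {R : realType} (G : metric_graph R).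
Local Notation mu := (@lebesgue_measure R).
Local Notation edge := 'I_(nedges G).
Local Notation Re := (@complex.Re R).
Local Notation Im := (@complex.Im R).
Implicit Types (f g h : graph_fun G) (u v w : L2_space G) (n : edge).

Definition is_L2 f : Prop := forall n, L2_on (edge_set n) (f n).

(** Statements about classes are transferred to explicit families through this relation, which asks
    for no proof that f is square-integrable. *)
Definition repr_by u f : Prop :=
  forall n, ae_on (edge_set n) (fun x => L2_repr u n x = f n x).

(** A family that is not square-integrable is sent to the class of 0, so that classes can be formed
    before integrability is proved. *)
Definition L2_of f : L2_space G := L2_class (insubd (0 : sqint_fun G) f).

Lemma L2_ofE f : is_L2 f -> repr_by (L2_of f) f.
Proof.
move=> f2 n; have fP : f \in @square_integrable R G by rewrite unfold_in; apply/asboolP.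
have /= := L2_repr_class (insubd (0 : sqint_fun G) f) n.
by apply: ae_onS => x _ ->; rewrite [sqint_val _](insubdK _ fP).
Qed.

Lemma repr_by_repr u : repr_by u (L2_repr u).
Proof. by move=> n; exact: ae_on_all. Qed.

Lemma repr_by_inj u v f : repr_by u f -> repr_by v f -> u = v.
Proof.
move=> uf vf; rewrite -(L2_classK u) -(L2_classK v); apply/eq_L2_class => n.
by apply: ae_onS2 (uf n) (vf n) => x _ ux vx; rewrite [LHS]ux [RHS]vx.
Qed.

Lemma eq_repr_by u f g : (forall n, ae_on (edge_set n) (fun x => f n x = g n x)) ->
  repr_by u f -> repr_by u g.
Proof. by move=> fg uf n; apply: ae_onS2 (fg n) (uf n) => x _ <-. Qed.

Lemma repr_by_lin c u v f g : repr_by u f -> repr_by v g ->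
  repr_by (c *: u + v) (fun n x => c * f n x + g n x).
Proof.
move=> uf vg n; apply: ae_onS2 (L2_repr_lin c u v n)
  (ae_onS2 (fun x _ a b => conj a b) (uf n) (vg n)) => x _ -> [-> ->] //.
Qed.

Lemma repr_by0 : repr_by 0 (fun _ _ => 0).
Proof.
have := repr_by_lin (- 1) (repr_by_repr 0) (repr_by_repr 0).
rewrite scaler0 addr0; apply: eq_repr_by => n; apply: ae_on_all => x _.
by rewrite mulN1r addNr.
Qed.

Lemma L2_ipE u v f g : is_L2 f -> is_L2 g -> repr_by u f -> repr_by v g ->
  L2_ip u v = \sum_n cintegral (edge_set n) (fun x => f n x * (g n x)^*).
Proof.
move=> f2 g2 uf vg; apply: eq_bigr => n _.
have mE := measurable_edge_set n.
rewrite (L2_dot_ae mE (L2_reprP u n) (f2 n) (L2_reprP v n) (uf n)).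
rewrite (L2_dot_conj mE (f2 n) (L2_reprP v n)).
rewrite (L2_dot_ae mE (L2_reprP v n) (g2 n) (f2 n) (vg n)).
by rewrite -(L2_dot_conj mE (f2 n) (g2 n)).
Qed.

(** The squared modulus as an element of R, so that norms and energies are real integrals and can be
    compared. *)
Definition msq (z : R[i]) : R := Re z ^+ 2 + Im z ^+ 2.

Lemma msqE z : z * z^* = (msq z)%:C.
Proof.
by apply: complex_ext; rewrite ReIm /= /msq; case: z => a b /=; ring.
Qed.

Lemma conj_realC (r : R) : conjC (r%:C : R[i]) = r%:C.
Proof. by apply: complex_ext; rewrite ReIm //= oppr0. Qed.

Lemma msq_ge0 z : 0 <= msq z.
Proof. by rewrite addr_ge0 ?sqr_ge0. Qed.

Lemma msqM (z w : R[i]) : msq (z * w) = msq z * msq w.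
Proof. by rewrite /msq; case: z w => a b [c d] /=; ring. Qed.

Lemma msq_real (r : R) : msq r%:C = r ^+ 2.
Proof. by rewrite /msq /= expr0n addr0. Qed.

Lemma intable_msq (E : set R) (f : R -> R[i]) : measurable E -> L2_on E f ->
  intable E (fun x => msq (f x)).
Proof.
move=> mE [/(Lp2P _ mE)[_ f1] /(Lp2P _ mE)[_ f2]].
by apply: intableD f1 f2.
Qed.

Lemma L2_dot_msq (E : set R) (f : R -> R[i]) :
  L2_dot E f f = (\int[mu]_(x in E) msq (f x))%:C.
Proof.
rewrite /L2_dot /cintegral; apply: complex_ext => /=.
  by apply: eq_Rintegral => x _; rewrite msqE.
transitivity (\int[mu]_(x in E) (0 : R)); last by rewrite /Rintegral integral0.
by apply: eq_Rintegral => x _; rewrite msqE.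
Qed.

Definition sqnorm f : R := \sum_n \int[mu]_(x in edge_set n) msq (f n x).

Lemma L2_ip_msq u f : is_L2 f -> repr_by u f -> L2_ip u u = (sqnorm f)%:C.
Proof.
move=> f2 uf; rewrite (L2_ipE f2 f2 uf uf) /sqnorm raddf_sum.
by apply: eq_bigr => n _; exact: L2_dot_msq.
Qed.

Lemma L2_norm_sq u : `|u| ^+ 2 = L2_ip u u.
Proof. by rewrite L2_normE sqrtCK. Qed.

End L2Representatives.

(** * Products with a square-integrable real weight *)

Section BoundedMultiplication.
Context {R : realType}.
Implicit Types (E : set R) (a b x : R).

Lemma Lp2_mul_bdd E (u v : R -> R) M : measurable E -> Lp_on E 2%:E u ->
  measurable_fun E v -> (forall x, E x -> `|v x| <= M) ->
  Lp_on E 2%:E (fun x => u x * v x).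
Proof.
move=> mE /(Lp2P _ mE)[mu_ iu] mv vM; apply/(Lp2P _ mE); split.
  exact: measurable_funM.
apply: eq_intable (intable_mul_bdd (M := M ^+ 2) mE iu (measurable_funX 2 mv) _) => //.
  by move=> x _; rewrite exprMn.
move=> x Ex; rewrite normrX lerXn2r ?nnegrE ?vM//.
by rewrite (le_trans _ (vM x Ex)).
Qed.

Lemma L2_on_mul_primitive a b (w : R -> R) (F f : R -> R[i]) : a <= b ->
  Lp_on `[a, b] 2%:E w -> cintable `[a, b] f -> is_primitive a b F f ->
  L2_on `[a, b] (fun x => (w x)%:C * F x).
Proof.
move=> ab w2 [f1 f2] /is_primitiveP[F1 F2].
have mE : measurable (`[a, b]%classic : set R) by exact: measurable_itv.
split.
  have := Lp2_mul_bdd mE w2 (primitive_measurable ab f1 F1) (primitive_bdd ab f1 F1).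
  by congr Lp_on; apply/funext => x; rewrite /= ReIm /= mul0r subr0.
have := Lp2_mul_bdd mE w2 (primitive_measurable ab f2 F2) (primitive_bdd ab f2 F2).
by congr Lp_on; apply/funext => x; rewrite /= ReIm /= mul0r addr0.
Qed.

Lemma L2_mulJ_cintable E (f g : R -> R[i]) : measurable E ->
  L2_on E f -> L2_on E g -> cintable E (fun x => f x * (g x)^*).
Proof. by move=> mE f2 g2; apply: L2_mul_cintable => //; exact: L2_onJ. Qed.

Lemma cintable_real_mul E (w : R -> R) (f : R -> R[i]) : measurable E ->
  Lp_on E 2%:E w -> L2_on E f -> cintable E (fun x => (w x)%:C * f x).
Proof.
move=> mE w2 f2; apply: L2_mul_cintable f2 => //; split => //.
exact: Lp2_on0.
Qed.

End BoundedMultiplication.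

(** * Schroedinger operators with square-integrable potential *)

Section Schrodinger.
Context {R : realType} (G : metric_graph R).
Local Notation edge := 'I_(nedges G).
Local Notation endpoint := (edge * bool)%type.
Implicit Types (f g h : graph_fun G) (u v w : L2_space G) (n : edge).

Definition regular g g1 g2 : Prop :=
  forall n, H2_with_derivatives (left_end n) (right_end n) (g n) (g1 n) (g2 n).

Let lr n : left_end n <= right_end n := ltW (left_lt_right n).

Lemma regular2 g g1 g2 : regular g g1 g2 -> is_L2 g2.
Proof. by move=> H n; have [] := H n. Qed.

Lemma regular1 g g1 g2 : regular g g1 g2 -> is_L2 g1.
Proof.
move=> H n; have [g2L g1E gE] := H n.
exact: L2_on_primitive (lr n) (L2_cintable g2L) g1E.
Qed.

Lemma regular0 g g1 g2 : regular g g1 g2 -> is_L2 g.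
Proof.
move=> H n; have [g2L g1E gE] := H n.
exact: L2_on_primitive (lr n) (L2_cintable (regular1 H n)) gE.
Qed.

Lemma regular_lin c g g1 g2 h h1 h2 : regular g g1 g2 -> regular h h1 h2 ->
  regular (fun n x => c * g n x + h n x) (fun n x => c * g1 n x + h1 n x)
    (fun n x => c * g2 n x + h2 n x).
Proof. by move=> H K n; exact: (H2_lin _ (lr n) (H n) (K n)). Qed.

Lemma kirchhoff_lin c g g1 h h1 : kirchhoff_conditions g g1 ->
  kirchhoff_conditions h h1 ->
  kirchhoff_conditions (fun n x => c * g n x + h n x : R[i])
    (fun n x => c * g1 n x + h1 n x).
Proof.
move=> H K v vG; have [H1 H2] := H v vG; have [K1 K2] := K v vG; split.
  move=> i j iv jv; rewrite /value_at.
  by rewrite -!/(value_at _ _) (H1 _ _ iv jv) (K1 _ _ iv jv).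
rewrite (eq_bigr (fun j => c * inward_derivative g1 j + inward_derivative h1 j)); last first.
  by move=> j _; rewrite /inward_derivative; case: ifP; rewrite // opprD mulrN.
by rewrite big_split /= -mulr_sumr H2 K2 mulr0 addr0.
Qed.

Lemma sum_endpoints (F : endpoint -> R[i]) :
  \sum_j F j = \sum_(v in vertices G) \sum_(j in v) F j.
Proof.
rewrite -(set_partition_big _ (vertices_partition G)).
by apply: eq_bigl => j; rewrite inE.
Qed.

(** The inward orientation gives both ends of an edge the same sign, so the boundary terms of all
    edges form one sum over endpoints, ready to be regrouped by vertices. *)
Lemma boundary_sum (F1 K : graph_fun G) :
  \sum_n (F1 n (right_end n) * K n (right_end n) - F1 n (left_end n) * K n (left_end n)) =
  - \sum_(j : endpoint) inward_derivative F1 j * value_at K j.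
Proof.
rewrite [in RHS](eq_bigr (fun p : endpoint =>
  (fun n b => inward_derivative F1 (n, b) * value_at K (n, b)) p.1 p.2)); last by case.
rewrite -(pair_bigA _ (fun n b => inward_derivative F1 (n, b) * value_at K (n, b))) /=.
rewrite -sumrN; apply: eq_bigr => n _; rewrite big_bool /inward_derivative /value_at.
by rewrite /position /= mulNr opprD opprK.
Qed.

(** At each vertex the common value of K factors out of the sum of the inward derivatives of F,
    which is zero. *)
Lemma kirchhoff_pairing (F F1 K K1 : graph_fun G) : kirchhoff_conditions F F1 ->
  kirchhoff_conditions K K1 ->
  \sum_n (F1 n (right_end n) * (K n (right_end n))^* -
           F1 n (left_end n) * (K n (left_end n))^*) = 0.
Proof.
move=> HF HK; rewrite (boundary_sum F1 (fun n x => (K n x)^*)).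
rewrite sum_endpoints big1 ?oppr0// => v vG.
have [->|[j0 j0v]] := set_0Vmem v; first by rewrite big_set0.
rewrite (eq_bigr (fun j => inward_derivative F1 j * (value_at K j0)^*)); last first.
  by move=> j jv; rewrite -((HK v vG).1 j j0 jv j0v).
by rewrite -mulr_suml (HF v vG).2 mul0r.
Qed.

Definition potential (W : edge -> R -> R) : Prop :=
  forall n, Lp_on (edge_set n) 2%:E (W n).

(** The potential acts on the continuous representative g rather than on the class. The graph is a
    relation here; that it is single-valued is proved in [schrodinger_fun]. *)
Definition schrodinger (W : edge -> R -> R) : set (L2_space G * L2_space G) :=
  [set x | exists g g1 g2, [/\ regular g g1 g2, kirchhoff_conditions g g1,
    repr_by x.1 g
    & repr_by x.2 (fun n t => - g2 n t + (W n t)%:C * g n t)]].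

(** As a primitive, g is bounded and measurable on each edge, so multiplying W by it stays in
    L^2. *)
Lemma potential_mul W g g1 g2 : potential W -> regular g g1 g2 ->
  is_L2 (fun n t => (W n t)%:C * g n t).
Proof.
move=> W2 H n; have [_ _ gE] := H n.
exact: L2_on_mul_primitive (lr n) (W2 n) (L2_cintable (regular1 H n)) gE.
Qed.

Lemma schrodinger_L2 W g g1 g2 : potential W -> regular g g1 g2 ->
  is_L2 (fun n t => - g2 n t + (W n t)%:C * g n t).
Proof.
by move=> W2 H n; apply: L2_onD (L2_onN (regular2 H n)) (potential_mul W2 H n).
Qed.

(** One integration by parts on each edge; the boundary terms add up to a vanishing Kirchhoff
    pairing. The form obtained is Hermitian in F and K, which gives symmetry, and for K = F it is
    the energy. *)
Lemma form_identity W (h k : L2_space G) (F F1 F2 K K1 K2 : graph_fun G) : potential W ->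
  regular F F1 F2 -> kirchhoff_conditions F F1 ->
  repr_by h (fun n t => - F2 n t + (W n t)%:C * F n t) ->
  regular K K1 K2 -> kirchhoff_conditions K K1 -> repr_by k K ->
  L2_ip h k = \sum_n (cintegral (edge_set n) (fun x => F1 n x * (K1 n x)^*) +
    cintegral (edge_set n) (fun x => (W n x)%:C * F n x * (K n x)^*)).
Proof.
move=> W2 HF kF hE HK kK kE.
rewrite (L2_ipE (schrodinger_L2 W2 HF) (regular0 HK) hE kE).
transitivity (\sum_n (cintegral (edge_set n) (fun x => F1 n x * (K1 n x)^*) +
    cintegral (edge_set n) (fun x => (W n x)%:C * F n x * (K n x)^*) -
    (F1 n (right_end n) * (K n (right_end n))^* -
           F1 n (left_end n) * (K n (left_end n))^*))); last first.
  by rewrite sumrB (kirchhoff_pairing kF kK) subr0.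
apply: eq_bigr => n _; have mE := measurable_edge_set n.
have [F2L F1E FE] := HF n; have [K2L K1E KE] := HK n.
rewrite -(cintegration_by_parts (lr n) (L2_cintable F2L)
  (L2_cintable (regular1 HK n)) F1E KE).
rewrite (@eq_cintegral _ _ _ (fun x => - (F2 n x * (K n x)^*) +
  (W n x)%:C * F n x * (K n x)^*)); last first.
  by move=> x _; rewrite mulrDl mulNr.
have mF2 := L2_mulJ_cintable mE F2L (regular0 HK n).
rewrite cintegralD//; [|exact: cintableN|exact: L2_mulJ_cintable (potential_mul W2 HF n) (regular0 HK n)].
rewrite cintegralN//.
set I1 := cintegral _ _; set I2 := cintegral _ _; set I3 := cintegral _ _.
by rewrite [_ + I3]addrC opprD addrA [I3 + I2]addrC addrK addrC.
Qed.

Lemma schrodinger_symmetric W x y : potential W ->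
  schrodinger W x -> schrodinger W y -> L2_ip x.2 y.1 = L2_ip x.1 y.2.
Proof.
move=> W2 [F [F1 [F2 [HF kF x1E x2E]]]] [K [K1 [K2 [HK kK y1E y2E]]]].
rewrite (form_identity W2 HF kF x2E HK kK y1E) L2_ip_herm.
rewrite (form_identity W2 HK kK y2E HF kF x1E) rmorph_sum.
apply: eq_bigr => n _; rewrite rmorphD /=; have mE := measurable_edge_set n.
rewrite -!cintegralJ//; last 2 first.
- exact: L2_mulJ_cintable (potential_mul W2 HK n) (regular0 HF n).
- exact: L2_mulJ_cintable (regular1 HK n) (regular1 HF n).
congr (_ + _); apply: eq_cintegral => z _.
  by rewrite rmorphM /= conjCK mulrC.
by rewrite !rmorphM /= conjCK conj_realC mulrAC.
Qed.

Lemma schrodinger0 W : schrodinger W 0.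
Proof.
exists (fun _ => cst 0), (fun _ => cst 0), (fun _ => cst 0); split.
- move=> n; split; [exact: L2_on0|exact: is_primitive_cst..].
- move=> v _; split; first by [].
  by apply: big1 => j _; rewrite /inward_derivative oppr0; case: ifP.
- exact: repr_by0.
- apply: eq_repr_by (@repr_by0 R G) => n; apply: ae_on_all => t _.
  by rewrite mulr0 oppr0 addr0.
Qed.

Lemma schrodinger_lin W c x y : schrodinger W x -> schrodinger W y ->
  schrodinger W (c *: x + y).
Proof.
move=> [F [F1 [F2 [HF kF x1E x2E]]]] [K [K1 [K2 [HK kK y1E y2E]]]].
exists (fun n t => c * F n t + K n t), (fun n t => c * F1 n t + K1 n t),
  (fun n t => c * F2 n t + K2 n t); split.
- exact: regular_lin.
- exact: kirchhoff_lin.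
- exact: repr_by_lin.
- apply: eq_repr_by (repr_by_lin c x2E y2E) => n; apply: ae_on_all => t _.
  rewrite mulrDr [RHS](_ : _ = c * - F2 n t - K2 n t +
    (c * ((W n t)%:C * F n t) + (W n t)%:C * K n t)).
    by rewrite -!addrA; congr (_ + _); rewrite addrCA.
  by rewrite opprD mulrN mulrDr [_ * (c * _)]mulrCA.
Qed.

End Schrodinger.

(** * The adjoint of a Schroedinger operator *)

Section Adjoint.
Context {R : realType} (G : metric_graph R).
Local Notation edge := 'I_(nedges G).
Local Notation endpoint := (edge * bool)%type.
Implicit Types (f g h : graph_fun G) (u v w : L2_space G) (n : edge).

Let lr n : left_end n <= right_end n := ltW (left_lt_right n).

Definition on_edge n (f : R -> R[i]) : graph_fun G :=
  fun m => if m == n then f else cst 0.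

Lemma on_edge_eq n (f : R -> R[i]) : on_edge n f n = f. Proof. by rewrite /on_edge eqxx. Qed.

Lemma on_edge_neq n m (f : R -> R[i]) : m != n -> on_edge n f m = cst 0.
Proof. by rewrite /on_edge => /negbTE ->. Qed.

Lemma regular_on_edge n (f f1 f2 : R -> R[i]) :
  H2_with_derivatives (left_end n) (right_end n) f f1 f2 ->
  regular (on_edge n f) (on_edge n f1) (on_edge n f2).
Proof.
move=> H m; rewrite /on_edge; case: eqP => [->//|_].
by split; [exact: L2_on0|exact: is_primitive_cst..].
Qed.

Lemma kirchhoff_zero_ends (g g1 : graph_fun G) :
  (forall n, [/\ g n (left_end n) = 0, g n (right_end n) = 0,
    g1 n (left_end n) = 0 & g1 n (right_end n) = 0]) ->
  kirchhoff_conditions g g1.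
Proof.
move=> H; have V j : value_at g j = 0.
  by case: j => n [] ; rewrite /value_at /position /=; have [] := H n.
have I j : inward_derivative g1 j = 0.
  case: j => n []; rewrite /inward_derivative /position /=;
    have [_ _ g1l g1r] := H n; rewrite ?g1l ?g1r ?oppr0//.
by move=> v _; split=> [i j _ _|]; [rewrite !V|apply: big1 => j _].
Qed.

Context (W : edge -> R -> R) (W2 : potential W).

Definition schrodinger_pair (g g2 : graph_fun G) : L2_space G * L2_space G :=
  (L2_of g, L2_of (fun n t => - g2 n t + (W n t)%:C * g n t)).

Lemma schrodinger_pairP g g1 g2 : regular g g1 g2 -> kirchhoff_conditions g g1 ->
  schrodinger W (schrodinger_pair g g2).
Proof.
move=> H k; exists g, g1, g2; split => //.
- exact/L2_ofE/(regular0 H).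
- exact/L2_ofE/(schrodinger_L2 W2 H).
Qed.

Context (y : L2_space G * L2_space G).
Context (yP : op_adjoint (@L2_ip R G) (schrodinger W) y).

(** The definition of the adjoint with the potential moved to the right-hand side: y.1 solves u'' =
    W u - w weakly, where w represents y.2. *)
Lemma adjoint_test (u w g g1 g2 : graph_fun G) : is_L2 u -> is_L2 w ->
  repr_by y.1 u -> repr_by y.2 w -> regular g g1 g2 -> kirchhoff_conditions g g1 ->
  \sum_n cintegral (edge_set n) (fun x => g2 n x * (u n x)^*) =
  \sum_n cintegral (edge_set n) (fun x => g n x * ((W n x)%:C * u n x - w n x)^*).
Proof.
move=> u2 w2 yu yw H k; have := yP (schrodinger_pairP H k).
rewrite /schrodinger_pair [in X in X -> _]/=.
rewrite (L2_ipE (schrodinger_L2 W2 H) u2 (L2_ofE (schrodinger_L2 W2 H)) yu).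
rewrite (L2_ipE (regular0 H) w2 (L2_ofE (regular0 H)) yw).
move=> /eqP; rewrite -subr_eq0 -sumrB => /eqP e.
apply/eqP; rewrite -subr_eq0 -sumrB -oppr_eq0 -sumrN; apply/eqP; rewrite -[RHS]e.
apply: eq_bigr => n _; have mE := measurable_edge_set n.
have uL := u2 n; have wL := w2 n.
have mg2u := L2_mulJ_cintable mE (regular2 H n) uL.
have mgw := L2_mulJ_cintable mE (regular0 H n) wL.
have mWu := L2_mulJ_cintable mE (schrodinger_L2 W2 H n) uL.
have iq : cintable (edge_set n) (fun x => ((W n x)%:C * u n x - w n x)^*).
  apply: cintableJ => //; apply: cintableB => //; last exact: L2_cintable.
  exact: cintable_real_mul.
have mgq : cintable (edge_set n) (fun x => g n x * ((W n x)%:C * u n x - w n x)^*).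
  have [g2L g1E gE] := H n.
  apply: eq_cintable (cintable_primitive_mul (lr n) (L2_cintable (regular1 H n)) iq gE) => //.
  by move=> x _; rewrite mulrC.
rewrite -!cintegralB// -cintegralN//; last exact: cintableB.
apply: eq_cintegral => x _.
rewrite rmorphB rmorphM /= conj_realC mulrBr mulrDl mulNr !opprB.
by rewrite mulrCA mulrA [- (g2 n x * _) + _]addrC addrAC.
Qed.

Let u := L2_repr y.1.
Let w := L2_repr y.2.

Let q n x := (W n x)%:C * u n x - w n x.

Let iq n : cintable (edge_set n) (q n).
Proof.
have mE := measurable_edge_set n.
apply: cintableB => //; last exact: L2_cintable (L2_reprP y.2 n).
exact: cintable_real_mul (L2_reprP y.1 n).
Qed.

(** A function clamped at both ends of one edge and extended by zero satisfies all Kirchhoff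
    conditions, so the weak equation can be tested on each edge separately. *)
Lemma adjoint_edge n : exists gg : (R -> R[i]) * (R -> R[i]),
  [/\ is_primitive (left_end n) (right_end n) gg.2 (q n),
    is_primitive (left_end n) (right_end n) gg.1 gg.2
    & ae_on (edge_set n) (fun x => u n x = gg.1 x)].
Proof.
have [|g [g1 H]] := du_bois_reymond (left_lt_right n) (L2_reprP y.1 n) (iq n);
  last by exists (g, g1).
move=> f f1 f2 Hf fa fb f1a f1b.
have := adjoint_test (@L2_reprP _ _ y.1) (@L2_reprP _ _ y.2) (repr_by_repr y.1)
  (repr_by_repr y.2) (regular_on_edge Hf).
rewrite (bigD1 n) //= big1 ?addr0; last first.
  move=> m mn; rewrite (@eq_cintegral _ _ _ (cst 0)) ?cintegral0// => x _.
  by rewrite on_edge_neq //= mul0r.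
rewrite (bigD1 n) //= big1 ?addr0; last first.
  move=> m mn; rewrite (@eq_cintegral _ _ _ (cst 0)) ?cintegral0// => x _.
  by rewrite on_edge_neq //= mul0r.
rewrite !on_edge_eq; apply; apply: kirchhoff_zero_ends => m.
by rewrite /on_edge; case: eqP => [->|].
Qed.

(** A bootstrap: W u is at first only integrable, as a product of two L^2 functions. Once u has an
    absolutely continuous representative g, the product W g is square-integrable, and so is the
    second derivative W g - w. *)
Lemma adjoint_regular : exists g g1 g2 : graph_fun G,
  [/\ regular g g1 g2, repr_by y.1 g &
    repr_by y.2 (fun n t => - g2 n t + (W n t)%:C * g n t)].
Proof.
have [gg ggP] := choice adjoint_edge.
pose g n := (gg n).1; pose g1 n := (gg n).2.
pose g2 n x : R[i] := (W n x)%:C * g n x - w n x.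
have ug : repr_by y.1 g by move=> n; have [] := ggP n.
have g2L : is_L2 g2.
  move=> n; apply: L2_onB; last exact: L2_reprP y.2 n.
  have [g1E gE _] := ggP n.
  have ig1 := cintable_primitive (lr n) (iq n) g1E.
  exact: L2_on_mul_primitive (lr n) (W2 n) ig1 gE.
exists g, g1, g2; split => //.
- move=> n; have [g1E gE uE] := ggP n; split => //; first exact: g2L.
  apply: is_primitive_ae (iq n) (L2_cintable (g2L n)) _ g1E.
  by apply: ae_onS uE => x _; rewrite /q /g2 => ->.
- move=> n; apply: ae_on_all => t _.
  by rewrite /g2 opprB subrK.
Qed.

(** Hermite cubics realise any real endpoint data v (values) and d (inward derivatives) that obey
    the vertex conditions. With them as test functions, Green's formula cancels the integrals and
    leaves an identity between boundary values. *)
Lemma adjoint_boundary (g g1 g2 : graph_fun G) (v d : endpoint -> R) :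
  regular g g1 g2 -> repr_by y.1 g ->
  repr_by y.2 (fun n t => - g2 n t + (W n t)%:C * g n t) ->
  (forall S, S \in vertices G ->
    (forall i j, i \in S -> j \in S -> v i = v j) /\ \sum_(j in S) d j = 0) ->
  \sum_j (d j)%:C * (value_at g j)^* =
  \sum_j (v j)%:C * (inward_derivative g1 j)^*.
Proof.
move=> H y1E y2E Hvd.
(* d prescribes inward derivatives, hence the sign at the right end. *)
have /choice[p pP] n : exists p : {poly R}, [/\ p.[left_end n] = v (n, false),
    p.[right_end n] = v (n, true), p^`().[left_end n] = d (n, false)
    & p^`().[right_end n] = - d (n, true)].
  have [p []] := hermite_interpolation (v (n, false)) (v (n, true)) (d (n, false))
    (- d (n, true)) (left_lt_right n).
  by exists p.
pose F n := cpoly (p n); pose F1 n := cpoly (p n)^`(); pose F2 n := cpoly (p n)^`()^`().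
have HF : regular F F1 F2 by move=> n; exact: H2_cpoly.
have FE j : value_at F j = (v j)%:C.
  by case: j => n []; rewrite /value_at /position /F /cpoly /=; have [pa pb _ _] := pP n;
    rewrite ?pa ?pb.
have F1E j : inward_derivative F1 j = (d j)%:C.
  case: j => n []; rewrite /inward_derivative /position /F1 /cpoly /=;
    have [_ _ pa pb] := pP n; rewrite ?pa ?pb //.
  by rewrite rmorphN opprK.
have kF : kirchhoff_conditions F F1.
  move=> S SG; have [vS dS] := Hvd S SG; split=> [i j iS jS|].
    by rewrite !FE (vS i j).
  by under eq_bigr do rewrite F1E; rewrite -rmorph_sum dS.
have := adjoint_test (regular0 H) (schrodinger_L2 W2 H) y1E y2E HF kF.
rewrite [in X in _ = X -> _](eq_bigr (fun n => cintegral (edge_set n)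
  (fun x => F n x * (g2 n x)^*))); last first.
  move=> n _; apply: eq_cintegral => x _; congr (_ * _^*).
  by rewrite opprD opprK addrCA subrr addr0.
move/eqP; rewrite -subr_eq0 -sumrB.
rewrite (eq_bigr (fun n =>
  (F1 n (right_end n) * (g n (right_end n))^* - F1 n (left_end n) * (g n (left_end n))^*)
  - ((g1 n (right_end n))^* * F n (right_end n) -
     (g1 n (left_end n))^* * F n (left_end n)))); last first.
  move=> n _; have [F2L F1p Fp] := HF n; have [g2L g1p gp] := H n.
  rewrite (green_formula (lr n) (L2_cintable F2L) (L2_cintable g2L) F1p Fp g1p gp).
  by rewrite !opprD !opprK addrACA; congr (_ + (- _ + _)); rewrite mulrC.
rewrite sumrB (boundary_sum F1 (fun n x => (g n x)^*)).
rewrite (boundary_sum (fun n x => (g1 n x)^*) F) opprK addrC subr_eq0 => /eqP e.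
transitivity (\sum_j inward_derivative F1 j * value_at (fun n x => (g n x)^*) j).
  by apply: eq_bigr => j _; rewrite F1E.
rewrite -e; apply: eq_bigr => j _; rewrite FE mulrC /inward_derivative.
by case: ifP => // _; rewrite rmorphN.
Qed.

(** Two choices of boundary data: v = 0 with d equal to 1 at i and -1 at j, for i and j in one
    vertex, forces equal values of g at i and j; d = 0 with v the indicator of a vertex S forces the
    inward derivatives over S to sum to zero. *)
Lemma schrodinger_adjoint : schrodinger W y.
Proof.
have [g [g1 [g2 [H y1E y2E]]]] := adjoint_regular.
have bdry := adjoint_boundary H y1E y2E.
have vtx S T j : S \in vertices G -> T \in vertices G -> j \in S -> j \in T -> S = T.
  have /and3P[_ tI _] := vertices_partition G.
  by move=> SG TG jS jT; rewrite -(def_pblock tI SG jS) -(def_pblock tI TG jT).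
exists g, g1, g2; split=> // S SG; split.
  move=> i j iS jS; have [->//|ij] := eqVneq i j.
  have K T : T \in vertices G -> (forall k l : endpoint, k \in T -> l \in T -> (0 : R) = 0) /\
      \sum_(k in T) ((k == i)%:R - (k == j)%:R) = 0 :> R.
    move=> TG; split=> //; rewrite sumrB.
    have cnt l : \sum_(k in T) (k == l)%:R = (l \in T)%:R :> R.
      have [lT|lT] := boolP (l \in T).
        by rewrite (bigD1 l)//= eqxx big1 ?addr0// => k /andP[_ /negbTE ->].
      by rewrite big1// => k kT; case: eqP => // kl; rewrite -kl kT in lT.
    rewrite !cnt (_ : (i \in T) = (j \in T)) ?subrr//.
    by apply/idP/idP => H'; [rewrite (vtx T S i)|rewrite (vtx T S j)].
  have := bdry (fun _ => 0) (fun k => (k == i)%:R - (k == j)%:R) K.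
  rewrite [X in _ = X -> _]big1; last by move=> k _; rewrite mul0r.
  rewrite (bigD1 i)//= (bigD1 j) 1?eq_sym//= big1 ?addr0; last first.
    by move=> k /andP[/negbTE -> /negbTE ->]; rewrite subrr mul0r.
  rewrite !eqxx [j == i]eq_sym (negbTE ij) subr0 sub0r rmorphN !mul1r mulN1r.
  move=> /eqP; rewrite subr_eq0 => /eqP; exact: (can_inj conjCK).
have K T : T \in vertices G -> (forall k l : endpoint, k \in T -> l \in T ->
    (k \in S)%:R = (l \in S)%:R :> R) /\ \sum_(k in T) (0 : R) = 0.
  move=> TG; split=> [k l kT lT|]; last by rewrite big1.
  rewrite (_ : (k \in S) = (l \in S))//.
  by apply/idP/idP => H'; [rewrite -(vtx T S k)|rewrite -(vtx T S l)].
have := bdry (fun k => (k \in S)%:R) (fun _ => 0) K.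
rewrite [X in X = _ -> _]big1; last by move=> k _; rewrite mul0r.
move=> /esym e.
apply: (can_inj conjCK); rewrite rmorph0 rmorph_sum -[RHS]e big_mkcond /=.
apply: eq_bigr => j _; case: ifP => _; first by rewrite mul1r.
by rewrite mul0r.
Qed.

End Adjoint.

(** * The norm as a real number *)

Section RealNorm.
Context {R : realType}.

Lemma ler_realC (x y : R) : ((x%:C : R[i]) <= y%:C) = (x <= y).
Proof. by rewrite lecE /= eqxx. Qed.

Lemma ltr_realC (x y : R) : ((x%:C : R[i]) < y%:C) = (x < y).
Proof. by rewrite ltcE /= eqxx. Qed.

Lemma ge0_realC (z : R[i]) : 0 <= z -> z = (complex.Re z)%:C.
Proof. by case: z => a b; rewrite lecE /= => /andP[/eqP -> _]. Qed.

(** Over R[i] the norm is itself a complex number; its real part is all of it, and makes real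
    arithmetic and infima available. *)
Definition rnorm {V : normedModType R[i]} (v : V) : R := complex.Re `|v|.

Lemma rnormE {V : normedModType R[i]} (v : V) : `|v| = (rnorm v)%:C.
Proof. by apply: ge0_realC. Qed.

Lemma rnorm_ge0 {V : normedModType R[i]} (v : V) : 0 <= rnorm v.
Proof. by rewrite -ler_realC -rnormE; exact: normr_ge0. Qed.

Lemma rnormD {V : normedModType R[i]} (u v : V) : rnorm (u + v) <= rnorm u + rnorm v.
Proof. by rewrite -ler_realC rmorphD /= -!rnormE ler_normD. Qed.

Lemma rnormZ {V : normedModType R[i]} (c : R[i]) (u : V) :
  rnorm (c *: u) = complex.Re `|c| * rnorm u.
Proof.
have := normrZ c u; rewrite (ge0_realC (normr_ge0 c)) !rnormE -rmorphM /= => -[] //.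
Qed.

Lemma rnorm_eq0 {V : normedModType R[i]} (u : V) : rnorm u = 0 -> u = 0.
Proof. by move=> u0; apply/eqP; rewrite -normr_eq0 rnormE u0. Qed.

End RealNorm.

(** * Density of the domain *)

Section Bump.
Context {R : realType}.
Implicit Types (q y : R).

(* The Stone-Weierstrass polynomials (1 - q^k)^(2^k) converge to the step
   function that jumps at q = 1/2. *)
Lemma bernoulli_sub y N : 0 <= y -> y <= 1 -> 1 - N%:R * y <= (1 - y) ^+ N.
Proof.
move=> y0 y1; have y1' : 0 <= 1 - y by rewrite subr_ge0.
elim: N => [|N IH]; first by rewrite mul0r subr0 expr0.
rewrite exprS (le_trans _ (ler_wpM2l y1' IH))// -subr_ge0 -natr1.
rewrite (_ : _ - _ = N%:R * y ^+ 2); last by ring.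
by rewrite mulr_ge0// sqr_ge0.
Qed.

Lemma bernoulli_add y N : 0 <= y -> N%:R * y <= (1 + y) ^+ N.
Proof.
move=> y0; have y1' : 0 <= 1 + y by rewrite addr_ge0.
suff : 1 + N%:R * y <= (1 + y) ^+ N by apply: le_trans; rewrite lerDr.
elim: N => [|N IH]; first by rewrite mul0r addr0 expr0.
rewrite exprS (le_trans _ (ler_wpM2l y1' IH))// -subr_ge0 -natr1.
rewrite (_ : _ - _ = N%:R * y ^+ 2); last by ring.
by rewrite mulr_ge0// sqr_ge0.
Qed.

(** Bernoulli's inequality with exponent 2^k squeezes the sequence between 1 - (2 q)^k and 1. *)
Lemma cvg_bump1 q : 0 <= q -> 2 * q < 1 ->
  (fun k => (1 - q ^+ k) ^+ (2 ^ k)%N) @ \oo --> (1 : R).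
Proof.
move=> q0 q1.
have q1' : q <= 1 by lra.
apply: (@squeeze_cvgr _ _ _ _ (fun k => 1 - (2 * q) ^+ k) (cst 1)).
- apply: nearW => k; rewrite exprn_ile1 ?subr_ge0 ?exprn_ile1// ?gerBl ?exprn_ge0//.
  rewrite andbT (le_trans _ (bernoulli_sub _ _ _))//; last 2 first.
  + exact: exprn_ge0.
  + exact: exprn_ile1.
  + by rewrite natrX exprMn.
- rewrite -[X in _ --> X]subr0; apply: cvgB; first exact: cvg_cst.
  by apply: cvg_expr; rewrite ger0_norm// mulr_ge0.
- exact: cvg_cst.
Qed.

(** With y = q^k and N = 2^k, (1 - y)^N N y <= (1 - y)^N (1 + y)^N = (1 - y^2)^N <= 1, so the
    sequence is at most (2 q)^-k. *)
Lemma cvg_bump0 q : q <= 1 -> 1 < 2 * q ->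
  (fun k => (1 - q ^+ k) ^+ (2 ^ k)%N) @ \oo --> (0 : R).
Proof.
move=> q1 q2; have q0 : 0 < q by lra.
have qk0 k : 0 <= q ^+ k by rewrite exprn_ge0// ltW.
have qk1 k : q ^+ k <= 1 by rewrite exprn_ile1// ltW.
apply: (@squeeze_cvgr _ _ _ _ (cst 0) (fun k => ((2 * q)^-1) ^+ k)).
- apply: nearW => k; rewrite exprn_ge0 ?subr_ge0//=.
  have p0 : 0 < (2 * q) ^+ k by rewrite exprn_gt0// mulr_gt0.
  rewrite exprVn -div1r ler_pdivlMr//.
  rewrite exprMn -natrX.
  apply: (@le_trans _ _ ((1 - q ^+ k) ^+ (2 ^ k) * (1 + q ^+ k) ^+ (2 ^ k))).
    by rewrite ler_wpM2l ?exprn_ge0 ?subr_ge0// bernoulli_add.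
  rewrite -exprMn exprn_ile1//.
    by rewrite mulr_ge0 ?subr_ge0// addr_ge0.
  rewrite (_ : _ * _ = 1 - (q ^+ k) ^+ 2); last by ring.
  by rewrite gerBl sqr_ge0.
- exact: cvg_cst.
- by apply: cvg_expr; rewrite ger0_norm ?invr_ge0 ?invf_lt1//; lra.
Qed.

End Bump.

Section Density.
Context {R : realType} (G : metric_graph R).
Local Notation mu := (@lebesgue_measure R).
Local Notation edge := 'I_(nedges G).
Implicit Types (u v w : L2_space G) (n : edge) (h k : R -> R).

Let lr n : left_end n <= right_end n := ltW (left_lt_right n).

Definition zero_ends (g g1 : graph_fun G) : Prop :=
  forall n, [/\ g n (left_end n) = 0, g n (right_end n) = 0,
    g1 n (left_end n) = 0 & g1 n (right_end n) = 0].

(** Vanishing values and derivatives at all endpoints imply the Kirchhoff conditions, so clamped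
    elements lie in the domain for every potential; density is proved for them. *)
Definition clamped u : Prop := exists g g1 g2,
  [/\ regular g g1 g2, zero_ends g g1 & repr_by u g].

Lemma clamped_lin c u v : clamped u -> clamped v -> clamped (c *: u + v).
Proof.
move=> [g [g1 [g2 [Hg zg ug]]]] [h [h1 [h2 [Hh zh vh]]]].
exists (fun n x => c * g n x + h n x), (fun n x => c * g1 n x + h1 n x),
  (fun n x => c * g2 n x + h2 n x); split.
- exact: regular_lin.
- by move=> n; have [-> -> -> ->] := zg n; have [-> -> -> ->] := zh n;
    rewrite !mulr0 !addr0.
- exact: repr_by_lin.
Qed.

Definition clamped_limit u : Prop :=
  forall e : R, 0 < e -> exists2 v, clamped v & rnorm (u - v) <= e.

Lemma clamped_limit_closed u :
  (forall e : R, 0 < e -> exists2 v, clamped_limit v & rnorm (u - v) <= e) ->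
  clamped_limit u.
Proof.
move=> H e e0; have e20 : 0 < e / 2 by rewrite divr_gt0.
have [v vl uv] := H _ e20; have [w wc vw] := vl _ e20.
exists w => //; rewrite (_ : u - w = (u - v) + (v - w)); last by rewrite addrA subrK.
by rewrite (le_trans (rnormD _ _))// [e]splitr lerD.
Qed.

Lemma clamped_limit_lin c u v : clamped_limit u -> clamped_limit v ->
  clamped_limit (c *: u + v).
Proof.
move=> ul vl e e0; pose r := complex.Re `|c|.
have r0 : 0 <= r by rewrite -ler_realC -ge0_realC//; exact: normr_ge0.
have e1 : 0 < e / 2 / (r + 1) by rewrite !divr_gt0// ltr_wpDl.
have e20 : 0 < e / 2 by rewrite divr_gt0.
have [u' u'c uu'] := ul _ e1; have [v' v'c vv'] := vl _ e20.
exists (c *: u' + v'); first exact: clamped_lin.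
rewrite opprD addrACA -scalerBr (le_trans (rnormD _ _))// [e]splitr lerD//.
rewrite rnormZ -/r (le_trans (ler_wpM2l r0 uu'))// mulrCA ler_piMr ?(ltW e20)//.
by rewrite ler_pdivrMr ?ltr_wpDl// mul1r lerDl.
Qed.

Lemma clamped_limit0 : clamped_limit 0.
Proof.
move=> e e0; exists 0; last by rewrite subr0 /rnorm normr0 ltW.
exists (fun _ => cst 0), (fun _ => cst 0), (fun _ => cst 0); split.
- by move=> n; split; [exact: L2_on0|exact: is_primitive_cst..].
- by [].
- exact: repr_by0.
Qed.

Definition emb n h : L2_space G := L2_of (on_edge n (fun x => (h x)%:C)).

Lemma Lp2_realC (E : set R) h : Lp_on E 2%:E h -> L2_on E (fun x => (h x)%:C).
Proof. by move=> h2; split; [exact: h2|exact: Lp2_on0]. Qed.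

Lemma is_L2_emb n h : Lp_on (edge_set n) 2%:E h ->
  is_L2 (on_edge n (fun x => (h x)%:C)).
Proof.
move=> h2 m; rewrite /on_edge; case: eqP => [->|_]; first exact: Lp2_realC.
exact: L2_on0.
Qed.

Lemma embE n h : Lp_on (edge_set n) 2%:E h ->
  repr_by (emb n h) (on_edge n (fun x => (h x)%:C)).
Proof. by move=> h2; apply/L2_ofE/is_L2_emb. Qed.

Lemma emb_lin n (a : R) h k : Lp_on (edge_set n) 2%:E h ->
  Lp_on (edge_set n) 2%:E k ->
  emb n (fun x => a * h x + k x) = a%:C *: emb n h + emb n k.
Proof.
move=> h2 k2; apply: (repr_by_inj (embE _)).
  exact: Lp2_on_lin.
apply: eq_repr_by (repr_by_lin a%:C (embE h2) (embE k2)) => m; apply: ae_on_all => x _.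
rewrite /on_edge; case: eqP => _ /=; last by rewrite mulr0 addr0.
by rewrite rmorphD rmorphM.
Qed.

Lemma eq_emb n h k : Lp_on (edge_set n) 2%:E h -> Lp_on (edge_set n) 2%:E k ->
  ae_on (edge_set n) (fun x => h x = k x) -> emb n h = emb n k.
Proof.
move=> h2 k2 hk; apply: (repr_by_inj (embE h2)); apply: eq_repr_by (embE k2) => m.
rewrite /on_edge; case: eqP => [->|_]; last exact: ae_on_all.
by apply: ae_onS hk => x _ ->.
Qed.

Lemma rnorm_sqr u (f : graph_fun G) : is_L2 f -> repr_by u f ->
  rnorm u ^+ 2 = sqnorm f.
Proof.
move=> f2 uf; have := L2_norm_sq u.
by rewrite (L2_ip_msq f2 uf) rnormE -rmorphXn /= => -[].
Qed.

Lemma emb_norm n h : Lp_on (edge_set n) 2%:E h ->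
  rnorm (emb n h) ^+ 2 = \int[mu]_(x in edge_set n) (h x ^+ 2).
Proof.
move=> h2; rewrite (rnorm_sqr (is_L2_emb h2) (embE h2)) /sqnorm.
rewrite (bigD1 n)//= big1 ?addr0 => [|m mn].
  by apply: eq_Rintegral => x _; rewrite on_edge_eq msq_real.
rewrite on_edge_neq//; under eq_Rintegral do rewrite msq_real expr0n.
by rewrite /Rintegral integral0.
Qed.

Lemma Lp2_le (E : set R) h k : measurable E -> measurable_fun E h ->
  Lp_on E 2%:E k -> (forall x, E x -> `|h x| <= k x) -> Lp_on E 2%:E h.
Proof.
move=> mE mh /(Lp2P _ mE)[mk ik] hk; apply/(Lp2P _ mE); split=> //.
apply: intable_le ik _ => //; first exact: measurable_funX.
move=> x Ex; rewrite normrX lerXn2r ?nnegrE ?hk//.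
by rewrite (le_trans _ (hk x Ex)).
Qed.

(** Dominated convergence for (h - h_i)^2, with bound (2 M)^2, turns pointwise into L^2 convergence.
    It serves for rays, for increasing unions of sets and for simple approximations. *)
Lemma clamped_limit_dominated n (h_ : nat -> R -> R) h M :
  Lp_on (edge_set n) 2%:E M ->
  (forall i, measurable_fun (edge_set n) (h_ i)) -> measurable_fun (edge_set n) h ->
  (forall i x, edge_set n x -> `|h_ i x| <= M x) ->
  (forall x, edge_set n x -> `|h x| <= M x) ->
  ae_on (edge_set n) (fun x => h_ ^~ x @ \oo --> h x) ->
  (forall i, clamped_limit (emb n (h_ i))) -> clamped_limit (emb n h).
Proof.
move=> M2 mh_ mh h_M hM h_h cl.
have mE := measurable_edge_set n.
have h2 := Lp2_le mE mh M2 hM; have h_2 i := Lp2_le mE (mh_ i) M2 (h_M i).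
have [mM iM] := (Lp2P _ mE).1 M2.
have mB i : measurable_fun (edge_set n) (fun x => (h x - h_ i x) ^+ 2).
  by apply: measurable_funX; exact: measurable_funB.
have [|//||||_ _] := @dominated_convergence _ _ _ mu (edge_set n) mE
  (fun i x => ((h x - h_ i x) ^+ 2)%:E) (cst 0%E) (fun x => (4 * M x ^+ 2)%:E).
- by move=> i; apply/measurable_EFinP; exact: (mB i).
- rewrite /ae_on in h_h; apply: filterS h_h => x h_h Ex.
  apply/fine_cvgP; split; first exact: nearW.
  rewrite [X in _ --> X](_ : _ = (h x - h x) ^+ 2); last by rewrite subrr expr0n.
  have B : (fun i => h x - h_ i x) @ \oo --> h x - h x.
    by apply: cvgB; [exact: cvg_cst|exact: h_h].
  exact: (cvgM B B).
- exact: intableZ.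
- apply: aeW => x i Ex; rewrite lee_fin ger0_norm ?sqr_ge0//.
  rewrite -(ger0_norm (sqr_ge0 _)) normrX.
  have hh : `|h x - h_ i x| <= 2 * M x.
    rewrite (le_trans (ler_normB _ _))// mulr_natl mulr2n lerD//; [exact: hM|exact: h_M].
  rewrite (_ : 4 * M x ^+ 2 = (2 * M x) ^+ 2); last by ring.
  by rewrite lerXn2r ?nnegrE// (le_trans _ hh).
rewrite integral0 => lim.
have embB i : emb n h - emb n (h_ i) = emb n (fun x => h x - h_ i x).
  rewrite -scaleN1r addrC -(_ : (-1)%:C = -1 :> R[i]); last by rewrite rmorphN.
  rewrite -emb_lin//; congr emb; apply/funext => x; ring.
have L2B i : Lp_on (edge_set n) 2%:E (fun x => h x - h_ i x).
  have := Lp2_on_lin (-1) (h_2 i) h2; congr Lp_on; apply/funext => x; ring.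
apply: clamped_limit_closed => e e0.
have [N _ /(_ N (leqnn N)) /=] := ((cvgrPdist_lt _ _).1 (fine_cvg lim)) _ (exprn_gt0 2 e0).
rewrite sub0r normrN => HN; exists (emb n (h_ N)); first exact: cl.
rewrite embB -(@ler_sqr R) ?nnegrE ?rnorm_ge0 ?(ltW e0)// emb_norm//.
exact: (le_trans (ler_norm _) (ltW HN)).
Qed.

(** The factor B^2 creates double zeros at both ends. *)
Lemma clamped_horner n (Q B : {poly R}) : B.[left_end n] = 0 ->
  B.[right_end n] = 0 -> clamped (emb n (horner (Q * B ^+ 2))).
Proof.
move=> Ba Bb; set P := Q * B ^+ 2.
have P0 x : B.[x] = 0 -> P.[x] = 0 /\ P^`().[x] = 0.
  move=> Bx; rewrite /P derivM deriv_exp !(hornerD, hornerM, hornerMn, horner_exp) Bx /=.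
  by rewrite expr1 !mulr0 addr0 mulr0 addr0.
exists (on_edge n (cpoly P)), (on_edge n (cpoly P^`())), (on_edge n (cpoly P^`()^`())).
split.
- exact/regular_on_edge/H2_cpoly.
- move=> m; rewrite /on_edge; case: eqP => [->|//]; rewrite /cpoly.
  by have [-> ->] := P0 _ Ba; have [-> ->] := P0 _ Bb.
- apply: embE; have [] // := L2_on_cpoly P (lr n).
Qed.

Lemma clamped_limit_clamped u : clamped u -> clamped_limit u.
Proof. by move=> uc e e0; exists u => //; rewrite subrr /rnorm normr0 ltW. Qed.

Lemma ae_on_neq (E : set R) (c : R) : ae_on E (fun x => x != c).
Proof.
rewrite /ae_on; exists [set c]; split.
- exact: measurable_set1.
- exact: lebesgue_measure_set1.
- by move=> x /= H; apply: contrapT => /eqP xc; apply: H.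
Qed.

(* Q k approximates the step at c, and the factor B k ^+ 2 clamps it at both
   ends of the edge without affecting the pointwise limit inside. *)
Lemma clamped_limit_ray n c : clamped_limit (emb n (\1_(`]-oo, c[%classic))).
Proof.
pose a := left_end n; pose b := right_end n.
have ab : a < b := left_lt_right n.
have L0 : 0 < b - a by rewrite subr_gt0.
pose s (x : R) := (x - a) / (b - a).
pose S : {poly R} := (b - a)^-1 *: ('X - a%:P).
have SE x : S.[x] = s x by rewrite /S hornerZ hornerXsubC mulrC.
(* Clamping s c to [0, 1] admits a c outside the edge and keeps r within [0, 1] on it; 2 r crosses 1
   at s = d, where the bump jumps. *)
pose d := Num.max 0 (Num.min 1 (s c)).
have d0 : 0 <= d by rewrite le_max lexx.
have d1 : d <= 1 by rewrite ge_max ler01 ge_min lexx.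
pose r : {poly R} := 2^-1 *: (1 + (S - d%:P)).
have rE x : r.[x] = (1 + (s x - d)) / 2.
  by rewrite /r hornerZ !(SE, hornerD, hornerN, hornerC) mulrC.
pose B (k : nat) : {poly R} := (1 - (1 - S) ^+ k) * (1 - S ^+ k).
pose Q (k : nat) : {poly R} := (1 - r ^+ k) ^+ (2 ^ k).
have BE (k : nat) x : (B k).[x] = (1 - (1 - s x) ^+ k) * (1 - s x ^+ k).
  by rewrite /B !(SE, hornerM, horner_exp, hornerD, hornerN, hornerC).
have QE (k : nat) x : (Q k).[x] = (1 - ((1 + (s x - d)) / 2) ^+ k) ^+ (2 ^ k).
  by rewrite /Q !(rE, horner_exp, hornerD, hornerN, hornerC).
have PE (k : nat) x : (Q k * B k ^+ 2).[x] =
    (1 - ((1 + (s x - d)) / 2) ^+ k) ^+ (2 ^ k) *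
    ((1 - (1 - s x) ^+ k) * (1 - s x ^+ k)) ^+ 2.
  by rewrite hornerM [(B k ^+ 2).[x]]horner_exp BE QE.
have s01 x : a <= x -> x <= b -> 0 <= s x <= 1.
  move=> ax xb; rewrite divr_ge0 ?subr_ge0 ?(ltW ab)//=.
  by rewrite ler_pdivrMr// mul1r lerD2r.
apply: (@clamped_limit_dominated n (fun k : nat => horner (Q k * B k ^+ 2)) _ (cst 1)).
- have := L2_on_cst (left_end n) (right_end n) 1; by case.
- move=> k; apply: measurable_funTS; exact: measurable_poly.
- exact: measurable_indic.
- move=> k x; rewrite /edge_set /= in_itv /= => /andP[ax xb].
  have /andP[sx0 sx1] := s01 _ ax xb.
  rewrite PE normrM !normrX.
  have in01 (y : R) (N : nat) : 0 <= y <= 1 -> 0 <= 1 - y ^+ N <= 1.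
    by move=> /andP[y0 y1]; rewrite subr_ge0 exprn_ile1//= gerBl exprn_ge0.
  have /andP[p0 p1] := in01 (s x) k (s01 _ ax xb).
  have /andP[q0 q1] : 0 <= 1 - (1 - s x) ^+ k <= 1 by apply: in01; lra.
  have /andP[t0 t1] : 0 <= 1 - ((1 + (s x - d)) / 2) ^+ k <= 1 by apply: in01; lra.
  by rewrite mulr_ile1 ?exprn_ge0 ?exprn_ile1// ?normrM ?mulr_ge0 ?mulr_ile1// ger0_norm.
- by move=> x _; rewrite indicE; case: (_ \in _); rewrite ?normr1 ?normr0//.
- apply: ae_onS2 (ae_on_neq (edge_set n) c)
    (ae_onS2 (fun x _ p q => conj p q) (ae_on_neq _ a) (ae_on_neq _ b)) => x.
  rewrite /edge_set /= in_itv /= => /andP[ax xb] xc [xa xb'].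
  have xa0 : a < x by rewrite lt_neqAle eq_sym xa.
  have xb0 : x < b by rewrite lt_neqAle xb'.
  have sx0 : 0 < s x by rewrite divr_gt0// subr_gt0.
  have sx1 : s x < 1 by rewrite ltr_pdivrMr// mul1r ltrD2r.
  have sxc : (s x < s c) = (x < c) by rewrite ltr_pM2r ?invr_gt0// ltrD2r.
  have scx : (s c < s x) = (c < x) by rewrite ltr_pM2r ?invr_gt0// ltrD2r.
  rewrite (_ : (fun k : nat => (Q k * B k ^+ 2).[x]) =
    (fun k : nat => (1 - ((1 + (s x - d)) / 2) ^+ k) ^+ (2 ^ k) *
      (((1 - (1 - s x) ^+ k) * (1 - s x ^+ k)) *
       ((1 - (1 - s x) ^+ k) * (1 - s x ^+ k))))); last by apply/funext => k; rewrite PE.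
  have cvg1 (y : R) : 0 < y -> y < 1 -> (fun k : nat => 1 - y ^+ k) @ \oo --> (1 : R).
    move=> y0 y1; rewrite -[X in _ --> X]subr0; apply: cvgB; first exact: cvg_cst.
    by apply: cvg_expr; rewrite gtr0_norm.
  have B1 : (fun k : nat => (1 - (1 - s x) ^+ k) * (1 - s x ^+ k)) @ \oo --> (1 : R).
    rewrite -[X in _ --> X]mulr1; apply: cvgM; apply: cvg1 => //; lra.
  have BB1 : (fun k : nat => ((1 - (1 - s x) ^+ k) * (1 - s x ^+ k)) *
       ((1 - (1 - s x) ^+ k) * (1 - s x ^+ k))) @ \oo --> (1 : R).
    by rewrite -[X in _ --> X]mulr1; exact: (cvgM B1 B1).
  rewrite indicE.
  case: (ltgtP x c) xc => // xc _.
    rewrite mem_set//= -[X in _ --> X]mulr1; apply: (fun A => cvgM A BB1).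
    have : s x < d by rewrite lt_max lt_min sx1 sxc xc orbT.
    by move=> sxd; apply: cvg_bump1; lra.
  rewrite memNset/=; last by rewrite in_itv/=; apply/negP; rewrite -leNgt ltW.
  rewrite -[X in _ --> X](mul0r 1); apply: (fun A => cvgM A BB1).
  have : d < s x by rewrite gt_max sx0 gt_min scx xc orbT.
  by move=> dsx; apply: cvg_bump0; lra.
- move=> k; apply: clamped_limit_clamped; apply: clamped_horner; rewrite BE /s.
    by rewrite subrr mul0r subr0 expr1n subrr mul0r.
  by rewrite divff ?gt_eqF// expr1n [X in _ * X]subrr mulr0.
Qed.

Lemma Lp2_indic n (A : set R) : measurable A -> Lp_on (edge_set n) 2%:E (\1_A : R -> R).
Proof.
move=> mA; apply: (@Lp2_le _ _ (cst 1) (measurable_edge_set n)).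
- exact: measurable_indic.
- by have := L2_on_cst (left_end n) (right_end n) 1; case.
- by move=> x _; rewrite indicE; case: (_ \in _); rewrite ?normr1 ?normr0.
Qed.

(** The Borel sets whose indicators can be approximated form a lambda-system containing the open
    left rays, a pi-system that generates the Borel sets. *)
Lemma clamped_limit_indic n (A : set R) : measurable A ->
  clamped_limit (emb n (\1_A : R -> R)).
Proof.
move=> mA.
pose H : set (set R) := [set A | measurable A /\ clamped_limit (emb n (\1_A : R -> R))].
suff : H A by case.
have L2_1 : Lp_on (edge_set n) 2%:E (cst 1 : R -> R).
  by have := L2_on_cst (left_end n) (right_end n) 1; case.
have sub : <<s setT, @RGenInftyO.G R >> `<=` H.
  apply: lambda_system_subset => //.
  - move=> _ _ [x ->] [y ->]; exists (Num.min x y); apply/seteqP; split => z /=;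
      rewrite !in_itv /= lt_min; [by case=> -> ->|by move=> /andP[]].
  - split.
    + by move=> X _; exact: subsetT.
    + split; first exact: measurableT.
      (* On the edge the whole line agrees with the ray ending one unit past the right end. *)
      rewrite (_ : emb n _ = emb n (\1_(`]-oo, (right_end n + 1)%R[%classic) : R -> R)).
        exact: clamped_limit_ray.
      apply: eq_emb; [exact: Lp2_indic|exact: Lp2_indic|].
      apply: ae_on_all => x; rewrite /edge_set /= in_itv /= => /andP[_ xb].
      rewrite !indicE !mem_set//= in_itv /= (le_lt_trans xb)// ltrDl//.
    + move=> X Y YX [mX HX] [mY HY]; split; first exact: measurableD.
      rewrite (_ : emb n _ = (-1)%:C *: emb n (\1_Y : R -> R) + emb n (\1_X : R -> R)).
        exact: (clamped_limit_lin _ HY HX).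
      rewrite -(emb_lin _ (Lp2_indic n mY) (Lp2_indic n mX)).
      congr emb; apply/funext => x; rewrite !indicE in_setD.
      have [xY|xY] := boolP (x \in Y); last by rewrite mulr0 add0r andbT.
      by rewrite andbF (mem_set (YX _ (set_mem xY))) mulr1 addNr.
    + move=> F ndF HF; split; first by apply: bigcupT_measurable => i; have [] := HF i.
      apply: (@clamped_limit_dominated n (fun i : nat => \1_(F i)) _ (cst 1)) => //.
      * by move=> i; apply: measurable_indic; have [] := HF i.
      * by apply: measurable_indic; apply: bigcupT_measurable => i; have [] := HF i.
      * by move=> i x _; rewrite indicE; case: (_ \in _); rewrite ?normr1 ?normr0.
      * by move=> x _; rewrite indicE; case: (_ \in _); rewrite ?normr1 ?normr0.
      * apply: ae_on_all => x _.
        have [[i _ Fix]|nF] := pselect ((\bigcup_i F i) x).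
          rewrite [X in _ --> X](_ : _ = 1); last by rewrite indicE mem_set//; exists i.
          apply: cvg_near_cst; exists i => // j /= ij.
          by rewrite indicE mem_set//; have /subsetPset := ndF _ _ ij; apply.
        rewrite [X in _ --> X](_ : _ = 0); last by rewrite indicE memNset.
        apply: cvg_near_cst; apply: nearW => j.
        by rewrite indicE memNset// => Fjx; apply: nF; exists j.
      * by move=> i; have [] := HF i.
  - move=> _ [x ->]; split; first exact: measurable_itv.
    exact: clamped_limit_ray.
apply: sub; move: mA.
by rewrite -[X in X -> _]/((@ocitv R).-sigma.-measurable A) RGenInftyO.measurableE.
Qed.

Import HBNNSimple.

Lemma clamped_limit_nnsfun n (g : {nnsfun R >-> R}) : clamped_limit (emb n g).
Proof.
pose F (s : seq R) (x : R) : R := \sum_(y <- s) y * \1_(g @^-1` [set y]) x.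
have -> : (g : R -> R) = F (finmap.enum_fset (fset_set (range g))).
  apply/funext => x; rewrite {1}fimfunE /F fsbig_finite//.
suff : forall s, Lp_on (edge_set n) 2%:E (F s) /\ clamped_limit (emb n (F s)).
  by move=> /(_ (finmap.enum_fset (fset_set (range g))))[].
have F0 : F [::] = cst 0 by apply/funext => x; rewrite /F big_nil.
elim=> [|y s [s2 IH]].
  rewrite F0; split; first exact: Lp2_on0.
  rewrite (_ : emb n _ = 0); first exact: clamped_limit0.
  apply: (repr_by_inj (embE (Lp2_on0 _))); apply: eq_repr_by (@repr_by0 R G) => m.
  by apply: ae_on_all => x _; rewrite /on_edge; case: eqP.
have mY : measurable (g @^-1` [set y]) by exact: measurable_funPTI.
have -> : F (y :: s) = fun x => y * (\1_(g @^-1` [set y]) : R -> R) x + F s x.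
  by apply/funext => x; rewrite /F big_cons.
split; first by apply: Lp2_on_lin (Lp2_indic n mY) s2.
rewrite (emb_lin _ (Lp2_indic n mY) s2).
exact: (clamped_limit_lin _ (clamped_limit_indic n mY) IH).
Qed.

(** Simple functions approximate h from below, so h itself is the dominating function. *)
Lemma clamped_limit_ge0 n h : Lp_on (edge_set n) 2%:E h ->
  (forall x, edge_set n x -> 0 <= h x) -> clamped_limit (emb n h).
Proof.
move=> h2 h0; have mE := measurable_edge_set n.
have [mh _] := (Lp2P _ mE).1 h2.
pose h' := h \_ (edge_set n).
have mh' : measurable_fun setT h' by apply/(measurable_restrictT _ mE).
have h'0 x : 0 <= h' x.
  by rewrite /h' /patch; case: ifPn => // /set_mem; exact: h0.
have mf : measurable_fun setT (EFin \o h') by exact/measurable_EFinP.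
pose g := nnsfun_approx measurableT mf.
have f0 (x : R) : [set: R] x -> (0 <= (EFin \o h') x)%E by rewrite lee_fin.
apply: (@clamped_limit_dominated n (fun i : nat => g i) _ h h2).
- by move=> i; exact: measurable_funTS.
- exact: mh.
- move=> i x Ex; rewrite ger0_norm//.
  rewrite -lee_fin /g nnsfun_approxE (le_trans (le_approx _ f0 _))//=.
  by rewrite /h' patchE mem_set.
- by move=> x Ex; rewrite ger0_norm// h0.
- apply: ae_on_all => x Ex.
  have := cvg_nnsfun_approx measurableT mf f0 (I : [set: R] x).
  rewrite /= /h' patchE mem_set// => /fine_cvg; exact.
- by move=> i; exact: clamped_limit_nnsfun.
Qed.

(** Both |h| and |h| + h are nonnegative, and h is their difference. *)
Lemma clamped_limit_real n h : Lp_on (edge_set n) 2%:E h -> clamped_limit (emb n h).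
Proof.
move=> h2; have mE := measurable_edge_set n; have [mh _] := (Lp2P _ mE).1 h2.
have habs : Lp_on (edge_set n) 2%:E (fun x => `|h x|).
  apply/(Lp2P _ mE); split; first exact: measurableT_comp.
  have [_ i2] := (Lp2P _ mE).1 h2.
  by apply: eq_intable i2 => // x _; rewrite real_normK ?num_real.
have hp : Lp_on (edge_set n) 2%:E (fun x => `|h x| + h x).
  have := Lp2_on_lin 1 habs h2; congr Lp_on; apply/funext => x; ring.
have -> : h = (fun x => -1 * `|h x| + (`|h x| + h x)) by apply/funext => x; ring.
rewrite (emb_lin _ habs hp); apply: clamped_limit_lin.
  exact: clamped_limit_ge0 habs _.
by apply: clamped_limit_ge0 hp _ => x _; rewrite -lerBlDr sub0r ler_normr lexx orbT.
Qed.

Lemma repr_by_sum (I : Type) (s : seq I) (v : I -> L2_space G)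
    (F : I -> graph_fun G) : (forall j, repr_by (v j) (F j)) ->
  repr_by (\sum_(j <- s) v j) (fun m x => \sum_(j <- s) F j m x).
Proof.
move=> vF; elim: s => [|j s IH].
  by rewrite big_nil; apply: eq_repr_by (@repr_by0 R G) => m; apply: ae_on_all => x _;
    rewrite big_nil.
rewrite big_cons -[v j]scale1r; apply: eq_repr_by (repr_by_lin 1 (vF j) IH) => m.
by apply: ae_on_all => x _; rewrite big_cons mul1r.
Qed.

(** u is a finite combination of the real and imaginary parts of its restrictions to the edges. *)
Lemma clamped_limit_all u : clamped_limit u.
Proof.
pose f := L2_repr u.
have f2 n : L2_on (edge_set n) (f n) := L2_reprP u n.
pose v n := 'i%C *: emb n (@complex.Im R \o f n) + emb n (@complex.Re R \o f n).
have -> : u = \sum_n v n.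
  apply: (repr_by_inj (repr_by_repr u)).
  have vP n : repr_by (v n) (fun m x =>
      'i%C * on_edge n (fun t => (complex.Im (f n t))%:C) m x +
      on_edge n (fun t => (complex.Re (f n t))%:C) m x).
    by have [f1 f2'] := f2 n; exact: (repr_by_lin _ (embE f2') (embE f1)).
  apply: eq_repr_by (repr_by_sum (index_enum _) vP) => m; apply: ae_on_all => x _.
  rewrite (bigD1 m)//= big1 ?addr0 => [|n nm]; last first.
    by rewrite !on_edge_neq 1?eq_sym// mulr0 addr0.
  rewrite !on_edge_eq /f; case: (L2_repr u m x) => p q /=.
  by apply: complex_ext; rewrite !ReIm /=; ring.
elim/big_ind: _ => [|w w' cw cw'|n _].
- exact: clamped_limit0.
- by rewrite -[w]scale1r; exact: clamped_limit_lin.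
- have [f1 f2'] := f2 n.
  by apply: clamped_limit_lin; exact: clamped_limit_real.
Qed.

Lemma clamped_dom (W : edge -> R -> R) u : potential W -> clamped u -> op_dom (schrodinger W) u.
Proof.
move=> W2 [g [g1 [g2 [H z ug]]]].
exists (L2_of (fun n t => - g2 n t + (W n t)%:C * g n t)); exists g, g1, g2; split => //.
- exact: kirchhoff_zero_ends.
- exact/L2_ofE/(schrodinger_L2 W2 H).
Qed.

Lemma schrodinger_dense (W : edge -> R -> R) : potential W -> dense (op_dom (schrodinger W)).
Proof.
move=> W2 O [u Ou] oO.
have /nbhs_ballP[e e0 eO] : nbhs u O by exact: open_nbhs_nbhs.
have e0' : 0 < complex.Re e by rewrite -ltr_realC -ge0_realC// ltW.
have [v vc uv] := clamped_limit_all u (divr_gt0 e0' (ltr0n _ 2)).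
exists v; split; last exact: clamped_dom vc.
apply: eO; rewrite -ball_normE /= rnormE [ltRHS](ge0_realC (ltW e0)) ltr_realC.
by rewrite (le_lt_trans uv)// ltr_pdivrMr// ltr_pMr// ltr1n.
Qed.

(** If v is orthogonal to u, Pythagoras keeps v at distance at least the norm of u; so for u nonzero
    the ball about u of that radius would miss D. *)
Lemma dense_orthogonal (D : set (L2_space G)) u : dense D ->
  (forall v, D v -> L2_ip u v = 0) -> u = 0.
Proof.
move=> dD uD; apply: rnorm_eq0; apply/eqP; apply: contraT => u0.
have r0 : 0 < rnorm u by rewrite lt_neqAle eq_sym u0 rnorm_ge0.
have [|v [vu /uD uv0]] := dD (ball u (rnorm u)%:C) _ (@ball_open _ _ _ _).
  by exists u; apply: ballxx; rewrite ltr_realC.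
move: vu; rewrite -ball_normE /= rnormE ltr_realC.
rewrite -(@ltr_sqr R) ?nnegrE ?rnorm_ge0// ltNge => /negP; apply: contra_notT => _.
rewrite -ler_realC !rmorphXn /= -!rnormE !L2_norm_sq.
rewrite (dnormB (@L2_ip R G)).
set d := (X in _ - (X + _)); have -> : d = 0 by exact: uv0.
set d' := (X in conjC X); have -> : d' = 0 by exact: uv0.
rewrite rmorph0 addr0 subr0 lerDl.
exact: dnorm_ge0.
Qed.

End Density.

(** * Self-adjointness, and A_N + alpha V as a Schroedinger operator *)

Section SelfAdjoint.
Context {R : realType} (G : metric_graph R).
Local Notation edge := 'I_(nedges G).
Implicit Types (u v w : L2_space G) (n : edge) (W V : edge -> R -> R).

(** By linearity (0, h - k) is in the graph, and symmetry makes h - k orthogonal to the dense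
    domain. *)
Lemma schrodinger_fun W f h k : potential W ->
  schrodinger W (f, h) -> schrodinger W (f, k) -> h = k :> L2_space G.
Proof.
move=> W2 fh fk; apply/eqP; rewrite -subr_eq0; apply/eqP.
apply: (dense_orthogonal (schrodinger_dense W2)) => v [v' vv'].
have := schrodinger_lin (-1) fk fh.
have -> : -1 *: (f, k) + (f, h) = (0, h - k).
  by congr (_, _); rewrite scaleN1r addrC ?subrr.
move=> S0; have /= -> := schrodinger_symmetric W2 S0 vv'.
exact: (linear0l (@L2_ip R G)).
Qed.

Lemma schrodinger_linear_operator W : potential W ->
  linear_operator (schrodinger W : set (L2_space G * L2_space G)).
Proof.
move=> W2; split; [exact: schrodinger0|exact: schrodinger_lin|].
by move=> f h k; exact: schrodinger_fun.
Qed.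

Theorem schrodinger_self_adjoint W : potential W ->
  self_adjoint (@L2_ip R G) (schrodinger W).
Proof.
move=> W2; split; [exact: schrodinger_linear_operator|exact: schrodinger_dense|].
apply/seteqP; split => [y yP|y Sy x Sx]; first exact: schrodinger_adjoint yP.
exact: schrodinger_symmetric.
Qed.

Lemma neumann_schrodinger : neumann_laplacian G = schrodinger (fun _ _ => 0).
Proof.
apply/seteqP; split => x [g [g1 [g2 [H k x1E x2E]]]]; exists g, g1, g2; split => //.
  by apply: eq_repr_by x2E => n; apply: ae_on_all => t _; rewrite mul0r addr0.
by move=> n; apply: ae_onS (x2E n) => t _ ->; rewrite mul0r addr0.
Qed.

Lemma potential0 : potential (fun (_ : edge) _ => 0).
Proof. by move=> n; exact: Lp2_on0. Qed.

Lemma potentialZ (a : R) V : potential V -> potential (fun n x => a * V n x).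
Proof.
move=> V2 n; have := Lp2_on_lin a (V2 n) (Lp2_on0 _); congr Lp_on.
by apply/funext => x; rewrite addr0.
Qed.

(** Intersecting with the domain of V does not shrink dom(A_N): the representative g is bounded, so
    V g is square-integrable. *)
Lemma neumann_add_schrodinger V (a : R) : potential V ->
  op_add (neumann_laplacian G) (op_scale a%:C (multiplication_operator V)) =
  schrodinger (fun n x => a * V n x).
Proof.
move=> V2; rewrite neumann_schrodinger; apply/seteqP; split => x.
  move=> [h [k [[g [g1 [g2 [H kg /= x1E hE]]]] [m /= mE /= kE] x2E]]].
  exists g, g1, g2; split => //; rewrite x2E kE addrC.
  have mg : repr_by m (fun n t => (V n t)%:C * g n t).
    by move=> n; apply: ae_onS2 (mE n) (x1E n) => t _ -> ->.
  apply: eq_repr_by (repr_by_lin a%:C mg hE) => n; apply: ae_on_all => t _.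
  by rewrite mul0r addr0 addrC mulrA -rmorphM.
move=> [g [g1 [g2 [H kg x1E x2E]]]].
have h2 := schrodinger_L2 potential0 H.
have m2 := potential_mul V2 H.
exists (L2_of (fun n t => - g2 n t + 0%:C * g n t)),
  (a%:C *: L2_of (fun n t => (V n t)%:C * g n t)); split.
- by exists g, g1, g2; split => //; exact: L2_ofE.
- exists (L2_of (fun n t => (V n t)%:C * g n t)) => //= n.
  by apply: ae_onS2 (L2_ofE m2 n) (x1E n) => t _ -> ->.
- apply: (repr_by_inj x2E); rewrite addrC.
  apply: eq_repr_by (repr_by_lin a%:C (L2_ofE m2) (L2_ofE h2)) => n.
  by apply: ae_on_all => t _; rewrite mul0r addr0 addrC mulrA -rmorphM.
Qed.

Lemma schrodinger_dom W W' : potential W' ->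
  op_dom (schrodinger W) `<=` op_dom (schrodinger W' : set (L2_space G * L2_space G)).
Proof.
move=> W2 f [h [g [g1 [g2 [H kg x1E _]]]]].
exists (L2_of (fun n t => - g2 n t + (W' n t)%:C * g n t)); exists g, g1, g2.
by split => //; exact/L2_ofE/(schrodinger_L2 W2 H).
Qed.

End SelfAdjoint.

(** * Negative spectrum *)

Section NegativeSpectrum.
Context {R : realType} (G : metric_graph R).
Local Notation mu := (@lebesgue_measure R).
Local Notation edge := 'I_(nedges G).
Local Notation Re := (@complex.Re R).
Implicit Types (u v w f h k : L2_space G) (n : edge) (W V : edge -> R -> R) (t : R).

Let lr n : left_end n <= right_end n := ltW (left_lt_right n).

Lemma sobolev_msq n (g g1 g2 : R -> R[i]) e x : 0 < e ->
  H2_with_derivatives (left_end n) (right_end n) g g1 g2 -> edge_set n x ->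
  msq (g x) <= e * \int[mu]_(t in edge_set n) msq (g1 t) +
    (e^-1 + (right_end n - left_end n)^-1) * \int[mu]_(t in edge_set n) msq (g t).
Proof.
move=> e0 [g2L g1E gE] Ex; have mE := measurable_edge_set n.
have g1L := L2_on_primitive (lr n) (L2_cintable g2L) g1E.
have gL := L2_on_primitive (lr n) (L2_cintable g1L) gE.
have [gE1 gE2] := (is_primitiveP _ _ _ _).1 gE.
have [g11 g12] := g1L; have [gL1 gL2] := gL.
have S1 := sobolev_sqr e0 (left_lt_right n) Ex g11 gE1.
have S2 := sobolev_sqr e0 (left_lt_right n) Ex g12 gE2.
have D (p : R -> R[i]) : L2_on (edge_set n) p ->
    \int[mu]_(t in edge_set n) msq (p t) =
    \int[mu]_(t in edge_set n) ((Re \o p) t ^+ 2) +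
    \int[mu]_(t in edge_set n) ((@complex.Im R \o p) t ^+ 2).
  by move=> [p1 p2]; rewrite -RintD//; [have [] := (Lp2P _ mE).1 p1|have [] := (Lp2P _ mE).1 p2].
rewrite (D _ g1L) (D _ gL) !mulrDr addrACA; exact: lerD.
Qed.

Lemma form_energy W f h (g g1 g2 : graph_fun G) : potential W ->
  regular g g1 g2 -> kirchhoff_conditions g g1 -> repr_by f g ->
  repr_by h (fun n t => - g2 n t + (W n t)%:C * g n t) ->
  L2_ip h f = (\sum_n (\int[mu]_(x in edge_set n) msq (g1 n x) +
    \int[mu]_(x in edge_set n) (W n x * msq (g n x))))%:C.
Proof.
move=> W2 H k fE hE; rewrite (form_identity W2 H k hE H k fE) rmorph_sum.
apply: eq_bigr => n _; rewrite rmorphD /= -L2_dot_msq; congr (_ + _).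
apply: complex_ext => /=.
  apply: eq_Rintegral => x _; by rewrite -mulrA msqE /= mul0r subr0.
transitivity (\int[mu]_(x in edge_set n) (0 : R)); last by rewrite /Rintegral integral0.
by apply: eq_Rintegral => x _; rewrite -mulrA msqE /= mul0r mulr0 addr0.
Qed.

Lemma intable_mul_msq n (w : R -> R) (g g1 g2 : R -> R[i]) :
  Lp_on (edge_set n) 2%:E w ->
  H2_with_derivatives (left_end n) (right_end n) g g1 g2 ->
  intable (edge_set n) (fun x => w x * msq (g x)).
Proof.
move=> w2 H; have mE := measurable_edge_set n.
have [g2L g1E gE] := H.
have g1L := L2_on_primitive (lr n) (L2_cintable g2L) g1E.
have gL := L2_on_primitive (lr n) (L2_cintable g1L) gE.
apply: (intable_mul_bdd (v := fun x => msq (g x)) mE (Lp2_intable w2)).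
  exact: intable_measurable (intable_msq mE gL).
move=> x Ex; rewrite ger0_norm ?msq_ge0//.
exact: (sobolev_msq ltr01 H Ex).
Qed.

(** On each edge the potential term is at most w sup |g|^2, with w the L^1 norm of W. Choosing e = 1
    / (w + 1) in the Sobolev bound makes w e <= 1: the derivative part is absorbed by the kinetic
    energy, and c n times the squared L^2 norm remains. *)
Lemma schrodinger_semibounded W : potential W -> exists K : R,
  forall f h, schrodinger W (f, h) -> - K * rnorm f ^+ 2 <= Re (L2_ip h f).
Proof.
move=> W2.
pose w n := \int[mu]_(x in edge_set n) `|W n x|.
have w0 n : 0 <= w n by apply: Rintegral_ge0.
pose c n := w n * ((w n + 1) + (right_end n - left_end n)^-1).
have c0 n : 0 <= c n.
  by rewrite mulr_ge0// !addr_ge0// invr_ge0 subr_ge0 lr.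
exists (\sum_n c n) => f h [g [g1 [g2 [H k fE hE]]]].
rewrite (form_energy W2 H k fE hE) /= (rnorm_sqr (regular0 H) fE) /sqnorm mulr_sumr.
apply: ler_sum => n _; have mE := measurable_edge_set n.
set I0 := \int[mu]_(x in edge_set n) msq (g n x).
set I1 := \int[mu]_(x in edge_set n) msq (g1 n x).
set J := \int[mu]_(x in edge_set n) (W n x * _).
have I10 : 0 <= I1 by apply: Rintegral_ge0 => x _; exact: msq_ge0.
have I00 : 0 <= I0 by apply: Rintegral_ge0 => x _; exact: msq_ge0.
pose e := (w n + 1)^-1.
have e0 : 0 < e by rewrite invr_gt0 ltr_wpDl.
pose B := e * I1 + (e^-1 + (right_end n - left_end n)^-1) * I0.
have iW := Lp2_intable (W2 n).
have iWm := intable_mul_msq (W2 n) (H n).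
have JB : `|J| <= w n * B.
  rewrite (le_trans (@le_normr_Rintegral _ _ _ mu _ _ mE iWm))//.
  rewrite mulrC -RintZ//; last exact: intable_norm.
  apply: (@le_Rintegral _ _ _ mu) => //; first exact: (intable_norm iWm).
    exact: (intableZ B mE (intable_norm iW)).
  move=> x Ex; rewrite normrM mulrC ler_wpM2r// ger0_norm ?msq_ge0//.
  exact: (sobolev_msq e0 (H n) Ex).
have wB : w n * B <= I1 + c n * I0.
  rewrite /B mulrDr mulrA lerD//.
    by rewrite ler_piMl// ler_pdivrMr ?ltr_wpDl// mul1r lerDl.
  by rewrite mulrA /e invrK.
have cK : c n * I0 <= (\sum_m c m) * I0.
  by rewrite ler_wpM2r// (bigD1 n)//= lerDl sumr_ge0.
have JJ : - J <= `|J| by rewrite ler_normr lexx orbT.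
by rewrite mulNr; lra.
Qed.

Definition rip u v : R := Re (L2_ip u v).

Lemma rip_lin t u v w : rip (t%:C *: u + v) w = t * rip u w + rip v w.
Proof. by rewrite /rip L2_ip_linl !ReIm /= mul0r subr0. Qed.

Lemma ripC u v : rip u v = rip v u.
Proof. by rewrite /rip L2_ip_herm ReIm. Qed.

Lemma rip_linr t u v w : rip w (t%:C *: u + v) = t * rip w u + rip w v.
Proof. by rewrite !(ripC w) rip_lin. Qed.

Lemma rip0 u : rip u 0 = 0.
Proof. by have := rip_linr (-1) 0 0 u; rewrite scaler0 addr0; lra. Qed.

Lemma rip_norm u : rip u u = rnorm u ^+ 2.
Proof. by rewrite /rip -L2_norm_sq rnormE -rmorphXn. Qed.

Lemma rip_le u v : 2 * rip u v <= rnorm u ^+ 2 + rnorm v ^+ 2.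
Proof.
have : 0 <= rip ((-1)%:C *: u + v) ((-1)%:C *: u + v) by rewrite rip_norm sqr_ge0.
by rewrite rip_lin !rip_linr !rip_norm (ripC v u); lra.
Qed.

Lemma schrodinger_rip_sym W f h k l : potential W -> schrodinger W (f, h) ->
  schrodinger W (k, l) -> rip h k = rip f l.
Proof. by move=> W2 fh kl; rewrite /rip (schrodinger_symmetric W2 fh kl). Qed.

Lemma resolvent_schrodinger W (m : R) : potential W ->
  resolvent_set (schrodinger W : set (L2_space G * L2_space G)) m%:C ->
  exists2 M : R, 0 <= M & forall f, exists k l,
    [/\ schrodinger W (k, l), f = l - m%:C *: k & rnorm k <= M * rnorm f].
Proof.
move=> W2 [_ domT [M HM]]; exists `|M| => // f.
have : op_dom (op_inv (op_shift (schrodinger W) m%:C)) f by rewrite domT.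
move=> [k fk]; have := HM _ _ fk.
case: fk => l [k' [/= kl [h2 h2k /= k'E] fE]] kM.
rewrite /op_id /= in h2k; rewrite k'E h2k scaleNr in fE.
exists k, l; split=> //.
move: kM; rewrite !rnormE -rmorphM ler_realC => /le_trans; apply.
by rewrite ler_wpM2r ?rnorm_ge0// ler_norm.
Qed.

(* m is the bottom of the numerical range; a near-minimizer f and k = (T - m)^-1 f
   make the form of T - m negative at f - t k, unless (T - m)^-1 is unbounded. *)
Lemma negative_spectrum W f0 h0 : potential W -> schrodinger W (f0, h0) ->
  rip h0 f0 < 0 ->
  spectrum (schrodinger W : set (L2_space G * L2_space G)) `&`
    [set t%:C | t in `]-oo, 0%R[] !=set0.
Proof.
move=> W2 S0 neg.
pose Q : set R := [set r | exists f h, [/\ schrodinger W (f, h), rnorm f != 0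
  & r = rip h f / rnorm f ^+ 2]].
have f00 : rnorm f0 != 0.
  by apply: contraTneq neg => /rnorm_eq0 ->; rewrite -leNgt rip0 lexx.
have Q0 : Q (rip h0 f0 / rnorm f0 ^+ 2) by exists f0, h0.
have [K HK] := schrodinger_semibounded W2.
have nsq u : rnorm u != 0 -> 0 < rnorm u ^+ 2.
  by move=> u0; rewrite exprn_gt0// lt_neqAle eq_sym u0 rnorm_ge0.
have lbQ : lbound Q (- K).
  by move=> _ [f [h [fh fn ->]]]; rewrite ler_pdivlMr ?nsq//; exact: HK fh.
have hQ : has_inf Q by split; [exists (rip h0 f0 / rnorm f0 ^+ 2)|exists (- K)].
pose m := inf Q.
have mQ r : Q r -> m <= r by apply: ge_inf; case: hQ.
have m0 : m < 0.
  by rewrite (le_lt_trans (mQ _ Q0))// ltr_pdivrMr ?mul0r// nsq.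
have form f h : schrodinger W (f, h) -> m * rnorm f ^+ 2 <= rip h f.
  move=> fh; have [fn|fn] := eqVneq (rnorm f) 0.
    by rewrite fn expr0n mulr0 (rnorm_eq0 fn) rip0.
  by rewrite -ler_pdivlMr ?nsq//; apply: mQ; exists f, h.
exists m%:C; split; last by exists m => //=; rewrite in_itv.
move=> /(resolvent_schrodinger W2)[M M0 HM].
(* Let F be the squared norm of f and s = 1 / N. The form of T - m at f - s k is its value at f,
   minus 2 s F, plus s^2 Re <f, k>. The first term is below s F / 2 by the choice of f, the last at
   most s F / 2 because 2 Re <f, k> <= N F; the total is below - s F. *)
pose N := 1 + M ^+ 2; have N0 : 0 < N by rewrite ltr_pwDl// sqr_ge0.
have [_ [f [h [fh fn ->]]]] := inf_adherent (divr_gt0 ltr01 (mulr_gt0 (ltr0n _ 2) N0)) hQ.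
rewrite -/m => fm.
have [k [l [kl fE kM]]] := HM f.
pose s := N^-1; have s0 : 0 < s by rewrite invr_gt0.
have sN : s * N = 1 by rewrite mulVf ?gt_eqF.
pose F := rnorm f ^+ 2; have F0 : 0 < F by exact: nsq.
have hf : rip h f < (m + s / 2) * F.
  move: fm; rewrite ltr_pdivrMr// => /lt_le_trans; apply.
  rewrite ler_wpM2r ?(ltW F0)// lerD2l /s; lra.
have kf : rip f k <= N / 2 * F.
  have := rip_le f k.
  have : rnorm k ^+ 2 <= M ^+ 2 * F.
    by rewrite -exprMn ler_sqr ?nnegrE ?mulr_ge0 ?rnorm_ge0.
  by rewrite -/F /N; lra.
have lf : l = (m%:C *: k + f) by rewrite fE addrC subrK.
have := form _ _ (schrodinger_lin (- s)%:C kl fh).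
rewrite -rip_norm /= !rip_lin !rip_linr !rip_norm -/F.
rewrite (schrodinger_rip_sym W2 fh kl) lf !rip_lin !rip_linr !rip_norm -/F (ripC k f).
have e1 : s ^+ 2 * rip f k <= s / 2 * F.
  rewrite (_ : s / 2 * F = s ^+ 2 * (N / 2 * F)) ?ler_wpM2l ?sqr_ge0//.
  by rewrite expr2 -[in LHS](mulr1 s) -sN; ring.
have sF : 0 < s * F by rewrite mulr_gt0.
rewrite leNgt => /negP; apply; rewrite -subr_gt0.
set A := rip f k in e1 *; set B := rip h f in hf *; set D := rnorm k ^+ 2.
have -> : m * (- s * (- s * D + A) + (- s * A + F)) -
    (- s * (- s * (m * D + A) + (m * A + F)) + (- s * (m * A + F) + B)) =
    2 * (s * F) - s ^+ 2 * A - (B - m * F) by ring.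
by lra.
Qed.

Lemma Rintegral_norm_eq0 n (v : R -> R) : intable (edge_set n) v ->
  \int[mu]_(x in edge_set n) `|v x| = 0 -> ae_on (edge_set n) (fun x => v x = 0).
Proof.
move=> iv v0; have mE := measurable_edge_set n.
have : ae_eq mu (edge_set n) (EFin \o v) (cst 0%E).
  apply: (@ae_eq_integral_abs _ _ _ mu (edge_set n) mE _ _).1.
    exact: (@measurable_int _ _ _ mu).
  rewrite -[RHS]/(0%:E) -v0 -integral_EFin//; exact: intable_norm.
by rewrite /ae_on; apply: filterS => x /[apply] -[].
Qed.

Lemma constant_negative_form V (a : R) : potential V ->
  ae_graph (fun n x => 0 <= V n x) -> ~ ae_graph (fun n x => V n x = 0) -> a < 0 ->
  exists f h, schrodinger (fun n x => a * V n x) (f, h) /\ rip h f < 0.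
Proof.
move=> V2 V0 VN a0.
pose g : graph_fun G := fun _ => cst 1; pose z : graph_fun G := fun _ => cst 0.
have H : regular g z z by move=> n; split; [exact: L2_on0|exact: is_primitive_cst..].
have k : kirchhoff_conditions g z.
  move=> v _; split => //; apply: big1 => j _.
  by rewrite /inward_derivative oppr0; case: ifP.
have aV2 := potentialZ a V2.
have fE := L2_ofE (regular0 H); have hE := L2_ofE (schrodinger_L2 aV2 H).
exists (L2_of g), (L2_of (fun n t => - z n t + (a * V n t)%:C * g n t)).
split; first by exists g, z, z.
rewrite /rip (form_energy aV2 H k fE hE) /=.
pose c n := \int[mu]_(x in edge_set n) `|V n x|.
have c0 n : 0 <= c n by apply: Rintegral_ge0.
rewrite (eq_bigr (fun n => a * c n)); last first.
  move=> n _; have mE := measurable_edge_set n; have iV := Lp2_intable (V2 n).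
  rewrite (_ : Rintegral _ _ _ = 0) ?add0r; last first.
    under eq_Rintegral do rewrite msq_real expr0n.
    by rewrite /Rintegral integral0.
  rewrite -RintZ//; last exact: intable_norm.
  apply: Rintegral_ae => //.
  - apply: intable_measurable; apply: eq_intable (intableZ a mE iV) => // x _.
    by rewrite msq_real expr1n mulr1.
  - exact: (intable_measurable (intableZ a mE (intable_norm iV))).
  - by apply: ae_onS (V0 n) => x _ Vx; rewrite msq_real expr1n mulr1 ger0_norm.
rewrite -mulr_sumr nmulr_rlt0// lt_neqAle sumr_ge0// andbT eq_sym.
(* A zero sum would make the integral of |V n| vanish on every edge, hence V zero almost
   everywhere. *)
apply/eqP => /psumr_eq0P c00; apply: VN => n.
apply: Rintegral_norm_eq0 (Lp2_intable (V2 n)) _.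
by apply: (c00 _ n) => // m _.
Qed.

End NegativeSpectrum.

(** * Compactness of the resolvent followed by a multiplication *)

Section Compactness.
Context {R : realType} (G : metric_graph R).
Local Notation mu := (@lebesgue_measure R).
Local Notation edge := 'I_(nedges G).
Local Notation Re := (@complex.Re R).
Implicit Types (u v w f h k : L2_space G) (n : edge) (x y t : R).

Let lr n : left_end n <= right_end n := ltW (left_lt_right n).

(* The real and imaginary parts of a function at all points of the edges, with
   the product topology: Tychonoff replaces the Arzela-Ascoli theorem. *)
Definition values : Type := {ptws (edge * R * bool)%type -> R}.
HB.instance Definition _ := Topological.on values.
Implicit Types phi psi : values.

Definition values_fun phi : graph_fun G :=
  fun n x => phi (n, x, false) +i* phi (n, x, true).

(** Hoelder continuity with exponent 1/2, squared to avoid roots. The bound B is imposed at points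
    off the edges too, so that the first set is a full product of compact intervals. *)
Definition hoelder_box (B C : R) : set values :=
  [set phi | forall i, phi i \in `[- B, B] ] `&`
  [set phi | forall n x y b, edge_set n x -> edge_set n y ->
    (phi (n, x, b) - phi (n, y, b)) ^+ 2 <= C * `|x - y|].

(** The product of intervals is compact by Tychonoff's theorem, and each Hoelder inequality is a
    closed condition on two coordinates. *)
Lemma hoelder_box_compact B C : compact (hoelder_box B C).
Proof.
apply: compact_closedI.
  apply: (@tychonoff _ (fun _ : edge * R * bool => R) (fun _ => `[- B, B]%classic)).
  by move=> i; exact: segment_compact.
pose D := [set q : edge * R * R * bool | edge_set q.1.1.1 q.1.1.2 /\ edge_set q.1.1.1 q.1.2].
rewrite (_ : mkset _ = \bigcap_(q in D) [set phi : values |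
  (phi (q.1.1.1, q.1.1.2, q.2) - phi (q.1.1.1, q.1.2, q.2)) ^+ 2 <=
    C * `|q.1.1.2 - q.1.2| ]); last first.
  apply/seteqP; split => [phi H [[[n x] y] b] /= [Ex Ey]|phi H n x y b Ex Ey].
    exact: H.
  exact: (H (n, x, y, b) (conj Ex Ey)).
apply: closed_bigI => -[[[n x] y] b] _ /=.
have pc i : continuous (fun phi : values => phi i).
  exact: (@proj_continuous _ (fun _ => R) i).
apply: (@closed_comp _ _ (fun phi : values =>
  (phi (n, x, b) - phi (n, y, b)) ^+ 2) [set r | r <= C * `|x - y|]).
  move=> phi _.
  have B' : (fun p : values => p (n, x, b) - p (n, y, b)) @ nbhs phi -->
      phi (n, x, b) - phi (n, y, b).
    by apply: cvgB; exact: pc.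
  rewrite /continuous_at expr2.
  by under eq_cvg do rewrite expr2; exact: (cvgM B' B').
exact: closed_le.
Qed.

Lemma hoelder_box_measurable B C phi n b : hoelder_box B C phi -> 0 <= C ->
  measurable_fun (edge_set n) (fun x => phi (n, x, b)).
Proof.
move=> [_ H] C0.
apply: subspace_continuous_measurable_fun; first exact: measurable_edge_set.
apply/subspace_continuousP => x Ex; apply/cvgrPdist_lt => e e0.
have d0 : 0 < e ^+ 2 / (C + 1) by rewrite divr_gt0 ?exprn_gt0// ltr_wpDl.
rewrite near_withinE; exists (e ^+ 2 / (C + 1)) => // t /= xt Et.
rewrite -(@ltr_sqr R) ?nnegrE ?(ltW e0)// real_normK ?num_real//.
apply: (le_lt_trans (H n x t b Ex Et)).
apply: (@le_lt_trans _ _ ((C + 1) * `|x - t|)); first by rewrite ler_wpM2r// lerDl.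
by rewrite mulrC -ltr_pdivlMr// ltr_wpDl.
Qed.

Context (V : edge -> R -> R) (V2 : potential V).

Definition values_mul phi : graph_fun G := fun n x => (V n x)%:C * values_fun phi n x.

Lemma values_mul_L2 B C phi : hoelder_box B C phi -> 0 <= C -> is_L2 (values_mul phi).
Proof.
move=> Hphi C0 n; have mE := measurable_edge_set n.
have bdd b x : edge_set n x -> `|phi (n, x, b)| <= B.
  by move=> _; have := Hphi.1 (n, x, b); rewrite in_itv /= ler_norml.
have L2 b := Lp2_mul_bdd mE (V2 n) (hoelder_box_measurable b Hphi C0) (bdd b).
split.
  by have := L2 false; congr Lp_on; apply/funext => x; rewrite /= mul0r subr0.
by have := L2 true; congr Lp_on; apply/funext => x; rewrite /= mul0r addr0.
Qed.

(** The factor 2 accounts for the real and imaginary parts. *)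
Lemma values_mul_dist B C phi psi eta : hoelder_box B C phi -> hoelder_box B C psi ->
  0 <= C ->
  (forall n x b, edge_set n x -> (psi (n, x, b) - phi (n, x, b)) ^+ 2 <= eta) ->
  rnorm (L2_of (values_mul psi) - L2_of (values_mul phi)) ^+ 2 <=
  \sum_n 2 * eta * \int[mu]_(x in edge_set n) (V n x ^+ 2).
Proof.
move=> Hphi Hpsi C0 dist.
have phiL := values_mul_L2 Hphi C0; have psiL := values_mul_L2 Hpsi C0.
pose d n x := -1 * values_mul phi n x + values_mul psi n x.
have dL : is_L2 d by move=> n; exact: L2_on_lin.
have dE : repr_by (L2_of (values_mul psi) - L2_of (values_mul phi)) d.
  by rewrite addrC -scaleN1r; exact: repr_by_lin (L2_ofE phiL) (L2_ofE psiL).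
rewrite (rnorm_sqr dL dE); apply: ler_sum => n _; have mE := measurable_edge_set n.
have [_ iV2] := (Lp2P _ mE).1 (V2 n).
rewrite -RintZ//; apply: (@le_Rintegral _ _ _ mu) => //.
- exact: (intable_msq mE (dL n)).
- exact: intableZ.
- move=> x Ex; have -> : d n x = (V n x)%:C * (values_fun psi n x - values_fun phi n x).
    by rewrite /d /values_mul mulrBr mulN1r addrC.
  rewrite msqM msq_real mulrC ler_wpM2r ?sqr_ge0// /msq /=.
  by rewrite mulr_natl mulr2n; apply: lerD; exact: dist.
Qed.

Lemma mesh n (N : nat) x : (0 < N)%N -> edge_set n x ->
  exists k : 'I_N.+1,
  let xk := left_end n + k%:R * ((right_end n - left_end n) / N%:R) in
  edge_set n xk /\ `|x - xk| <= (right_end n - left_end n) / N%:R.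
Proof.
move=> N0; rewrite /edge_set /= in_itv /= => /andP[ax xb].
set L := right_end n - left_end n.
have L0 : 0 < L by rewrite subr_gt0 left_lt_right.
have N0' : 0 < N%:R :> R by rewrite ltr0n.
have h0 : 0 < L / N%:R by rewrite divr_gt0.
pose t := (x - left_end n) / (L / N%:R).
have t0 : 0 <= t by rewrite divr_ge0 ?subr_ge0// ltW.
have tN : t <= N%:R.
  by rewrite ler_pdivrMr// [leRHS]mulrC divfK ?gt_eqF// /L lerD2r.
(* The integer part of t is the wanted index; it reaches N at the right end, hence N + 1 mesh
   points. *)
have /andP[kt tk] := truncn_itv t0.
have kN : (Num.truncn t < N.+1)%N.
  by rewrite ltnS -(ler_nat R) (le_trans kt).
exists (Ordinal kN) => /=.
have xt : x = left_end n + t * (L / N%:R).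
  by rewrite /t divfK ?gt_eqF// addrC subrK.
split.
  rewrite in_itv /= lerDl mulr_ge0 ?(ltW h0)//=.
  by rewrite (le_trans _ xb)// xt lerD2l ler_wpM2r// ltW.
rewrite {1}xt opprD addrACA subrr add0r -mulrBl normrM (ger0_norm (ltW h0)).
rewrite ler_piMl ?(ltW h0)// ger0_norm ?subr_ge0//.
by rewrite lerBlDl natr1 ltW.
Qed.

(* On the box, closeness at the finitely many points of a fine mesh implies
   uniform closeness. *)
Lemma values_mul_continuous B C : 0 <= C ->
  {within hoelder_box B C, continuous (fun phi => L2_of (values_mul phi))}.
Proof.
move=> C0; apply/subspace_continuousP => phi Hphi.
apply/cvgrPdist_lt => e' e'0.
pose e := Re e'.
have e0 : 0 < e by rewrite -ltr_realC -ge0_realC// ltW.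
pose v : R := \sum_n \int[mu]_(x in edge_set n) (V n x ^+ 2).
have v0 : 0 <= v by apply: sumr_ge0 => n _; apply: Rintegral_ge0 => x _; exact: sqr_ge0.
(* 2 eta v < e^2. Two Hoelder steps to a mesh point cost eta / 12 each and the deviation there eta /
   6; since (r + s - t)^2 <= 3 (r^2 + s^2 + t^2), the squared distance at any point is at most 3
   (eta / 12 + eta / 6 + eta / 12) = eta. *)
pose eta := e ^+ 2 / (4 * (v + 1)).
have v10 : 0 < 4 * (v + 1) by rewrite mulr_gt0// ltr_wpDl.
have eta0 : 0 < eta by rewrite divr_gt0// exprn_gt0.
pose d := Num.min 1 (eta / 6).
have d0 : 0 < d by rewrite lt_min ltr01 divr_gt0.
have d2 : d ^+ 2 <= eta / 6.
  have d1 : d <= 1 by rewrite ge_min lexx.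
  by rewrite expr2 (le_trans (ler_piMr (ltW d0) d1))// /d ge_min lexx orbT.
pose L : R := \sum_(n : edge) (right_end n - left_end n).
have Ln n : right_end n - left_end n <= L.
  by rewrite /L (bigD1 n)//= lerDl sumr_ge0// => m _; rewrite subr_ge0 lr.
have L0 : 0 <= L by apply: sumr_ge0 => m _; rewrite subr_ge0 lr.
pose N := (Num.truncn (12 * C * L / eta)).+1.
have N0 : 0 < N%:R :> R by rewrite ltr0n.
have NE n : C * ((right_end n - left_end n) / N%:R) <= eta / 12.
  rewrite mulrA ler_pdivrMr// (le_trans (ler_wpM2l C0 (Ln n)))//.
  have := ltW (truncnS_gt (12 * C * L / eta)); rewrite -/N ler_pdivrMr// => h.
  rewrite (_ : eta / 12 * N%:R = N%:R * eta / 12); last by ring.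
  by rewrite ler_pdivlMr// mulrC mulrA.
pose xk (n : edge) (k : 'I_N.+1) : R := left_end n + k%:R * ((right_end n - left_end n) / N%:R).
have pc i : continuous (fun phi : values => phi i).
  exact: (@proj_continuous _ (fun _ => R) i).
have near_phi : \forall psi \near nbhs phi, forall q : edge * 'I_N.+1 * bool,
    `|phi (q.1.1, xk q.1.1 q.1.2, q.2) - psi (q.1.1, xk q.1.1 q.1.2, q.2)| < d.
  apply: filter_forall => q.
  by have /cvgrPdist_lt/(_ _ d0) := pc (q.1.1, xk q.1.1 q.1.2, q.2) phi.
rewrite near_withinE; apply: filterS near_phi => psi Hq Hpsi.
rewrite rnormE [ltRHS](ge0_realC (ltW e'0)) ltr_realC -/e.
rewrite -(@ltr_sqr R) ?nnegrE ?rnorm_ge0 ?(ltW e0)//.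
apply: le_lt_trans (values_mul_dist (eta := eta) Hpsi Hphi C0 _) _; last first.
  rewrite -mulr_sumr -/v /eta -mulrA mulrCA [ltLHS](_ : _ = e ^+ 2 * (2 * v / (4 * (v + 1)))).
    by rewrite gtr_pMr ?exprn_gt0// ltr_pdivrMr//; lra.
  by ring.
move=> n x b Ex; have [k [Ek xxk]] := mesh (ltn0Sn _ : (0 < N)%N) Ex.
rewrite -/(xk n k) in Ek xxk.
have h1 := Hphi.2 n x (xk n k) b Ex Ek.
have h2 := Hpsi.2 n x (xk n k) b Ex Ek.
have h3 := Hq (n, k, b); rewrite /= in h3.
have h3' : (phi (n, xk n k, b) - psi (n, xk n k, b)) ^+ 2 <= eta / 6.
  by rewrite (le_trans _ d2)// -real_normK ?num_real// ler_sqr ?nnegrE// ltW.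
have hC : C * `|x - xk n k| <= eta / 12 by rewrite (le_trans _ (NE n))// ler_wpM2l.
set p := phi _ in h1 *; set q := psi _ in h2 *.
set p' := phi _ in h1 h3' *; set q' := psi _ in h2 h3' *.
have -> : p - q = (p - p') + (p' - q') - (q - q') by ring.
have sq3 (r s t : R) : (r + s - t) ^+ 2 <= 3 * (r ^+ 2 + s ^+ 2 + t ^+ 2).
  rewrite -subr_ge0 (_ : _ - _ = (r - s) ^+ 2 + (r + t) ^+ 2 + (s + t) ^+ 2).
    by rewrite !addr_ge0 ?sqr_ge0.
  by ring.
apply: le_trans (sq3 _ _ _) _; lra.
Qed.

Lemma values_mul_precompact B C : 0 <= C ->
  precompact [set L2_of (values_mul phi) | phi in hoelder_box B C].
Proof.
move=> C0; exists [set L2_of (values_mul phi) | phi in hoelder_box B C] => //.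
have cK := continuous_compact (values_mul_continuous C0) (@hoelder_box_compact B C).
split => //; apply: compact_closed cK; exact: norm_hausdorff.
Qed.

End Compactness.

(** * Hoelder bounds on the range of the resolvent *)

Section ResolventCompact.
Context {R : realType} (G : metric_graph R).
Local Notation mu := (@lebesgue_measure R).
Local Notation edge := 'I_(nedges G).
Local Notation Re := (@complex.Re R).
Local Notation Im := (@complex.Im R).
Implicit Types (f h k l : L2_space G) (n : edge) (x y t : R) (z : R[i]).

Let lr n : left_end n <= right_end n := ltW (left_lt_right n).

Lemma op_inv_shiftP (T : set (L2_space G * L2_space G)) z f h :
  op_inv (op_shift T z) (f, h) <-> exists2 l, T (h, l) & f = l - z *: h.
Proof.
split=> [[l [k' [/= hl [h' h'h /= k'E] fE]]]|[l hl ->]].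
  by exists l => //; rewrite /op_id /= in h'h; rewrite fE k'E h'h scaleNr.
exists l, (- (z *: h)); split => //; exists h => //=; by rewrite scaleNr.
Qed.

(** Cauchy-Schwarz for the integral of v between x and y. *)
Lemma primitive_hoelder (a b : R) (u v : R -> R) x y : Lp_on `[a, b] 2%:E v ->
  primitive a b u v -> x \in `[a, b] -> y \in `[a, b] ->
  (u x - u y) ^+ 2 <= (\int[mu]_(t in `[a, b]) v t ^+ 2) * `|x - y|.
Proof.
move=> v2 uv; wlog xy : x y / x <= y => [H xab yab|].
  have [/H|/ltW/H yx] := leP x y; first exact.
  by rewrite -sqrrN opprB distrC; exact: yx.
rewrite !in_itv /= => /andP[ax xb] /andP[ay yb].
have mE : measurable (`[a, b]%classic : set R) by exact: measurable_itv.
have iv := Lp2_intable v2; have [_ iv2] := (Lp2P _ mE).1 v2.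
have ivxy := intable_itvS ax yb iv; have iv2xy := intable_itvS ax yb iv2.
rewrite (primitive_sub ax xy yb iv uv) opprD addrA subrr add0r sqrrN.
apply: le_trans (Rintegral_cauchy_schwarz xy ivxy iv2xy) _.
rewrite distrC ger0_norm ?subr_ge0// mulrC ler_wpM2r ?subr_ge0//.
rewrite [leRHS](Rintegral_chasles ax xb iv2).
rewrite (Rintegral_chasles xy yb (intable_itvS ax (lexx b) iv2)).
have ge0 c d : 0 <= \int[mu]_(t in `[c, d]) v t ^+ 2.
  by apply: Rintegral_ge0 => t _; exact: sqr_ge0.
by rewrite addrCA lerDl addr_ge0.
Qed.

(** Off the edges g is arbitrary; the value 0 there keeps every coordinate within the bound of the
    box. *)
Definition values_of (g : graph_fun G) : values G :=
  fun i : edge * R * bool => if `[< edge_set i.1.1 i.1.2 >] then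
    (if i.2 then Im (g i.1.1 i.1.2) else Re (g i.1.1 i.1.2)) else 0.

Lemma values_ofE g n x b : edge_set n x ->
  values_of g (n, x, b) = if b then Im (g n x) else Re (g n x).
Proof. by move=> Ex; rewrite /values_of asboolT. Qed.

Lemma values_of_hoelder (g g1 g2 : graph_fun G) (B C : R) : regular g g1 g2 ->
  0 <= B -> (forall n x, edge_set n x -> msq (g n x) <= B ^+ 2) ->
  (forall n, \int[mu]_(x in edge_set n) msq (g1 n x) <= C) ->
  hoelder_box B C (values_of g).
Proof.
move=> H B0 gB gC; split=> [[[n x] b]|n x y b Ex Ey].
  rewrite in_itv /= -ler_norml; have [Ex|Ex] := pselect (edge_set n x); last first.
    by rewrite /values_of asboolF// normr0.
  rewrite values_ofE// -(@ler_sqr R) ?nnegrE// real_normK ?num_real//.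
  by apply: le_trans (gB n x Ex); rewrite /msq; case: b; rewrite ?lerDl ?lerDr sqr_ge0.
rewrite !values_ofE//; have [g2L g1E gE] := H n; have mE := measurable_edge_set n.
have [g11 g12] := regular1 H n; have [gE1 gE2] := (is_primitiveP _ _ _ _).1 gE.
have [_ i1] := (Lp2P _ mE).1 g11; have [_ i2] := (Lp2P _ mE).1 g12.
case: b.
  apply: le_trans (primitive_hoelder g12 gE2 Ex Ey) _.
  rewrite ler_wpM2r// (le_trans _ (gC n))//.
  apply: (@le_Rintegral _ _ _ mu) => //; first exact: (intable_msq mE (regular1 H n)).
  by move=> t _; rewrite /msq lerDr sqr_ge0.
apply: le_trans (primitive_hoelder g11 gE1 Ex Ey) _.
rewrite ler_wpM2r// (le_trans _ (gC n))//.
apply: (@le_Rintegral _ _ _ mu) => //; first exact: (intable_msq mE (regular1 H n)).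
by move=> t _; rewrite /msq lerDl sqr_ge0.
Qed.

(* The energy of h is the inner product of A h = f + z h with h. *)
Lemma resolvent_hoelder_box (M : R) z : 0 <= M -> exists B C, 0 <= C /\
  forall f h l, schrodinger (fun _ _ => 0) (h, l) -> f = l - z *: h ->
    rnorm f <= 1 -> rnorm h <= M ->
    exists g g1 g2, [/\ regular g g1 g2, repr_by h g & hoelder_box B C (values_of g)].
Proof.
move=> M0; pose zr := Re `|z|.
have zr0 : 0 <= zr by rewrite -ler_realC -ge0_realC//; exact: normr_ge0.
(* The norm of l is at most 1 + |z| M, so 2 Re <l, h> <= C. Below, D is the Sobolev bound for |g|^2
   with e = 1, and 1 + D serves as a bound for |g| because D <= (1 + D)^2. *)
pose C := (1 + zr * M) ^+ 2 + M ^+ 2.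
have C0 : 0 <= C by rewrite addr_ge0 ?sqr_ge0.
pose D := C + \sum_(n : edge) (1 + (right_end n - left_end n)^-1) * M ^+ 2.
have D1 n : 0 <= 1 + (right_end n - left_end n)^-1.
  by rewrite addr_ge0// invr_ge0 subr_ge0 lr.
have D0 : 0 <= D by rewrite addr_ge0// sumr_ge0// => n _; rewrite mulr_ge0 ?sqr_ge0.
exists (1 + D), C; split=> // f h l [g [g1 [g2 [H kg hE lE]]]] fE f1 hM.
exists g, g1, g2; split=> //.
have lM : rnorm l <= 1 + zr * M.
  rewrite (_ : l = f + z *: h); last by rewrite fE subrK.
  by rewrite (le_trans (rnormD _ _))// lerD// rnormZ ler_wpM2l.
have energy : \sum_n \int[mu]_(x in edge_set n) msq (g1 n x) <= C.
  have := rip_le l h; rewrite /rip (form_energy (@potential0 R G) H kg hE lE) /=.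
  rewrite (eq_bigr (fun n => \int[mu]_(x in edge_set n) msq (g1 n x))); last first.
    move=> n _; under [X in _ + X]eq_Rintegral do rewrite mul0r.
    by rewrite /Rintegral integral0 addr0.
  set E := \sum_n _.
  have E0 : 0 <= E.
    by apply: sumr_ge0 => n _; apply: Rintegral_ge0 => x _; exact: msq_ge0.
  have l2 : rnorm l ^+ 2 <= (1 + zr * M) ^+ 2.
    by rewrite ler_sqr ?nnegrE ?rnorm_ge0// addr_ge0// mulr_ge0.
  have h2 : rnorm h ^+ 2 <= M ^+ 2 by rewrite ler_sqr ?nnegrE ?rnorm_ge0.
  by rewrite /C; lra.
have g1C n : \int[mu]_(x in edge_set n) msq (g1 n x) <= C.
  rewrite (le_trans _ energy)// (bigD1 n)//= lerDl sumr_ge0// => m _.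
  by apply: Rintegral_ge0 => x _; exact: msq_ge0.
have gM n : \int[mu]_(x in edge_set n) msq (g n x) <= M ^+ 2.
  have h2 : rnorm h ^+ 2 <= M ^+ 2 by rewrite ler_sqr ?nnegrE ?rnorm_ge0.
  rewrite (le_trans _ h2)// (rnorm_sqr (regular0 H) hE) /sqnorm (bigD1 n)//=.
  by rewrite lerDl sumr_ge0// => m _; apply: Rintegral_ge0 => x _; exact: msq_ge0.
apply: (values_of_hoelder H _ _ g1C); first by rewrite addr_ge0.
move=> n x Ex; apply: le_trans (sobolev_msq ltr01 (H n) Ex) _.
rewrite mul1r invr1; apply: (@le_trans _ _ D).
  rewrite /D lerD ?g1C// (bigD1 n)//= (le_trans (ler_wpM2l (D1 n) (gM n)))// lerDl.
  by rewrite sumr_ge0// => m _; rewrite mulr_ge0 ?sqr_ge0.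
by rewrite expr2 mulrDl mul1r (le_trans (_ : D <= 1 + D)) ?lerDr// lerDl mulr_ge0// addr_ge0.
Qed.

(** For f in the unit ball, h = (A_N - z)^-1 f has norm at most |M|, so its regular representative
    lies in one fixed box; V h then lies in the continuous image of that compact box. *)
Theorem multiplication_resolvent_compact (V : edge -> R -> R) z : potential V ->
  resolvent_set (neumann_laplacian G) z ->
  compact_operator (op_comp (multiplication_operator V)
    (op_inv (op_shift (neumann_laplacian G) z))).
Proof.
move=> V2; rewrite neumann_schrodinger => -[[L0 Llin Lfun] Ldom [M LM]].
set A := op_inv _ in L0 Llin Lfun Ldom LM *.
(* V h may be computed on the regular representative of h, where boundedness is available. *)
have mulE h k (g g1 g2 : graph_fun G) : regular g g1 g2 -> repr_by h g ->
    multiplication_operator V (h, k) <-> repr_by k (fun n x => (V n x)%:C * g n x).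
  move=> H hE; split => kE n.
    by apply: ae_onS2 (hE n) (kE n) => t _ /= -> ->.
  by apply: ae_onS2 (hE n) (kE n) => t _ /= -> ->.
split.
- split.
  + exists 0; first exact: L0.
    move=> n; apply: ae_onS2 (@repr_by0 R G n) (@repr_by0 R G n) => t _ /= -> _.
    by rewrite mulr0.
  + move=> c [f k] [f' k'] [h /= fh hk] [h' /= fh' hk'].
    exists (c *: h + h'); first exact: (Llin c _ _ fh fh').
    move=> n /=.
    apply: ae_onS2 (ae_onS2 (fun x _ p q => conj p q) (hk n) (hk' n))
      (ae_onS2 (fun x _ p q => conj p q) (L2_repr_lin c h h' n) (L2_repr_lin c k k' n)).
    move=> t _ /= [-> ->] [-> ->].
    by rewrite mulrDr mulrCA.
  + move=> f k k' [h /= fh hk] [h' /= fh' hk'].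
    have hh := Lfun _ _ _ fh fh'; rewrite -hh in hk'.
    by apply: (repr_by_inj (f := fun n x => (V n x)%:C * L2_repr h n x)) => n;
      [exact: hk|exact: hk'].
- apply/seteqP; split => // f _; have : op_dom A f by rewrite Ldom.
  move=> [h fh]; have /op_inv_shiftP[l [g [g1 [g2 [H kg hE lE]]]] fE] := fh.
  exists (L2_of (fun n x => (V n x)%:C * g n x)), h => //.
  exact/(mulE _ _ _ _ _ H hE)/L2_ofE/(potential_mul V2 H).
- have [B [C [C0 HBC]]] := resolvent_hoelder_box z (normr_ge0 M).
  apply: precompact_subset (values_mul_precompact V2 B C0) => k [f f1 [h /= fh hk]].
  have /op_inv_shiftP[l hl fE] := fh.
  have f1' : rnorm f <= 1 by rewrite -ler_realC -rnormE.
  have hM : rnorm h <= `|M|.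
    have := LM _ _ fh; rewrite !rnormE -rmorphM ler_realC => /le_trans; apply.
    rewrite (le_trans (ler_wpM2r (rnorm_ge0 _) (ler_norm M)))// ler_piMr//.
  have [g [g1 [g2 [H hE box]]]] := HBC _ _ _ hl fE f1' hM.
  exists (values_of g) => //.
  apply: (repr_by_inj (L2_ofE (values_mul_L2 V2 box C0))).
  apply: eq_repr_by ((mulE _ _ _ _ _ H hE).1 hk) => n; apply: ae_on_all => x Ex.
  rewrite /values_mul /values_fun !values_ofE//; by case: (g n x).
Qed.

End ResolventCompact.

(** * Self-adjointness, compactness and negative spectrum for an L^p potential *)

Theorem corollary3p4 (R : realType) (G : metric_graph R) (p : \bar R)
    (V : 'I_(nedges G) -> R -> R)
    (p_ge2 : (2%:E <= p)%E)
    (V_Lp : Lp_graph p V)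
    (V_ge0 : ae_graph (fun n x => 0 <= V n x))
    (V_neq0 : ~ ae_graph (fun n x => V n x = 0)) :
  let A := neumann_laplacian G in
  let M := multiplication_operator V in
  let AV (alpha : R) := op_add A (op_scale alpha%:C M) in
  [/\ forall alpha : R,
        op_dom (AV alpha) = op_dom A /\ self_adjoint (@L2_ip R G) (AV alpha),
      forall z : R[i], resolvent_set A z ->
        compact_operator (op_comp M (op_inv (op_shift A z)))
    & forall alpha : R, alpha < 0 ->
        spectrum (AV alpha) `&` [set t%:C | t in `]-oo, 0%R[] !=set0].
Proof.
(* Edges have finite length, so L^p is contained in L^2 for p >= 2. *)
have V2 : potential V.
  move=> n; apply: Lp_on_ge2 p_ge2 (V_Lp n); first exact: measurable_edge_set.
  exact: lebesgue_measure_itv_lty.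
move=> A M AV; have AVE a : AV a = schrodinger (fun n x => a * V n x).
  exact: neumann_add_schrodinger.
split=> [a|z zA|a a0].
- rewrite AVE; split; last exact: schrodinger_self_adjoint (potentialZ a V2).
  rewrite /A neumann_schrodinger; apply/seteqP; split; apply: schrodinger_dom.
    exact: potential0.
  exact: potentialZ.
- exact: multiplication_resolvent_compact.
- have [f [h [fh neg]]] := constant_negative_form V2 V_ge0 V_neq0 a0.
  rewrite AVE; exact: negative_spectrum (potentialZ a V2) fh neg.
Qed.
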